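(* Let $T>0$ and let $g:[0,\infty)\to\mathbb R$ be an integrable function such that $$a(h)=-\frac{\mathrm d}{\mathrm dh}\int_0^\infty g(s)g(h+s)\,\mathrm ds,\qquad h\ge0,$$ is a trawl function. For $n\in\mathbb N$ let $X^{(n)}_t=L^{(n)}(A_t)$ be the trawl process with this trawl function $a$ driven by a homogeneous Lévy basis $L^{(n)}$ on $\mathbb R^2$ with characteristic triplet $(\gamma^{(n)},b^{(n)},\nu^{(n)})$. Assume that $a$ is monotone and that for some $\epsilon\in(0,\infty)$, $C\in(0,\infty)$ and $C_T\in(0,T^{-(1+\epsilon)}]$: $$\mathrm{Leb}(A_t\setminus A_s)\le C(t-s)^{\frac12+\frac\epsilon2}\quad\text{for all } s\le t \text{ in } \mathbb R,$$ $$\mathrm{Leb}\big((A_s\setminus A_t)\setminus A_r\big)\le C_T(t-r)^{1+\epsilon}\quad\text{for all } r\le s\le t\text{ in }[0,T].$$ Assume further that, as $n\to\infty$, $\int_{\mathbb R}\frac{x^2}{n}\nu^{(n)}(\mathrm dx)\to1$, $\int_{\mathbb R}\frac{|x|^3}{n\sqrt n}\nu^{(n)}(\mathrm dx)\to0$, $\frac{(b^{(n)})^2}{n}\to0$, and that $\int_{\mathbb R}\frac{x^4}{n^2}\nu^{(n)}(\mathrm dx)$ is bounded uniformly in $n$. Then, as $n\to\infty$, $$\Big\{\frac1{\sqrt n}\big(X^{(n)}_t-\mathbb E[X^{(n)}_t]\big)\Big\}_{t\in[0,T]}\ \overset{d}{\rightarrow}\ \Big\{\int_{-\infty}^tg(t-s)\,\mathrm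 dB_s\Big\}_{t\in[0,T]},$$ as processes in the Skorokhod space $\mathcal D[0,T]$, where $B$ is a one-dimensional (two-sided) Brownian motion.
   Context: Lévy basis. A homogeneous Lévy basis on $\mathbb{R}^2$ with characteristic triplet $(\gamma,b,\nu)$ ($\gamma\in\mathbb R$, $b\ge0$, $\nu$ a Lévy measure on $\mathbb R$) is a family $L=\{L(A)\}$ of real random variables, indexed by Borel sets $A\subset\mathbb{R}^2$ of finite Lebesgue measure, that is a.s. $\sigma$-additive, takes independent values on disjoint sets, and satisfies $\log\mathbb{E}e^{izL(A)}=\mathrm{Leb}(A)\psi(z)$ with $\psi(z)=i\gamma z-\frac12b^2z^2+\int_{\mathbb{R}\setminus\{0\}}(e^{izx}-1-izx\mathbf 1_{|x|\le1})\nu(\mathrm{d}x)$. Trawl process. A trawl function is a non-increasing integrable function $a:[0,\infty)\to[0,\infty)$; its trawl set is $A=\{(r,y):r\le0,\ 0\le y\le a(-r)\}$, $A_t=A+(t,0)$, and the trawl process driven by $L$ is $X_t=L(A_t)$, $t\in\mathbb R$. Note that $\mathrm{Leb}((A_s\setminus A_t)\setminus A_r)=\int_r^s(a(s-p)-a(t-p))\,\mathrm dp$ for $r\le s\le t$. $\mathrm{Leb}$ denotes Lebesgue measure. *)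

(* Defs.v *)
From HB Require Import structures.
From mathcomp Require Import all_boot all_order all_algebra.
From mathcomp Require Import all_classical all_reals all_analysis.
From mathcomp Require Import complex.

Set Implicit Arguments.
Unset Strict Implicit.
Unset Printing Implicit Defensive.

Import Order.TTheory GRing.Theory Num.Theory.
Import numFieldNormedType.Exports.

Local Open Scope classical_set_scope.
Local Open Scope complex_scope.
Local Open Scope ring_scope.

Section Complex.
Context {R : realType}.

Definition cexp (z : R[i]) : R[i] :=
  (expR (complex.Re z))%:C * (cos (complex.Im z) +i* sin (complex.Im z)).

Definition cintegral d (T : measurableType d) (mu : {measure set T -> \bar R})
    (D : set T) (f : T -> R[i]) : R[i] :=
  (\int[mu]_(x in D) complex.Re (f x)) +i* (\int[mu]_(x in D) complex.Im (f x)).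

Definition char_fun d (T : measurableType d) (P : probability T R)
    (X : T -> R) (z : R) : R[i] :=
  cintegral P setT (fun w => cexp (0 +i* (z * X w))).

End Complex.

(* Since each [B i] may be [setT], the product rule for the whole finite family
   contains the product rule for all its subfamilies. *)
Definition mutually_independent {R : realType} d (Om : measurableType d)
    (P : probability Om R) (k : nat) (X : 'I_k -> Om -> R) : Prop :=
  forall B : 'I_k -> set (measurableTypeR R), (forall i, measurable (B i)) ->
    P (\bigcap_(i in [set: 'I_k]) (X i @^-1` B i)) =
    (\prod_(i < k) P (X i @^-1` B i))%E.

Section LevyBasis.
Context {R : realType}.

Definition leb2 : set (measurableTypeR R * measurableTypeR R) -> \bar R :=
  (@lebesgue_measure R \x @lebesgue_measure R)%E.

Definition finite_borel (A : set (measurableTypeR R * measurableTypeR R)) :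
  Prop := measurable A /\ (leb2 A < +oo)%E.

Definition levy_measure (nu : {measure set (measurableTypeR R) -> \bar R}) :
    Prop :=
  nu [set 0] = 0%E /\ (\int[nu]_x (Num.min 1 (x ^+ 2))%:E < +oo)%E.

Definition levy_exponent (gamma b : R)
    (nu : {measure set (measurableTypeR R) -> \bar R}) (z : R) : R[i] :=
  (0 +i* (gamma * z)) - (2^-1 * b ^+ 2 * z ^+ 2)%:C
  + cintegral nu [set~ 0] (fun x : R =>
      cexp (0 +i* (z * x)) - 1 - (0 +i* (z * x * \1_(`[-1, 1]%classic) x))).

(* The identity log E exp(izL(A)) = Leb(A) psi(z) refers to the continuous
   logarithm vanishing at z = 0. As psi is continuous with psi(0) = 0, it is the
   exponentiated identity required of every real z below. *)
Definition levy_basis d (Om : measurableType d) (P : probability Om R)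
    (L : set (measurableTypeR R * measurableTypeR R) -> Om -> R)
    (gamma b : R) (nu : {measure set (measurableTypeR R) -> \bar R}) : Prop :=
  [/\ forall A, finite_borel A -> measurable_fun setT (L A),
      forall F : nat -> set (measurableTypeR R * measurableTypeR R),
        (forall i, finite_borel (F i)) -> trivIset setT F ->
        finite_borel (\bigcup_i F i) ->
        {ae P, forall w,
           (\sum_(0 <= i < n) L (F i) w) @[n --> \oo] --> L (\bigcup_i F i) w},
      forall (k : nat) (F : 'I_k -> set (measurableTypeR R * measurableTypeR R)),
        (forall i, finite_borel (F i)) -> trivIset setT F ->
        mutually_independent P (fun i => L (F i)) &
      forall A, finite_borel A -> forall z : R,
        char_fun P (L A) z =
        cexp ((fine (leb2 A))%:C * levy_exponent gamma b nu z)].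

End LevyBasis.

Section Trawl.
Context {R : realType}.

(* Functions on [0, oo) are encoded as functions on R whose values on the
   negative half-line are never used. *)
Definition trawl_function (a : R -> R) : Prop :=
  [/\ forall h, 0 <= h -> 0 <= a h,
      forall h k, 0 <= h -> h <= k -> a k <= a h &
      lebesgue_measure.-integrable `[0, +oo[ (EFin \o a)].

Definition monotone_half_line (a : R -> R) : Prop :=
  (forall h k, 0 <= h -> h <= k -> a h <= a k) \/
  (forall h k, 0 <= h -> h <= k -> a k <= a h).

Definition trawl_set (a : R -> R) :
    set (measurableTypeR R * measurableTypeR R) :=
  [set p | p.1 <= 0 /\ 0 <= p.2 <= a (- p.1)].

Definition shifted_trawl_set (a : R -> R) (t : R) :
    set (measurableTypeR R * measurableTypeR R) :=
  (fun p => (p.1 + t, p.2)) @` trawl_set a.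

Definition overlap (g : R -> R) (h : R) : R :=
  \int[lebesgue_measure]_(s in `[0, +oo[) (g s * g (h + s)).

(* The derivative on [0, oo) is one-sided at h = 0; the restriction 0 <= h + k
   is void near k = 0 when h > 0. The integrability clause makes the integral
   defining [overlap g h] meaningful, as [Rintegral] is total. *)
Definition trawl_from_kernel (g a : R -> R) : Prop :=
  (forall h, 0 <= h ->
     lebesgue_measure.-integrable `[0, +oo[ (fun s => (g s * g (h + s))%:E)) /\
  (forall h, 0 <= h ->
     (overlap g (h + k) - overlap g h) / k
       @[k --> within [set k | 0 <= h + k] 0^'] --> - a h).

End Trawl.

Section Skorokhod.
Context {R : realType}.

Definition cadlag (T : R) (x : R -> R) : Prop :=
  (forall t, 0 <= t < T -> x s @[s --> t^'+] --> x t) /\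
  (forall t, 0 < t <= T -> cvg (x s @[s --> t^'-])).

Definition time_change (T : R) (lam : R -> R) : Prop :=
  [/\ lam 0 = 0, lam T = T,
      forall s t, 0 <= s -> s < t -> t <= T -> lam s < lam t &
      {within `[0, T], continuous lam}].

Definition skorokhod_dist (T : R) (x y : R -> R) : R :=
  inf [set e | 0 <= e /\ exists2 lam, time_change T lam &
         forall t, 0 <= t <= T ->
           `|lam t - t| <= e /\ `|x t - y (lam t)| <= e].

(* Elements of D[0,T] are represented by functions on R that are cadlag on
   [0,T]. Two functions equal on [0,T] are at distance 0, so that a functional
   continuous in this sense depends on the restriction to [0,T] only. *)
Definition skorokhod_continuous (T : R) (F : (R -> R) -> R) : Prop :=
  forall x, cadlag T x -> forall e, 0 < e -> exists2 del, 0 < del &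
    forall y, cadlag T y -> skorokhod_dist T x y < del -> `|F x - F y| < e.

(* A random element of D[0,T]: the Borel sigma-algebra of D[0,T] is generated
   by the coordinate maps. *)
Definition cadlag_process (T : R) d (Om : measurableType d)
    (X : R -> Om -> R) : Prop :=
  (forall w, cadlag T (X ^~ w)) /\
  (forall t, 0 <= t <= T -> measurable_fun setT (X t)).

Definition skorokhod_cvg_in_law (T : R)
    (d : nat -> measure_display) (Om : forall n, measurableType (d n))
    (P : forall n, probability (Om n) R) (X : forall n, R -> Om n -> R)
    (d' : measure_display) (Om' : measurableType d') (P' : probability Om' R)
    (Y : R -> Om' -> R) : Prop :=
  forall F : (R -> R) -> R, skorokhod_continuous T F ->
    (exists M, forall x, cadlag T x -> `|F x| <= M) ->
    ('E_(P n)[fun w => F (X n ^~ w)])%E @[n --> \oo] -->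
    ('E_P'[fun w => F (Y ^~ w)])%E.

End Skorokhod.

Section Wiener.
Context {R : realType} d (Om : measurableType d) (P : probability Om R).

Definition two_sided_brownian_motion (B : R -> Om -> R) : Prop :=
  [/\ forall t, measurable_fun setT (B t),
      {ae P, forall w, B 0 w = 0},
      {ae P, forall w, continuous (B ^~ w)},
      forall s t, s < t -> forall A : set (measurableTypeR R), measurable A ->
        P ((fun w => B t w - B s w) @^-1` A) =
        normal_prob 0 (Num.sqrt (t - s)) A &
      forall (k : nat) (t : nat -> R), (forall i, t i <= t i.+1) ->
        mutually_independent P
          (fun (i : 'I_k) w => B (t i.+1) w - B (t i) w)].

(* The list [l] of triples (c, u, v) encodes the step function
   \sum c * 1_(u, v]. *)
Definition step_fun (l : seq (R * R * R)) (s : R) : R :=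
  \sum_(p <- l) p.1.1 * \1_(`]p.1.2, p.2]%classic) s.

Definition step_integral (B : R -> Om -> R) (l : seq (R * R * R)) (w : Om) : R :=
  \sum_(p <- l) p.1.1 * (B p.2 w - B p.1.2 w).

(* [I] is a version of the integral of the deterministic [f] against [B]: the
   L^2(P)-limit of the integrals of step functions converging to [f] in
   L^2(Leb). *)
Definition is_wiener_integral (B : R -> Om -> R) (f : R -> R) (I : Om -> R) :
    Prop :=
  measurable_fun setT I /\
  exists l : nat -> seq (R * R * R),
    [/\ forall k p, p \in l k -> p.1.2 <= p.2,
        (\int[lebesgue_measure]_s ((f s - step_fun (l k) s) ^+ 2)%:E)%E
          @[k --> \oo] --> 0%E &
        ('E_P[fun w => ((I w - step_integral B (l k) w) ^+ 2)%R])%E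
          @[k --> \oo] --> 0%E].

Definition moving_average_kernel (g : R -> R) (t s : R) : R :=
  if s <= t then g (t - s) else 0.

End Wiener.

(* Main.v *)
Require Import Defs.
From HB Require Import structures.
From mathcomp Require Import all_boot all_order all_algebra.
From mathcomp Require Import all_classical all_reals all_analysis.
From mathcomp Require Import complex.
From mathcomp Require Import measurable_realfun zify ring lra.

Set Implicit Arguments.
Unset Strict Implicit.
Unset Printing Implicit Defensive.

Import Order.TTheory GRing.Theory Num.Theory.
Import numFieldNormedType.Exports.

Local Open Scope classical_set_scope.
Local Open Scope ring_scope.

(** Finite-dimensional laws. The trawl sets [A_(t_j)] are unions of disjoint
    atoms, on which the Levy basis takes independent values. With [q S] the area
    of the atom [S] and [th_S] the sum of [th_j] over [j] in [S], the
    characteristic exponent of [sum_j th_j X_(t_j)] is [sum_S q S * psi (th_S)];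
    after centring and rescaling, the moment assumptions make it converge to
    [- sum_S q S * th_S ^ 2 / 2], in which only the areas of
    [A_s `&` A_t] enter. Such an area is the integral of [a] over the half-line
    [|s - t|, oo), hence equals [overlap g |s - t|], both functions having the
    same derivative and vanishing at infinity. This is the covariance of the
    Wiener integrals.

    Tightness. Fatou's lemma applied to
    [(1 - cos (z U)) (1 - cos (z V)) / z ^ 4] turns the exponent into the bound
    [E (X_s - X_r) ^ 2 (X_t - X_s) ^ 2 <= K (t - r) ^ (1 + eps)], uniformly in
    [n] after rescaling. Chaining over dyadic points bounds the distance between
    a path and its step approximation on the grid of mesh [T / k], outside an
    event controlled by [K] and by the increments along the grid, hence by
    finitely many coordinates.

    Conclusion. The Skorokhod distance is at most the uniform one, so a bounded
    Skorokhod-continuous [F] is, at cadlag paths, the limit of the minorants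
    [inf_y (F y + m * |x - y|)]. Evaluated at the step approximation these are
    Lipschitz functions of finitely many coordinates, whose expectations converge
    by approximation with trigonometric polynomials. This gives
    [E F(Y) <= liminf E F(X^n)], and the same for [- F]. *)

(** * Trigonometric inequalities *)

(** The trawl processes jump, so moments of single increments do not give tightness: the fourth
    moment of [X_t - X_s] contains the area of the symmetric difference of [A_s] and [A_t] to the
    first power, for which only the exponent [1/2 + eps/2] is available. In the product of two
    adjacent squared increments this term keeps only the area of [(A_s \ A_t) \ A_r], to which the
    second condition on the trawl gives the exponent [1 + eps]; the remaining term is quadratic in
    areas, which doubles [1/2 + eps/2]. Such a bound controls only the smaller of two adjacent
    increments. The increments along the grid are controlled in the limit, where the Gaussian fourth
    moment is quadratic in the variance, and the control is carried back to large [n] by the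
    convergence of finitely many coordinates. This is why paths can be compared in the uniform
    distance although they jump. A Skorokhod-continuous [F] evaluated at a process is not known to
    be a measurable function of the outcome, so its expectations are reached only through pointwise
    comparison with measurable functions. *)

Section Taylor.
Context {R : realType}.
Implicit Types x y K : R.

(** The mean value theorem turns a bound on the derivative into one with an additional power of [y].
    Most of the estimates below iterate it, with constants that are not optimal. *)
Lemma derive_lipschitz (f df : R -> R) y K :
  (forall x, is_derive x 1 f (df x)) ->
  (forall x, `|x| <= `|y| -> `|df x| <= K) -> `|f y - f 0| <= K * `|y|.
Proof.
move=> fdf dfK.
have cf a b : {within `[a, b], continuous f}.
  apply: continuous_subspaceT => x.
  by apply/differentiable_continuous/derivable1_diffP; case: (fdf x).
have [y0|y0] := leP 0 y.
  have [c cin ->] := MVT_segment y0 (fun x _ => fdf x) (cf _ _).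
  rewrite subr0 normrM ler_wpM2r// dfK//.
  by move: cin; rewrite in_itv/= => /andP[c0 cy]; rewrite !ger0_norm.
have [c cin E] := MVT_segment (ltW y0) (fun x _ => fdf x) (cf _ _).
rewrite distrC E sub0r normrM normrN ler_wpM2r// dfK//.
move: cin; rewrite in_itv/= => /andP[c0 cy].
by rewrite !ler0_norm ?lerN2// ltW.
Qed.

Lemma sin_le_norm y : `|sin y| <= `|y|.
Proof.
rewrite -[sin y]subr0 -[in X in _ - X](@sin0 R) -[leRHS]mul1r.
by apply: (@derive_lipschitz _ cos) => x _; exact: cos_max.
Qed.

Lemma cosB1_le y : `|cos y - 1| <= y ^+ 2.
Proof.
rewrite -(@cos0 R) -real_normK ?num_real// expr2.
by apply: (@derive_lipschitz _ (fun x => - sin x)) => x xy; rewrite normrN (le_trans (sin_le_norm _)).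
Qed.

Lemma sinB_le3 y : `|sin y - y| <= `|y| ^+ 3.
Proof.
have -> : sin y - y = (sin y - y) - (sin 0 - 0) by rewrite sin0 !subr0.
rewrite exprSr.
apply: (@derive_lipschitz (fun x => sin x - x) (fun x => cos x - 1)) => x xy.
by rewrite (le_trans (cosB1_le _))// -real_normK ?num_real// lerXn2r ?nnegrE.
Qed.

(** Cubic near 0 and linear far away, hence quadratic everywhere. Two powers are what second moments
    can integrate, whereas [sinB_le3] needs a third moment. *)
Lemma sinB_le2 y : `|sin y - y| <= 2 * y ^+ 2.
Proof.
rewrite -[y ^+ 2]real_normK ?num_real//.
have [y1|y1] := leP `|y| 1.
  rewrite (le_trans (sinB_le3 _))// exprS.
  by have := normr_ge0 y; move: `|y| y1 => a; nra.
rewrite (le_trans (ler_normB _ _))//.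
by have := sin_max y; move: `|y| `|sin y| y1 => a b; nra.
Qed.

Lemma cosB_le3 y : `|cos y - 1 + y ^+ 2 / 2| <= 2 * `|y| ^+ 3.
Proof.
have /(_ y) := @derive_lipschitz (fun x => cos x - 1 + x ^+ 2 / 2)
  (fun x => - sin x + x) _ (2 * `|y| ^+ 2).
rewrite cos0 subrr expr0n/= mul0r addr0 subr0.
rewrite [X in _ -> _ <= X](_ : _ = 2 * `|y| ^+ 2 * `|y|); last by rewrite -mulrA -exprSr.
apply=> x.
  apply: is_derive_eq.
  by rewrite /GRing.scale/=; field.
move=> xy; rewrite addrC -normrN opprB (le_trans (sinB_le2 _))// ler_wpM2l//.
by rewrite -real_normK ?num_real// lerXn2r ?nnegrE.
Qed.

Lemma expRN_le (a : R) : 0 <= a -> expR (- a) <= 1 - a + a ^+ 2.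
Proof.
move=> a0; have a1 : 0 < 1 + a by lra.
rewrite expRN (@le_trans _ _ (1 + a)^-1)//.
  by rewrite lef_pV2 ?posrE ?expR_gt0// expR_ge1Dx.
rewrite -[leLHS]mul1r ler_pdivrMr//.
have -> : (1 - a + a ^+ 2) * (1 + a) = 1 + a ^+ 3 by ring.
by rewrite lerDl exprn_ge0.
Qed.

Lemma cos_lip (x y : R) : `|cos x - cos y| <= `|x - y|.
Proof.
wlog xy : x y / x <= y.
  by move=> H; have [/H//|/ltW/H] := leP x y; rewrite distrC [leRHS]distrC.
have cc : {within `[x, y], continuous (@cos R)}.
  exact/continuous_subspaceT/continuous_cos.
have [c _ E] := MVT_segment xy (fun z _ => is_derive_cos z) cc.
by rewrite distrC E distrC normrM normrN ler_piMl// sin_max.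
Qed.

Lemma sin_lip (x y : R) : `|sin x - sin y| <= `|x - y|.
Proof. by rewrite -!cosBpihalf (le_trans (cos_lip _ _))// opprB addrA subrK. Qed.

End Taylor.

Lemma integrable_bigsum {R : realType} d {T : measurableType d} (mu : {measure set T -> \bar R})
    I (s : seq I) (F : I -> T -> R) :
  (forall i, mu.-integrable setT (EFin \o F i)) ->
  mu.-integrable setT (EFin \o (fun w => \sum_(i <- s) F i w)).
Proof.
move=> iF; apply: (eq_integrable _ (fun w => \sum_(i <- s) (EFin \o F i) w)%E) => //.
  by move=> w _; rewrite /= sumEFin.
by apply: integrable_sum => // i _; exact: iF.
Qed.

Lemma Rintegral_sum {R : realType} d {T : measurableType d} (mu : {measure set T -> \bar R})
    I (s : seq I) (F : I -> T -> R) :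
  (forall i, mu.-integrable setT (EFin \o F i)) ->
  \int[mu]_w (\sum_(i <- s) F i w) = \sum_(i <- s) \int[mu]_w F i w.
Proof.
move=> iF; elim: s => [|i s IH].
  rewrite big_nil; under eq_Rintegral do rewrite big_nil.
  by rewrite /Rintegral integral0.
rewrite big_cons -IH -RintegralD//; first by under eq_Rintegral do rewrite big_cons.
exact: integrable_bigsum.
Qed.

(** * Characteristic functions and independence *)

Section BoundedExpectation.
Context {R : realType} {d} {T : measurableType d} (P : probability T R).
Implicit Types (f g : T -> R).

Definition bounded_rv f := measurable_fun setT f /\ exists M : R, forall w, `|f w| <= M.

Lemma bounded_rv_integrable f : bounded_rv f -> P.-integrable setT (EFin \o f).
Proof.
move=> [mf [M fM]]; apply: measurable_bounded_integrable => //.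
  by rewrite ltey_eq fin_num_measure.
by exists M; split; [exact: num_real|move=> x Mx w _; exact: le_trans (fM w) (ltW Mx)].
Qed.

Lemma bounded_rv_cst (c : R) : bounded_rv (cst c).
Proof. by split; [exact: measurable_cst|exists `|c|]. Qed.

Lemma bounded_rvD f g : bounded_rv f -> bounded_rv g -> bounded_rv (fun w => f w + g w).
Proof.
move=> [mf [M fM]] [mg [N gN]]; split; first exact: measurable_funD.
by exists (M + N) => w; rewrite (le_trans (ler_normD _ _))// lerD.
Qed.

Lemma bounded_rvM f g : bounded_rv f -> bounded_rv g -> bounded_rv (fun w => f w * g w).
Proof.
move=> [mf [M fM]] [mg [N gN]]; split; first exact: measurable_funM.
by exists (M * N) => w; rewrite normrM ler_pM.
Qed.

Lemma bounded_rvB f g : bounded_rv f -> bounded_rv g -> bounded_rv (fun w => f w - g w).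
Proof.
move=> [mf [M fM]] [mg [N gN]]; split; first exact: measurable_funB.
by exists (M + N) => w; rewrite (le_trans (ler_normB _ _))// lerD.
Qed.

Lemma bounded_rv_sum I (s : seq I) (p : pred I) (F : I -> T -> R) :
  (forall i, bounded_rv (F i)) -> bounded_rv (fun w => \sum_(i <- s | p i) F i w).
Proof.
move=> bF; elim: s => [|i s IH].
  by under [X in bounded_rv X]eq_fun do rewrite big_nil; exact: bounded_rv_cst.
under [X in bounded_rv X]eq_fun do rewrite big_cons.
by case: (p i) => //; exact: bounded_rvD.
Qed.

Lemma bounded_rv_prod I (s : seq I) (p : pred I) (F : I -> T -> R) :
  (forall i, bounded_rv (F i)) -> bounded_rv (fun w => \prod_(i <- s | p i) F i w).
Proof.
move=> bF; elim: s => [|i s IH].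
  by under [X in bounded_rv X]eq_fun do rewrite big_nil; exact: bounded_rv_cst.
under [X in bounded_rv X]eq_fun do rewrite big_cons.
by case: (p i) => //; exact: bounded_rvM.
Qed.

Lemma bounded_rv_cos f : measurable_fun setT f -> bounded_rv (cos \o f).
Proof.
move=> mf; split; last by exists 1 => w; exact: cos_max.
apply: measurableT_comp => //; apply: continuous_measurable_fun; exact: continuous_cos.
Qed.

Lemma bounded_rv_sin f : measurable_fun setT f -> bounded_rv (sin \o f).
Proof.
move=> mf; split; last by exists 1 => w; exact: sin_max.
apply: measurableT_comp => //; apply: continuous_measurable_fun; exact: continuous_sin.
Qed.

Lemma bounded_rv_indic (A : set T) : measurable A -> bounded_rv \1_A.
Proof.
by move=> mA; split => //; exists 1 => w; rewrite indicE; case: (_ \in _); rewrite ?normr1 ?normr0.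
Qed.

Lemma Rintegral_prob_cst (c : R) : \int[P]_w c = c.
Proof.
rewrite Rintegral_cst//; transitivity (c * 1); last by rewrite mulr1.
exact: (congr1 (fun x => c * fine x) (probability_setT P)).
Qed.

Lemma le_norm_Rintegral_bound f M : measurable_fun setT f -> (forall w, `|f w| <= M) ->
  `|\int[P]_w f w| <= M.
Proof.
move=> mf fM; have bf : bounded_rv f by split => //; exists M.
rewrite (le_trans (le_normr_Rintegral _ _))//; first exact: bounded_rv_integrable.
rewrite (@le_trans _ _ (\int[P]_w M))//; last by rewrite Rintegral_prob_cst.
apply: le_Rintegral => //.
  exact/integrable_norm/bounded_rv_integrable.
exact/bounded_rv_integrable/bounded_rv_cst.
Qed.

Lemma Rintegral_indic (A : set T) : measurable A -> \int[P]_w \1_A w = fine (P A).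
Proof. by move=> mA; rewrite /Rintegral integral_indic// setIT. Qed.

End BoundedExpectation.

(** * Products of expectations under independence *)

Section Independence.
Context {R : realType} {d} {T : measurableType d} (P : probability T R).

(** Factorization on indicators suffices because [f] is within [1 / N] of a simple function of
    finitely many level sets, and both sides are continuous for uniform convergence. [W] is left
    arbitrary so that it can stand for the product of the other factors. *)
Lemma factor_expectation (W X : T -> R) (f : R -> R) :
  bounded_rv W -> measurable_fun setT X -> bounded_rv f ->
  (forall B : set R, measurable B ->
    \int[P]_w (W w * \1_B (X w)) = \int[P]_w W w * \int[P]_w \1_B (X w)) ->
  \int[P]_w (W w * f (X w)) = \int[P]_w W w * \int[P]_w f (X w).
Proof.
move=> bW mX [mf [M fM]] H.
have [mW [C WC]] := bW.
have b1 (B : set R) : measurable B -> bounded_rv (fun w => \1_B (X w) : R).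
  move=> mB; split; last by exists 1 => w; rewrite indicE; case: (_ \in _); rewrite ?normr1 ?normr0.
  by apply: measurableT_comp => //; exact: measurable_indic.
apply/eqP; rewrite -subr_eq0 -normr_le0; apply/ler_addgt0Pl => /= e e0; rewrite addr0.
have C0 : 0 <= C by apply: le_trans (WC point).
have M0 : 0 <= M by apply: le_trans (fM point).
pose N := (Num.truncn (2 * C / e)).+1.
have N0 : 0 < N%:R :> R by rewrite ltr0n.
have NC : 2 * C / N%:R <= e.
  by rewrite ler_pdivrMr// [e * _]mulrC -ler_pdivrMr// ltW// truncnS_gt.
(* Level sets of [f] at height [1 / N]: the shift by [M] makes the argument of [truncn] nonnegative,
   and only the first [K] indices occur. *)
pose h (x : R) := Num.truncn (N%:R * (f x + M)).
pose K := (Num.truncn (N%:R * (M + M))).+1.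
have h0 x : 0 <= N%:R * (f x + M).
  by rewrite mulr_ge0//; have := fM x; rewrite ler_norml => /andP[]; lra.
have hK x : (h x < K)%N.
  rewrite ltnS le_truncn// ler_wpM2l//.
  by have := fM x; rewrite ler_norml => /andP[]; lra.
have mh j : measurable [set x | h x = j].
  rewrite (_ : [set x | h x = j] = f @^-1` (`[j%:R / N%:R - M, j.+1%:R / N%:R - M[)%classic).
    by rewrite -[X in measurable X]setTI; exact: mf.
  apply/seteqP; split => x /=; rewrite in_itv/=.
    move=> <-; rewrite /h; have /andP[] := truncn_itv (h0 x).
    by rewrite lerBlDr ltrBrDr ler_pdivrMr// ltr_pdivlMr// ![_ * N%:R]mulrC => -> ->.
  rewrite lerBlDr ltrBrDr ler_pdivrMr// ltr_pdivlMr// ![_ * N%:R]mulrC => xj.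
  by apply/eqP; rewrite truncn_eq.
pose D j := [set x | h x = j].
pose fN (x : R) : R := \sum_(j < K) (j%:R / N%:R - M) * \1_(D j) x.
have fNE x : fN x = (h x)%:R / N%:R - M.
  rewrite /fN (bigD1 (Ordinal (hK x)))//= big1 ?addr0; first by rewrite indicE mem_set// mulr1.
  move=> j jh; rewrite indicE memNset ?mulr0// /D/= => hj.
  by move/negP: jh; apply; apply/eqP/val_inj.
have fNf x : `|f x - fN x| <= N%:R^-1.
  rewrite fNE; have /andP[h1 h2] := truncn_itv (h0 x).
  rewrite -/(h x) -natr1 in h1 h2.
  rewrite ger0_norm.
    by rewrite opprB addrA lerBlDl -[X in _ <= _ + X]mul1r -mulrDl ler_pdivlMr// mulrC ltW.
  by rewrite opprB addrA subr_ge0 ler_pdivrMr// mulrC.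
have bD j : bounded_rv (fun w => \1_(D j) (X w) : R) by apply: b1; exact: mh.
have bfN : bounded_rv (fun w => fN (X w)).
  by apply: bounded_rv_sum => j; apply: bounded_rvM => //; exact: bounded_rv_cst.
have bf : bounded_rv (fun w => f (X w)).
  by split; [exact: measurableT_comp|exists M => w; exact: fM].
have HN : \int[P]_w (W w * fN (X w)) = \int[P]_w W w * \int[P]_w fN (X w).
  under eq_Rintegral do rewrite mulr_sumr.
  rewrite !Rintegral_sum; last 2 first.
  - by move=> j; apply/bounded_rv_integrable/bounded_rvM => //; exact: bounded_rv_cst.
  - by move=> j; apply/bounded_rv_integrable/bounded_rvM => //; apply: bounded_rvM => //;
      exact: bounded_rv_cst.
  rewrite mulr_sumr; apply: eq_bigr => j _.
  under eq_Rintegral do rewrite mulrCA.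
  rewrite !RintegralZl//; last 2 first.
  - exact/bounded_rv_integrable.
  - by apply/bounded_rv_integrable/bounded_rvM.
  by rewrite (H _ (mh j)) mulrCA.
have E1 : \int[P]_w (W w * f (X w)) =
   \int[P]_w (W w * fN (X w)) + \int[P]_w (W w * (f (X w) - fN (X w))).
  rewrite -RintegralD//.
  - by apply: eq_Rintegral => w _; ring.
  - by apply/bounded_rv_integrable/bounded_rvM.
  - by apply/bounded_rv_integrable/bounded_rvM => //; exact: bounded_rvB.
have E2 : \int[P]_w f (X w) = \int[P]_w fN (X w) + \int[P]_w (f (X w) - fN (X w)).
  rewrite -RintegralD//.
  - by apply: eq_Rintegral => w _; ring.
  - exact/bounded_rv_integrable.
  - by apply/bounded_rv_integrable; exact: bounded_rvB.
rewrite E1 E2 HN mulrDr opprD addrACA subrr add0r (le_trans _ NC)//.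
rewrite (le_trans (ler_normB _ _))// (_ : 2 * C / N%:R = C * N%:R^-1 + C * N%:R^-1); last by ring.
have bB : bounded_rv (fun w => f (X w) - fN (X w)) by exact: bounded_rvB.
apply: lerD.
  apply: le_norm_Rintegral_bound => [|w]; first by have [] := bounded_rvM bW bB.
  by rewrite normrM ler_pM.
rewrite normrM ler_pM//; first exact: le_norm_Rintegral_bound.
by apply: le_norm_Rintegral_bound => //; have [] := bB.
Qed.

Lemma independent_expectation_prod (k : nat) (X : 'I_k -> T -> R) (f : 'I_k -> R -> R) :
  (forall i, measurable_fun setT (X i)) -> mutually_independent P X ->
  (forall i, bounded_rv (f i)) ->
  \int[P]_w (\prod_(i < k) f i (X i w)) = \prod_(i < k) \int[P]_w f i (X i w).
Proof.
move=> mX iX.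
have bi B : measurable B -> bounded_rv (\1_B : R -> R) by exact: bounded_rv_indic.
(* The first [m] factors are arbitrary and the others are indicators: [m = 0] is the definition of
   independence, and each step frees one factor by [factor_expectation]. *)
suff H m : (m <= k)%N -> forall f : 'I_k -> R -> R, (forall i, bounded_rv (f i)) ->
  (forall i : 'I_k, (m <= i)%N -> exists2 B, measurable B & f i = \1_B) ->
  \int[P]_w (\prod_(i < k) f i (X i w)) = \prod_(i < k) \int[P]_w f i (X i w).
  by move=> bf; apply: (H k) => // i; rewrite leqNgt ltn_ord.
elim: m => [_ {}f bf fB|m IH mk {}f bf fB].
  have /choice[B HB] : forall i, exists B, measurable B /\ f i = \1_B.
    by move=> i; have [B mB fiB] := fB i isT; exists B.
  have fiE i w : f i (X i w) = \1_(X i @^-1` B i) w by rewrite (HB i).2.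
  have mXB i : measurable (X i @^-1` B i).
    by rewrite -[X in measurable X]setTI; apply: mX => //; exact: (HB i).1.
  under [RHS]eq_bigr => i _ do under eq_Rintegral do rewrite fiE.
  under [RHS]eq_bigr => i _ do rewrite Rintegral_indic//.
  have -> : \int[P]_w \prod_(i < k) f i (X i w) =
      \int[P]_w \1_(\bigcap_(i in [set: 'I_k]) (X i @^-1` B i)) w.
    apply: eq_Rintegral => w _; under eq_bigr do rewrite fiE.
    rewrite [RHS]indicE; have [|] := boolP (w \in _).
      by rewrite inE => h; rewrite big1// => i _; rewrite indicE mem_set//; exact: h.
    rewrite notin_setE => h.
    have [i hi] : exists i, ~ B i (X i w).
      by apply/existsNP => h'; apply: h => i _; exact: h'.
    by rewrite (bigD1 i)//= indicE memNset// mul0r.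
  rewrite Rintegral_indic; last first.
    by apply: fin_bigcap_measurable => //; exact: finite_finset.
  rewrite iX; last by move=> i; exact: (HB i).1.
  have E i : P (X i @^-1` B i) = (fine (P (X i @^-1` B i)))%:E.
    by rewrite fineK// fin_num_measure.
  rewrite (_ : (\prod_(i < k) P (X i @^-1` B i))%E =
    (\prod_(i < k) fine (P (X i @^-1` B i)))%:E)//.
  by rewrite -prodEFin; apply: eq_bigr => i _; exact: E.
pose j := Ordinal mk.
pose W w := \prod_(i < k | i != j) f i (X i w).
have bW : bounded_rv W.
  apply: bounded_rv_prod => i; have [mfi [M fM]] := bf i.
  by split; [exact: measurableT_comp|exists M => w; exact: fM].
pose f' B i := if i == j then \1_B else f i.
have Hf' (B : set R) : measurable B -> \int[P]_w (W w * \1_B (X j w)) =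
     \prod_(i < k | i != j) \int[P]_w f i (X i w) * \int[P]_w \1_B (X j w).
  move=> mB; have := IH (ltnW mk) (f' B).
  have -> : (fun w : T => \prod_(i < k) f' B i (X i w)) = (fun w => W w * \1_B (X j w)).
    apply/funext => w; rewrite (bigD1 j)//= /f' eqxx mulrC; congr (_ * _).
    by apply: eq_bigr => i /negbTE ->.
  move=> ->.
  - rewrite (bigD1 j)//= /f' eqxx mulrC; congr (_ * _).
    by apply: eq_bigr => i /negbTE ->.
  - by rewrite /f' => i; case: ifP => // _; exact: bi.
  - move=> i mi; rewrite /f'; case: eqVneq => [_|ij]; first by exists B.
    apply: fB; rewrite ltn_neqAle mi andbT; apply: contra ij => /eqP mi'.
    by apply/eqP/val_inj.
(* Taking [B = setT] identifies the product of the other expectations as the expectation of [W]. *)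
have WE : \int[P]_w W w = \prod_(i < k | i != j) \int[P]_w f i (X i w).
  have := Hf' setT measurableT.
  under eq_Rintegral do rewrite indicT mulr1.
  under [X in _ = _ * X -> _]eq_Rintegral do rewrite indicT.
  by rewrite Rintegral_prob_cst !mulr1.
rewrite (bigD1 j)//= mulrC -WE.
have := @factor_expectation W (X j) (f j) bW (mX j) (bf j).
rewrite -/W => <-; last by move=> B mB; rewrite Hf'// WE.
by apply: eq_Rintegral => w _; rewrite (bigD1 j)//= mulrC.
Qed.

(* Exposes E exp(i Y) = rho exp(i beta) through its real and imaginary parts. *)
Definition char_polar (Y : T -> R) (rho beta : R) :=
  \int[P]_w cos (Y w) = rho * cos beta /\ \int[P]_w sin (Y w) = rho * sin beta.

Lemma char_polar_sum (k : nat) (X : 'I_k -> T -> R) (th rho beta : 'I_k -> R) :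
  (forall i, measurable_fun setT (X i)) -> mutually_independent P X ->
  (forall i, char_polar (fun w => th i * X i w) (rho i) (beta i)) ->
  char_polar (fun w => \sum_(i < k) th i * X i w) (\prod_(i < k) rho i) (\sum_(i < k) beta i).
Proof.
move=> mX iX HX.
have bc (t : R) : bounded_rv (fun x : R => cos (t * x)).
  by apply: bounded_rv_cos; exact: mulrl_measurable.
have bs (t : R) : bounded_rv (fun x : R => sin (t * x)).
  by apply: bounded_rv_sin; exact: mulrl_measurable.
pose S m w := \sum_(i < k | (i < m)%N) th i * X i w.
have mS m : measurable_fun setT (S m).
  rewrite /S; under eq_fun do rewrite big_mkcond.
  apply: measurable_sum => i; case: (i < m)%N; last exact: measurable_cst.
  exact: measurable_funM.
pose F m (f : 'I_k -> R -> R) w := \prod_(i < k | (m <= i)%N) f i (X i w).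
pose Q m (f : 'I_k -> R -> R) := \prod_(i < k | (m <= i)%N) \int[P]_w f i (X i w).
have bF m f : (forall i, bounded_rv (f i)) -> bounded_rv (F m f).
  move=> bf; apply: bounded_rv_prod => i; have [mfi [M fM]] := bf i.
  by split; [exact: measurableT_comp|exists M => w; exact: fM].
(* The first [m] terms are gathered in the phase, while the other variables remain as arbitrary
   bounded factors [f i]. Choosing [cos (th j * x)] or [sin (th j * x)] as the next factor, the
   addition formulas gather one more term. *)
suff H m : (m <= k)%N -> forall f : 'I_k -> R -> R, (forall i, bounded_rv (f i)) ->
  \int[P]_w (cos (S m w) * F m f w) =
    (\prod_(i < k | (i < m)%N) rho i) * cos (\sum_(i < k | (i < m)%N) beta i) * Q m f /\
  \int[P]_w (sin (S m w) * F m f w) =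
    (\prod_(i < k | (i < m)%N) rho i) * sin (\sum_(i < k | (i < m)%N) beta i) * Q m f.
  have kT (i : 'I_k) : (i < k)%N = true by exact: ltn_ord.
  have kF (i : 'I_k) : (k <= i)%N = false by rewrite leqNgt kT.
  have F1 : F k (fun=> cst 1) = cst 1 by apply/funext => w; rewrite /F big_pred0.
  have Q1 : Q k (fun=> cst 1) = 1 by rewrite /Q big_pred0.
  have [] := H k (leqnn k) (fun=> cst 1) (fun=> @bounded_rv_cst _ _ _ 1).
  have SE w : S k w = \sum_(i < k) th i * X i w by apply: eq_bigl.
  have rE : \prod_(i < k | (i < k)%N) rho i = \prod_(i < k) rho i by apply: eq_bigl.
  have bE : \sum_(i < k | (i < k)%N) beta i = \sum_(i < k) beta i by apply: eq_bigl.
  rewrite F1 Q1 rE bE !mulr1 => Hc Hs; split.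
    by rewrite -Hc; apply: eq_Rintegral => w _; rewrite mulr1 SE.
  by rewrite -Hs; apply: eq_Rintegral => w _; rewrite mulr1 SE.
have S0 w : S 0%N w = 0 by rewrite /S big_pred0.
elim: m => [_ f bf|m IH mk f bf].
  rewrite !big_pred0//= cos0 sin0 !mulr1 mulr0 !mul0r mul1r; split.
    have -> : Q 0%N f = \prod_(i < k) \int[P]_w f i (X i w) by apply: eq_bigl.
    rewrite -(independent_expectation_prod mX iX bf).
    apply: eq_Rintegral => w _; rewrite S0 cos0 mul1r; exact: eq_bigl.
  under eq_Rintegral do rewrite S0 sin0 mul0r.
  by rewrite Rintegral_prob_cst.
pose j := Ordinal mk.
have jm (i : 'I_k) : ((i < m.+1)%N && (i != j)) = (i < m)%N.
  by rewrite ltnS ltn_neqAle andbC.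
have jm' (i : 'I_k) : ((m <= i)%N && (i != j)) = (m.+1 <= i)%N.
  by rewrite ltn_neqAle andbC eq_sym.
pose g (h : R -> R) i : R -> R := if i == j then h else f i.
have FE h w : F m (g h) w = h (X j w) * F m.+1 f w.
  rewrite /F (bigD1 j)/= ?leqnn// /g eqxx; congr (_ * _).
  by rewrite (eq_bigl _ _ jm'); apply: eq_bigr => i; case: eqVneq => // ->; rewrite ltnn.
have QE h : Q m (g h) = \int[P]_w h (X j w) * Q m.+1 f.
  rewrite /Q (bigD1 j)/= ?leqnn// /g eqxx; congr (_ * _).
  by rewrite (eq_bigl _ _ jm'); apply: eq_bigr => i; case: eqVneq => // ->; rewrite ltnn.
have SE w : S m.+1 w = S m w + th j * X j w.
  by rewrite /S (bigD1 j)/= ?leqnn// (eq_bigl _ _ jm) addrC.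
rewrite [\prod_(i < k | _) rho i](bigD1 j)/= ?leqnn// (eq_bigl _ _ jm).
rewrite [\sum_(i < k | _) beta i](bigD1 j)/= ?leqnn// (eq_bigl _ _ jm).
have bg h : bounded_rv h -> forall i, bounded_rv (g h i).
  by move=> bh i; rewrite /g; case: eqP.
have [cc sc] := IH (ltnW mk) (g (fun x => cos (th j * x))) (bg _ (bc _)).
have [cs ss] := IH (ltnW mk) (g (fun x => sin (th j * x))) (bg _ (bs _)).
have [Hc Hs] := HX j; rewrite QE Hc in cc sc; rewrite QE Hs in cs ss.
have bSc : bounded_rv (cos \o S m) by exact: bounded_rv_cos.
have bSs : bounded_rv (sin \o S m) by exact: bounded_rv_sin.
split.
  transitivity (\int[P]_w (cos (S m w) * F m (g (fun x => cos (th j * x))) w) -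
                \int[P]_w (sin (S m w) * F m (g (fun x => sin (th j * x))) w)).
    rewrite -RintegralB//; first by apply: eq_Rintegral => w _; rewrite SE cosD !FE; ring.
    - by apply: bounded_rv_integrable; apply: bounded_rvM => //; exact/bF/bg/bc.
    - by apply: bounded_rv_integrable; apply: bounded_rvM => //; exact/bF/bg/bs.
  by rewrite cc ss cosD; ring.
transitivity (\int[P]_w (sin (S m w) * F m (g (fun x => cos (th j * x))) w) +
              \int[P]_w (cos (S m w) * F m (g (fun x => sin (th j * x))) w)).
  rewrite -RintegralD//; first by apply: eq_Rintegral => w _; rewrite SE sinD !FE; ring.
  - by apply: bounded_rv_integrable; apply: bounded_rvM => //; exact/bF/bg/bc.
  - by apply: bounded_rv_integrable; apply: bounded_rvM => //; exact/bF/bg/bs.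
by rewrite sc cs sinD; ring.
Qed.

End Independence.

(** * Joint characteristic functions of a Levy basis *)

Section CharFun.
Context {R : realType} {d} {T : measurableType d} (P : probability T R).

Lemma ae_eq_Rintegral (f g : T -> R) : measurable_fun setT f -> measurable_fun setT g ->
  {ae P, forall w, f w = g w} -> \int[P]_w f w = \int[P]_w g w.
Proof.
move=> mf mg fg; congr fine; apply: ae_eq_integral => //; try exact/measurable_EFinP.
by apply: filterS fg => w -> _.
Qed.

Lemma ae_char_polar (X Y : T -> R) rho beta : measurable_fun setT X -> measurable_fun setT Y ->
  {ae P, forall w, X w = Y w} -> char_polar P X rho beta -> char_polar P Y rho beta.
Proof.
move=> mX mY XY [cX sX].
have [mcX _] := bounded_rv_cos mX; have [mcY _] := bounded_rv_cos mY.
have [msX _] := bounded_rv_sin mX; have [msY _] := bounded_rv_sin mY.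
split; rewrite -?cX -?sX; apply: ae_eq_Rintegral => //; apply: filterS XY => w /= -> //.
Qed.

Lemma char_fun_polar (X : T -> R) (z : R) (c : R[i]) : char_fun P X z = cexp c ->
  char_polar P (fun w => z * X w) (expR (complex.Re c)) (complex.Im c).
Proof.
move=> /eqP; rewrite /char_fun /cintegral eq_complex/= => /andP[/eqP cE /eqP sE].
split.
  rewrite mul0r subr0 in cE; rewrite -cE; apply: eq_Rintegral => w _.
  by rewrite expR0 mul1r mul0r subr0.
move: sE; rewrite [in X in _ = X -> _]mul0r [in X in _ = X -> _]addr0 => <-.
by apply: eq_Rintegral => w _; rewrite expR0 mul1r mul0r addr0.
Qed.

End CharFun.

(** * Real and imaginary parts of the characteristic exponent *)

Section LevyExponent.
Context {R : realType}.

Definition re_exponent (b : R) (nu : {measure set (measurableTypeR R) -> \bar R}) (z : R) : R :=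
  - (2^-1 * b ^+ 2 * z ^+ 2) + \int[nu]_(x in [set~ 0]) (cos (z * x) - 1).

Definition im_exponent (gamma : R) (nu : {measure set (measurableTypeR R) -> \bar R}) (z : R) : R :=
  gamma * z +
  \int[nu]_(x in [set~ 0]) (sin (z * x) - z * x * \1_(`[-1, 1]%classic) x).

Lemma Re_levy_exponent gamma b nu z :
  complex.Re (levy_exponent gamma b nu z) = re_exponent b nu z.
Proof.
rewrite /levy_exponent /re_exponent/= sub0r; congr (_ + _).
by apply: eq_Rintegral => x _; rewrite expR0 mul1r mul0r !subr0.
Qed.

Lemma Im_levy_exponent gamma b nu z :
  complex.Im (levy_exponent gamma b nu z) = im_exponent gamma nu z.
Proof.
rewrite /levy_exponent /im_exponent/= subr0; congr (_ + _).
by apply: eq_Rintegral => x _; rewrite expR0 mul1r mul0r addr0 subr0.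
Qed.

Lemma levy_basis_polar {d} {T : measurableType d} (P : probability T R) L gamma b nu
    (A : set (measurableTypeR R * measurableTypeR R)) (z : R) :
  levy_basis P L gamma b nu -> finite_borel A ->
  char_polar P (fun w => z * L A w) (expR (fine (leb2 A) * re_exponent b nu z))
    (fine (leb2 A) * im_exponent gamma nu z).
Proof.
move=> [_ _ _ H] fA; have := char_fun_polar (H A fA z).
rewrite -(Re_levy_exponent gamma) -(Im_levy_exponent gamma b).
by case: (levy_exponent gamma b nu z) => u v; rewrite /= !mul0r subr0 addr0.
Qed.

End LevyExponent.

(** * Atoms of a finite family of sets *)

Section Atoms.
Context {T : Type} {k : nat} (A : 'I_k -> set T).

(* The empty index set is given the empty atom, as the complement of all the
   [A j] has infinite measure. *)
Definition atom (S : {set 'I_k}) : set T :=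
  if S == finset.set0 then set0 else [set p | forall j, A j p <-> j \in S].

Lemma atom_trivIset : trivIset setT atom.
Proof.
move=> S S' _ _ [p []]; rewrite /atom; case: eqP => // _; case: eqP => // _ /= pS pS'.
by apply/setP => j; apply/idP/idP => [/pS/pS'|/pS'/pS].
Qed.

Lemma sub_atom (S : {set 'I_k}) j : j \in S -> atom S `<=` A j.
Proof. by move=> jS p; rewrite /atom; case: eqP => //= _ /(_ j) h; apply/h. Qed.

Lemma bigcup_atom j : A j = \bigcup_(S in [set S : {set 'I_k} | j \in S]) atom S.
Proof.
apply/seteqP; split => p; last by move=> [S /= jS pS]; exact: sub_atom pS.
move=> pj; pose S := [set i | `[< A i p >]]%SET; have jS : j \in S by rewrite inE; apply/asboolP.
exists S => //=; rewrite /atom ifF.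
  by move=> i; rewrite inE; split => /asboolP.
by apply/negbTE; apply: contraL jS => /eqP ->; rewrite inE.
Qed.

End Atoms.

Lemma atom_measurable d (T : measurableType d) k (A : 'I_k -> set T) S :
  (forall j, measurable (A j)) -> measurable (atom A S).
Proof.
move=> mA; rewrite /atom; case: eqP => // _.
rewrite (_ : [set p | _] = \bigcap_(j in [set: 'I_k]) (if j \in S then A j else ~` A j)).
  apply: fin_bigcap_measurable; first exact: finite_finset.
  by move=> j _; case: ifP => _ //; exact: measurableC.
apply/seteqP; split => p /= h j.
  by move=> _; case: ifPn => [/h//|/negP jS /h].
have := h j Logic.I; case: ifPn => //= jS pj; split => //; by move/negP : jS.
Qed.

Section LevyBasisAdditive.
Context {R : realType} {d} {T : measurableType d} (P : probability T R).
Context (L : set (measurableTypeR R * measurableTypeR R) -> T -> R) (gamma b : R)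
  (nu : {measure set (measurableTypeR R) -> \bar R}).
Hypothesis hL : levy_basis P L gamma b nu.

Lemma finite_borel0 : finite_borel (set0 : set (measurableTypeR R * measurableTypeR R)).
Proof. by split => //; rewrite /leb2 measure0 ltry. Qed.

Lemma sub_finite_borel (A B : set (measurableTypeR R * measurableTypeR R)) :
  measurable A -> A `<=` B -> finite_borel B -> finite_borel A.
Proof.
move=> mA AB [mB fB]; split => //; apply: le_lt_trans fB; apply: le_measure => //; exact/mem_set.
Qed.

(** Additivity along a sequence of empty sets makes the partial sums of a constant series converge,
    so its general term is 0. *)
Lemma levy_basis_set0 : {ae P, forall w, L set0 w = 0}.
Proof.
have [_ H _ _] := hL.
have U0 : \bigcup_(i in [set: nat]) (set0 : set (measurableTypeR R * measurableTypeR R)) = set0.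
  exact: bigcup0.
have t0 : trivIset [set: nat] (fun=> set0 : set (measurableTypeR R * measurableTypeR R)).
  by move=> i j _ _ [x []].
have := H (fun=> set0) (fun=> finite_borel0) t0.
rewrite U0 => /(_ finite_borel0)/filterS; apply.
move=> w; set c := L set0 w => cc.
have c' : \sum_(0 <= i < n.+1) c - \sum_(0 <= i < n) c @[n --> \oo] --> c - c.
  by apply: cvgB => //; rewrite (cvg_shiftS (fun n => \sum_(0 <= i < n) c)).
have : (c : R) @[n --> \oo] --> c - c.
  by apply: cvg_trans c'; apply: near_eq_cvg; near=> n; rewrite big_nat_recr//= addrAC subrr add0r.
rewrite subrr; move/(cvg_lim (@Rhausdorff R)) => <-.
by rewrite lim_cst.
Unshelve. all: by end_near. Qed.

(** The family is completed by empty sets into a sequence; their contribution vanishes only almost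
    surely. *)
Lemma levy_basis_fin_add m (F : 'I_m -> set (measurableTypeR R * measurableTypeR R)) :
  (forall i, finite_borel (F i)) -> trivIset setT F ->
  finite_borel (\bigcup_i F i) ->
  {ae P, forall w, L (\bigcup_i F i) w = \sum_(i < m) L (F i) w}.
Proof.
move=> fF tF fU; have [_ H _ _] := hL.
pose G n := if insub n is Some i then F i else set0.
have GE (i : 'I_m) : G i = F i by rewrite /G valK.
have G0 n : (m <= n)%N -> G n = set0 by move=> mn; rewrite /G insubF// ltnNge mn.
have UE : \bigcup_i G i = \bigcup_i F i.
  apply/seteqP; split => x [i _].
    by rewrite /G; case: insubP => // j _ _ xj; exists j.
  by rewrite -GE => xi; exists (i : nat).
have fG n : finite_borel (G n) by rewrite /G; case: insubP => // _; exact: finite_borel0.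
have tG : trivIset setT G.
  move=> i j _ _ [x []]; rewrite /G.
  case: insubP => // i' _ <- xi; case: insubP => // j' _ <- xj.
  by congr nat_of_ord; apply: tF => //; exists x.
have := H G fG tG; rewrite UE => /(_ fU).
apply: filterS2 levy_basis_set0 => w w0 cv.
apply: (@cvg_unique _ (@Rhausdorff R) _ _ _ _ cv).
apply: (@cvg_near_cst _ _ _ _ _ _); near=> n.
have mn : (m <= n)%N by near: n; exact: nbhs_infty_ge.
rewrite (big_cat_nat _ mn)//= [X in _ + X]big1_seq ?addr0; last first.
  by move=> i /=; rewrite mem_index_iota => /andP[mi _]; rewrite G0.
by rewrite big_mkord; apply: eq_bigr => i _; rewrite GE.
Unshelve. all: by end_near. Qed.

Lemma levy_basis_joint_polar k (A : 'I_k -> set (measurableTypeR R * measurableTypeR R))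
    (th : 'I_k -> R) :
  (forall j, finite_borel (A j)) ->
  char_polar P (fun w => \sum_(j < k) th j * L (A j) w)
    (expR (\sum_S fine (leb2 (atom A S)) * re_exponent b nu (\sum_(j in S) th j)))
    (\sum_S fine (leb2 (atom A S)) * im_exponent gamma nu (\sum_(j in S) th j)).
Proof.
move=> fA; have [mL _ indL _] := hL.
have mat S : measurable (atom A S) by apply: atom_measurable => j; case: (fA j).
have fat S : finite_borel (atom A S).
  have [->|/set0Pn[j jS]] := eqVneq S finset.set0.
    by rewrite /atom eqxx; exact: finite_borel0.
  exact: sub_finite_borel (sub_atom jS) (fA j).
(* Independence is stated for families indexed by ordinals, so the subsets of ['I_k] are
   enumerated. *)
pose m := #|{: {set 'I_k}}|; pose e (i : 'I_m) : {set 'I_k} := enum_val i.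
pose F (i : 'I_m) := atom A (e i).
have einj : injective e by exact: enum_val_inj.
have fF i : finite_borel (F i) by exact: fat.
have tF : trivIset setT F.
  move=> i j _ _ h; apply: einj; exact: (@atom_trivIset _ _ A) h.
have addA j : {ae P, forall w, L (A j) w = \sum_(i < m) (j \in e i)%:R * L (F i) w}.
  pose G i := if j \in e i then F i else set0.
  have UE : A j = \bigcup_i G i.
    rewrite {1}(bigcup_atom A j); apply/seteqP; split => x.
      move=> [S jS xS]; exists (enum_rank S) => //.
      by rewrite /G /F /e enum_rankK jS.
    by move=> [i _]; rewrite /G; case: ifP => // ji xi; exists (e i).
  have fG i : finite_borel (G i).
    by rewrite /G; case: ifP => _; [exact: fat|exact: finite_borel0].
  have tG : trivIset setT G.
    move=> i i' _ _ [x []]; rewrite /G; case: ifP => // _ xi; case: ifP => // _ xi'.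
    by apply: tF => //; exists x.
  have := @levy_basis_fin_add _ G fG tG; rewrite -UE => /(_ (fA j)).
  apply: filterS2 levy_basis_set0 => w w0 ->; apply: eq_bigr => i _.
  by rewrite /G; case: ifP => _; rewrite ?mul1r// w0 mul0r.
pose th' (i : 'I_m) := \sum_(j in e i) th j.
have HF : char_polar P (fun w => \sum_(i < m) th' i * L (F i) w)
    (\prod_(i < m) expR (fine (leb2 (F i)) * re_exponent b nu (th' i)))
    (\sum_(i < m) fine (leb2 (F i)) * im_exponent gamma nu (th' i)).
  apply: char_polar_sum.
  - by move=> i; apply: mL; exact: fF.
  - exact: indL fF tF.
  - by move=> i; apply: levy_basis_polar hL (fF i).
have E1 : \prod_(i < m) expR (fine (leb2 (F i)) * re_exponent b nu (th' i)) =
   expR (\sum_S fine (leb2 (atom A S)) * re_exponent b nu (\sum_(j in S) th j)).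
  by rewrite -expR_sum [in RHS]big_enum_val.
have E2 : \sum_(i < m) fine (leb2 (F i)) * im_exponent gamma nu (th' i) =
   \sum_S fine (leb2 (atom A S)) * im_exponent gamma nu (\sum_(j in S) th j).
  by rewrite [in RHS]big_enum_val.
rewrite -E1 -E2; apply: ae_char_polar HF.
- by apply: measurable_sum => i; apply: measurable_funM => //; apply: mL; exact: fF.
- by apply: measurable_sum => i; apply: measurable_funM => //; apply: mL; exact: fA.
(* There are finitely many [j], hence one null set serves all of them. *)
have : {ae P, forall w, forall j, L (A j) w = \sum_(i < m) (j \in e i)%:R * L (F i) w}.
  exact: filter_forall.
apply: filterS => w H.
under [RHS]eq_bigr do rewrite H mulr_sumr.
rewrite exchange_big/=; apply: eq_bigr => i _; rewrite /th' mulr_suml big_mkcond/=.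
by apply: eq_bigr => j _; case: ifP => _; rewrite ?mul1r// mul0r mulr0.
Qed.

End LevyBasisAdditive.

(** * Gaussian laws and Wiener integrals *)

Section Antiderivative.
Context {R : realType}.
Local Notation mu := (@lebesgue_measure R).

Lemma is_derive_continuous (F f : R -> R) : (forall x : R, is_derive x 1 F (f x)) -> continuous F.
Proof.
by move=> dF x; apply/differentiable_continuous/derivable1_diffP; case: (dF x).
Qed.

(** Over [[-(n+1), n+1]] the integral is [F (n+1) - F (-(n+1))]; dominated convergence then lets [n]
    tend to infinity. *)
Lemma integral_derivative_vanishing (F f : R -> R) : (forall x : R, is_derive x 1 F (f x)) ->
  continuous f -> mu.-integrable setT (EFin \o f) ->
  F n.+1%:R @[n --> \oo] --> 0 -> F (- n.+1%:R) @[n --> \oo] --> 0 ->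
  \int[mu]_x f x = 0.
Proof.
move=> dF cf intf Fp Fn; have cF := is_derive_continuous dF.
have mf : measurable_fun setT f by exact: continuous_measurable_fun.
pose I n : set R := `[- n.+1%:R, n.+1%:R]%classic.
have mI n : measurable (I n) by exact: measurable_itv.
have H n : (\int[mu]_x ((f x * \1_(I n) x)%:E) = (F n.+1%:R - F (- n.+1%:R))%:E)%E.
  have n0 : - n.+1%:R < n.+1%:R :> R by rewrite gtrN.
  rewrite EFinB -(continuous_FTC2 n0 (f := f) (F := F)).
  - rewrite [RHS]integral_mkcond; apply: eq_integral => x _.
    by rewrite patchE indicE; case: ifP => _; rewrite ?mulr1 ?mulr0.
  - exact: continuous_subspaceT.
  - split=> [x _||].
    + by case: (dF x).
    + by apply/cvg_at_right_filter; exact: cF.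
    + by apply/cvg_at_left_filter; exact: cF.
  - by move=> x _; rewrite derive1E; case: (dF x).
have L : (\int[mu]_x ((f x * \1_(I n) x)%:E) @[n --> \oo] --> \int[mu]_x (f x)%:E)%E.
  apply: (@dominated_cvg _ _ _ mu setT measurableT _ _ (fun x => `|f x|%:E)) => //.
  - by move=> n; apply/measurable_EFinP/measurable_funM => //; apply: measurable_indic; exact: mI.
  - move=> x _; apply: cvg_EFin; first exact: nearW.
    apply: cvg_near_cst; near=> n => /=.
    rewrite indicE mem_set ?mulr1//= /I/= in_itv/= -ler_norml.
    near: n; exists (Num.truncn `|x|) => // n /= xn.
    by rewrite (le_trans (ltW (truncnS_gt _)))// ler_nat ltnS.
  - exact: (integrable_norm intf).
  - move=> n x _; rewrite lee_fin normrM ler_piMr// indicE.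
    by case: (_ \in _); rewrite ?normr1 ?normr0.
have L0 : (\int[mu]_x ((f x * \1_(I n) x)%:E) @[n --> \oo] --> 0%:E)%E.
  under eq_fun do rewrite H; apply: cvg_EFin; first exact: nearW.
  by rewrite -[X in _ --> X](subrr 0); exact: cvgB.
by rewrite /Rintegral (cvg_unique _ L L0)//; exact: ereal_hausdorff.
Unshelve. all: by end_near. Qed.

End Antiderivative.

(** * Characteristic function of the normal law *)

Section GaussianCharFun.
Context {R : realType}.
Variable s : R.
Hypothesis s0 : s != 0.
Local Notation mu := (@lebesgue_measure R).
Local Notation pdf := (normal_pdf 0 s).

Lemma normal_pdf_exp x : pdf x = normal_peak s * expR (- x ^+ 2 / (s ^+ 2 *+ 2)).
Proof. by rewrite /normal_pdf (negbTE s0) /normal_fun subr0. Qed.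

Lemma is_derive_normal_pdf (x : R) : is_derive x 1 pdf (- x / s ^+ 2 * pdf x).
Proof.
rewrite (_ : pdf = fun x => normal_peak s * expR (- x ^+ 2 / (s ^+ 2 *+ 2))); last first.
  by apply/funext => y; exact: normal_pdf_exp.
apply: is_derive_eq.
by rewrite /GRing.scale/= ?mulr1 ?mulr0 ?add0r ?addr0; field.
Qed.

Lemma integrable_id_normal_pdf : mu.-integrable setT (EFin \o (fun x => `|x| * pdf x)).
Proof.
have s2 : 0 < s ^+ 2 by rewrite exprn_even_gt0.
(* Doubling the variance splits the density into two equal exponential factors [expR (- a)]: one
   absorbs [|x|], the other is the density for [s'] up to its peak. *)
pose s' := Num.sqrt 2 * s.
have s'0 : s' != 0 by rewrite mulf_neq0// sqrtr_eq0 -ltNge.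
have s'2 : s' ^+ 2 = 2 * s ^+ 2 by rewrite exprMn sqr_sqrtr.
have I := integrable_normal_pdf 0 s'.
pose K := 2 * `|s| * normal_peak s / normal_peak s'.
have K0 : 0 <= K by rewrite !mulr_ge0 ?invr_ge0 ?normal_peak_ge0.
have mpdf := measurable_normal_pdf 0 s.
apply: (le_integrable measurableT _ _ (integrableZl measurableT K I)) => [|x _ /=].
  by apply/measurable_EFinP; apply: measurable_funM => //; exact: measurableT_comp.
rewrite lee_fin normrM normr_id [X in _ <= X]ger0_norm; last first.
  by rewrite mulr_ge0// normal_pdf_ge0.
rewrite ger0_norm ?normal_pdf_ge0// normal_pdf_exp /normal_pdf (negbTE s'0) /normal_fun subr0.
rewrite /K [leRHS]mulrA divfK ?gt_eqF ?normal_peak_gt0//.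
set a := x ^+ 2 / (s ^+ 2 *+ 4).
have -> : - x ^+ 2 / (s ^+ 2 *+ 2) = - a - a by rewrite /a; field.
have -> : - x ^+ 2 / (s' ^+ 2 *+ 2) = - a by rewrite s'2 /a; field.
have xs : `|x| <= 2 * `|s| * expR a.
  have e1 := expR_ge1Dx a.
  have v0 : 0 < `|s| by rewrite normr_gt0.
  rewrite (@le_trans _ _ (2 * `|s| * (1 + a)))//; last by rewrite ler_wpM2l// mulr_ge0.
  have -> : a = (`|x| / `|s|) ^+ 2 / 4.
    by rewrite exprMn exprVn !real_normK ?num_real// /a; field.
  rewrite mulrAC -ler_pdivrMr//.
  by move: (`|x| / `|s|) => v; have := sqr_ge0 (v - 1); have := sqr_ge0 v; nra.
have P0 := normal_peak_ge0 s.
have H : `|x| * expR (- a) <= 2 * `|s| by rewrite expRN ler_pdivrMr ?expR_gt0.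
have := ler_wpM2r (mulr_ge0 P0 (expR_ge0 (- a))) H.
by rewrite expRD; move: (expR (- a)) (normal_peak s) => e p; rewrite !mulrA => h; lra.
Qed.

Lemma normal_pdf_cvg0 : pdf n.+1%:R @[n --> \oo] --> 0 /\ pdf (- n.+1%:R) @[n --> \oo] --> 0.
Proof.
have s2 : 0 < s ^+ 2 by rewrite exprn_even_gt0.
have sym x : pdf (- x) = pdf x by rewrite !normal_pdf_exp sqrrN.
suff H : pdf n.+1%:R @[n --> \oo] --> 0.
  by split => //; under eq_fun do rewrite sym.
pose K := normal_peak s * (s ^+ 2 *+ 2).
have K0 : 0 <= K by rewrite mulr_ge0 ?normal_peak_ge0// mulrn_wge0// ltW.
have KN : K * harmonic n @[n --> \oo] --> (0 : R).
  by rewrite -(mulr0 K); apply: cvgMr; exact: cvg_harmonic.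
apply: (squeeze_cvgr _ (cvg_cst 0) KN); near=> n.
have n1 : 1 <= n.+1%:R :> R by rewrite ler1n.
rewrite normal_pdf_ge0/= normal_pdf_exp /K -mulrA ler_wpM2l ?normal_peak_ge0//.
rewrite mulNr expRN /harmonic/=.
set y := n.+1%:R ^+ 2 / (s ^+ 2 *+ 2).
have y0 : 0 < y by rewrite divr_gt0 ?exprn_gt0 ?pmulrn_lgt0// ltr0n.
rewrite (@le_trans _ _ y^-1)//.
  by rewrite lef_pV2 ?posrE ?expR_gt0// (le_trans _ (expR_ge1Dx _))// lerDr.
rewrite /y invf_div ler_wpM2l ?mulrn_wge0 ?(ltW s2)// lef_pV2 ?posrE ?exprn_gt0 ?ltr0n//.
by rewrite expr2 ler_peMl.
Unshelve. all: by end_near. Qed.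

Let is_derive_cos_affine (z c x : R) :
  is_derive x 1 (fun x : R => cos (z * x + c)) (- z * sin (z * x + c)).
Proof.
have dg : is_derive x 1 (fun x : R => z * x + c) z.
  by apply: is_derive_eq; rewrite /GRing.scale/= ?mulr1 ?mulr0 ?addr0 ?add0r.
have := @is_derive1_comp _ _ (fun x : R => z * x + c) _ _ _ (is_derive_cos (z * x + c)) dg.
by rewrite mulNr mulNr [sin _ * _]mulrC.
Qed.

Let is_derive_sin_affine (z c x : R) :
  is_derive x 1 (fun x : R => sin (z * x + c)) (z * cos (z * x + c)).
Proof.
have dg : is_derive x 1 (fun x : R => z * x + c) z.
  by apply: is_derive_eq; rewrite /GRing.scale/= ?mulr1 ?mulr0 ?addr0 ?add0r.
by have := @is_derive1_comp _ _ (fun x : R => z * x + c) _ _ _ (is_derive_sin (z * x + c)) dg; rewrite mulrC.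
Qed.

Lemma integrable_cos_normal_pdf z c : mu.-integrable setT (EFin \o (fun x => cos (z * x + c) * pdf x)).
Proof.
have mpdf := measurable_normal_pdf 0 s.
have mt : measurable_fun setT (fun x : R => z * x + c).
  by apply: measurable_funD => //; exact: mulrl_measurable.
have [mc _] := bounded_rv_cos mt.
apply: (le_integrable measurableT _ _ (integrable_normal_pdf 0 s)) => [|x _ /=].
  by apply/measurable_EFinP; exact: measurable_funM.
by rewrite lee_fin !normrM ler_piMl// cos_max.
Qed.

Lemma integrable_sin_normal_pdf z c :
  mu.-integrable setT (EFin \o (fun x => x * sin (z * x + c) * pdf x)).
Proof.
have mpdf := measurable_normal_pdf 0 s.
have mt : measurable_fun setT (fun x : R => z * x + c).
  by apply: measurable_funD => //; exact: mulrl_measurable.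
have [ms _] := bounded_rv_sin mt.
apply: (le_integrable measurableT _ _ integrable_id_normal_pdf) => [|x _ /=].
  by apply/measurable_EFinP; apply: measurable_funM => //; exact: measurable_funM.
by rewrite lee_fin !normrM normr_id ler_wpM2r// ler_piMr// sin_max.
Qed.

(** Stein's identity for the test function [sin (z * x + c)]: the integral of the derivative of
    [pdf x * sin (z * x + c)] vanishes. *)
Lemma normal_pdf_cos_by_parts z c :
  \int[mu]_x (x * sin (z * x + c) * pdf x) = s ^+ 2 * z * \int[mu]_x (cos (z * x + c) * pdf x).
Proof.
have i1 := integrable_sin_normal_pdf z c.
have i2 := integrable_cos_normal_pdf z c.
pose F x := pdf x * sin (z * x + c).
pose f x := - (s ^+ 2)^-1 * (x * sin (z * x + c) * pdf x) + z * (cos (z * x + c) * pdf x).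
have s2 : s ^+ 2 != 0 by rewrite expf_neq0.
have j1 : mu.-integrable setT (EFin \o (fun x => - (s ^+ 2)^-1 * (x * sin (z * x + c) * pdf x))).
  exact: (integrableZl measurableT (- (s ^+ 2)^-1) i1).
have j2 : mu.-integrable setT (EFin \o (fun x => z * (cos (z * x + c) * pdf x))).
  exact: (integrableZl measurableT z i2).
have if_ : mu.-integrable setT (EFin \o f) by exact: (integrableD measurableT j1 j2).
have dF (x : R) : is_derive x 1 F (f x).
  have dp := is_derive_normal_pdf x; have ds := is_derive_sin_affine z c x.
  rewrite /F /f; apply: is_derive_eq; rewrite /GRing.scale/=; by field.
have cc : continuous (fun x : R => cos (z * x + c)).
  exact: is_derive_continuous (is_derive_cos_affine z c).
have cs : continuous (fun x : R => sin (z * x + c)).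
  exact: is_derive_continuous (is_derive_sin_affine z c).
have cp : continuous pdf by exact: is_derive_continuous is_derive_normal_pdf.
have cf : continuous f.
  move=> x; apply: cvgD; apply: cvgM; try exact: cvg_cst.
    by apply: cvgM; [apply: cvgM; [exact: cvg_id|exact: cs]|exact: cp].
  by apply: cvgM; [exact: cc|exact: cp].
have [Lp Ln] := normal_pdf_cvg0.
have lim0 (u : nat -> R) : pdf (u n) @[n --> \oo] --> 0 -> F (u n) @[n --> \oo] --> 0.
  move=> pu; apply/norm_cvg0P; apply: (squeeze_cvgr _ (cvg_cst 0) pu).
  near=> n; rewrite normr_ge0/= /F normrM ger0_norm ?normal_pdf_ge0//.
  by rewrite ler_piMr ?normal_pdf_ge0// sin_max.
have := integral_derivative_vanishing dF cf if_ (lim0 _ Lp) (lim0 _ Ln).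
rewrite /f RintegralD// !RintegralZl// => /eqP.
rewrite mulNr addrC subr_eq0 => /eqP E.
by apply: (mulfI (invr_neq0 s2)); rewrite -E mulrA mulrA mulVf// mul1r.
Unshelve. all: by end_near. Qed.

(** As a function of [z] the integral solves [f' = - s ^ 2 z f], by differentiation under the
    integral sign and Stein's identity. The phase [c] covers the sine as well, through
    [c = - pi / 2]. *)
Lemma Rintegral_cos_normal_pdf z c :
  \int[mu]_x (cos (z * x + c) * pdf x) = cos c * expR (- (s ^+ 2 * z ^+ 2 / 2)).
Proof.
pose f z := \int[mu]_x (cos (z * x + c) * pdf x); rewrite -/(f z); move: z.
have df (z : R) : is_derive z 1 f (- (s ^+ 2 * z * f z)).
  pose h z x := cos (z * x + c) * pdf x.
  have dh (z' x : R) : is_derive z' 1 (h ^~ x) (- x * sin (z' * x + c) * pdf x).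
    rewrite /h; have := is_derive_cos_affine x c z'.
    under eq_fun do rewrite mulrC. rewrite [x * z']mulrC => dc.
    by apply: is_derive_eq; rewrite /GRing.scale/= ?mulr0 ?add0r mulrC.
  have zI : `]z - 1, z + 1[%classic z by rewrite /= in_itv/= gtrBl ltrDl ltr01.
  have ih z' : `]z - 1, z + 1[%classic z' -> mu.-integrable setT (EFin \o h z').
    by move=> _; exact: integrable_cos_normal_pdf.
  have dh' z' x : `]z - 1, z + 1[%classic z' -> setT x -> derivable (h ^~ x) z' 1.
    by move=> _ _; case: (dh z' x).
  have g0 (x : R) : 0 <= `|x| * pdf x by rewrite mulr_ge0 ?normal_pdf_ge0.
  have hp z' x : partial1of2 h z' x = - x * sin (z' * x + c) * pdf x.
    by rewrite /partial1of2 derive1E; case: (dh z' x).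
  have gb z' x : `]z - 1, z + 1[%classic z' -> setT x -> `|partial1of2 h z' x| <= `|x| * pdf x.
    move=> _ _; rewrite hp !normrM normrN [`|pdf x|]ger0_norm ?normal_pdf_ge0//.
    by rewrite ler_wpM2r ?normal_pdf_ge0// ler_piMr// sin_max.
  have E := differentiation_under_integral measurableT zI ih dh' g0 integrable_id_normal_pdf gb.
  have D := derivable_under_integral measurableT zI ih dh' g0 integrable_id_normal_pdf gb.
  apply: DeriveDef => //; rewrite -derive1E E.
  rewrite -normal_pdf_cos_by_parts -mulN1r -RintegralZl//; last exact: integrable_sin_normal_pdf.
  by apply: eq_Rintegral => x _; rewrite hp; ring.
pose k z := f z * expR (s ^+ 2 * z ^+ 2 / 2).
have dk (z : R) : is_derive z 1 k 0.
  have de : is_derive z 1 (fun z => expR (s ^+ 2 * z ^+ 2 / 2)) (s ^+ 2 * z * expR (s ^+ 2 * z ^+ 2 / 2)).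
    by apply: is_derive_eq; rewrite /GRing.scale/=; field.
  have df' := df z; rewrite /k; apply: is_derive_eq; rewrite /GRing.scale/=; ring.
move=> z; have := is_derive_0_is_cst z 0 dk.
rewrite /k expr0n/= mulr0 mul0r expR0 mulr1 => E.
have f0 : f 0 = cos c.
  rewrite /f; under eq_Rintegral do rewrite mul0r add0r.
  rewrite RintegralZl//; last exact: integrable_normal_pdf.
  by rewrite /Rintegral integral_normal_pdf/= mulr1.
rewrite -f0 -E; clearbody f; set q := s ^+ 2 * _ / 2.
by rewrite -mulrA expRxMexpNx_1 mulr1.
Qed.

End GaussianCharFun.

(** * Integrals of step functions against Brownian motion *)

Section BrownianIntegral.
Context {R : realType}.
Local Notation mu := (@lebesgue_measure R).

Lemma Rintegral_normal_prob (s : R) (f : R -> R) : bounded_rv f ->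
  \int[normal_prob 0 s]_x f x = \int[mu]_x (f x * normal_pdf 0 s x).
Proof.
move=> bf; have [mf [M fM]] := bf; congr fine.
have dom := normal_prob_dominates 0 s.
have mEf : measurable_fun setT (EFin \o f) by exact/measurable_EFinP.
have ip := integrable_normal_pdf 0 s.
have iRN : mu.-integrable setT (Radon_Nikodym (charge_of_finite_measure (normal_prob 0 s)) mu).
  by apply: Radon_Nikodym_integrable; exact: dom.
have RNE : ae_eq mu setT (Radon_Nikodym (charge_of_finite_measure (normal_prob 0 s)) mu) (fun x => (normal_pdf 0 s x)%:E).
  apply: integral_ae_eq => //; first exact: (measurable_int mu ip).
  by move=> E _ mE; rewrite -Radon_Nikodym_integral.
rewrite -(Radon_Nikodym_change_of_variables dom)//; last exact: bounded_rv_integrable.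
apply: ae_eq_integral => //.
- by apply: emeasurable_funM => //; exact: (measurable_int mu iRN).
- apply/measurable_EFinP/measurable_funM => //; exact: measurable_normal_pdf.
- by apply: filterS RNE => x /= h _; rewrite h.
Qed.

Context {d} {Om : measurableType d} (P : probability Om R) (B : R -> Om -> R).
Hypothesis hB : two_sided_brownian_motion P B.

Lemma Rintegral_law (X : Om -> R) (Q : probability (measurableTypeR R) R) (f : R -> R) :
  measurable_fun setT X -> bounded_rv f ->
  (forall A, measurable A -> P (X @^-1` A) = Q A) ->
  \int[P]_w f (X w) = \int[Q]_x f x.
Proof.
move=> mX bf H; have [mf [M fM]] := bf; congr fine.
have mX' : @measurable_fun _ _ Om (measurableTypeR R) setT X := mX.
pose X' : {mfun Om >-> measurableTypeR R} :=
  HB.pack (X : Om -> measurableTypeR R) (@isMeasurableFun.Build _ _ _ (measurableTypeR R) X mX').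
rewrite -(@integral_distribution _ _ _ _ _ P X' (EFin \o f)).
- apply: (@eq_measure_integral _ (measurableTypeR R) R setT Q (distribution P X')) => /= A mA _.
  exact: H.
- exact/measurable_EFinP.
- apply: bounded_rv_integrable; split; first exact: measurableT_comp.
  by exists M => w; exact: fM.
Qed.

Lemma brownian_increment_polar (s t z : R) : s <= t ->
  char_polar P (fun w => z * (B t w - B s w)) (expR (- (z ^+ 2 * (t - s) / 2))) 0.
Proof.
have [mB _ _ gB _] := hB.
rewrite le_eqVlt => /predU1P[<-|st].
  split; under eq_Rintegral do rewrite subrr mulr0.
    by rewrite cos0 Rintegral_prob_cst subrr mulr0 mul0r oppr0 expR0 mulr1.
  by rewrite sin0 Rintegral_prob_cst mulr0.
have ts : Num.sqrt (t - s) != 0 by rewrite gt_eqF// sqrtr_gt0 subr_gt0.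
have mX : measurable_fun setT (fun w => B t w - B s w) by exact: measurable_funB.
have bc c : bounded_rv (fun x : R => cos (z * x + c)).
  by apply: bounded_rv_cos; apply: measurable_funD => //; exact: mulrl_measurable.
have H c : \int[P]_w cos (z * (B t w - B s w) + c) = expR (- (z ^+ 2 * (t - s) / 2)) * cos c.
  rewrite (Rintegral_law mX (bc c) (gB s t st)) Rintegral_normal_prob//.
  rewrite Rintegral_cos_normal_pdf// sqr_sqrtr ?subr_ge0 ?ltW// mulrC.
  by rewrite [(t - s) * _]mulrC.
split; first by rewrite -H; apply: eq_Rintegral => w _; rewrite addr0.
transitivity (\int[P]_w cos (z * (B t w - B s w) + - (pi / 2))).
  by apply: eq_Rintegral => w _; rewrite cosBpihalf.
by rewrite H cosN cos_pihalf sin0.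
Qed.

(** The intervals of [l] may overlap, so everything is rewritten over the cells of the grid of all
    endpoints, where the increments of [B] are independent and the square of the step function has
    no cross terms. *)
Lemma step_integral_polar (l : seq (R * R * R)) : (forall p, p \in l -> p.1.2 <= p.2) ->
  char_polar P (step_integral B l) (expR (- (\int[mu]_x (step_fun l x) ^+ 2) / 2)) 0 /\
  mu.-integrable setT (EFin \o (fun x => step_fun l x ^+ 2)).
Proof.
move=> hl; have [mB _ _ _ iB] := hB.
pose ends := flatten [seq [:: p.1.2; p.2] | p <- l].
pose srt := sort <=%R ends.
pose k := size srt.
(* Beyond the last endpoint [t] stays constant, so that it is nondecreasing on all of [nat], as the
   independence of increments requires; the last cell, of index [k - 1], is then degenerate. *)
pose t i := nth (last 0 srt) srt i.
have ss : sorted <=%R srt by apply: sort_sorted; exact: le_total.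
have tS i : t i <= t i.+1.
  have [ik|ki] := ltnP i.+1 k.
    by apply: (sorted_leq_nth (@le_trans _ _) (@lexx _ _)) => //; rewrite ?inE//; exact: ltnW.
  rewrite /t [leRHS]nth_default//.
  have [ik|ki'] := ltnP i k; last by rewrite nth_default.
  have -> : i = k.-1 by lia.
  rewrite (set_nth_default 0) ?nth_last// -/k; lia.
have tle i j : (i <= j)%N -> t i <= t j by move=> ij; exact: (homo_leq (@lexx _ _) (@le_trans _ _) tS).
have tE u : u \in ends -> exists2 i, (i < k)%N & t i = u.
  move=> ue; have us : u \in srt by rewrite mem_sort.
  by exists (index u srt); rewrite ?index_mem// /t nth_index.
have tP p : p \in l -> exists i j, [/\ (i <= j < k)%N, t i = p.1.2 & t j = p.2].
  move=> pl; have := hl p pl.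
  have [i ik ti] : exists2 i, (i < k)%N & t i = p.1.2.
    by apply: tE; apply/flattenP; exists [:: p.1.2; p.2]; rewrite ?mem_head//; apply/mapP; exists p.
  have [j jk tj] : exists2 i, (i < k)%N & t i = p.2.
    apply: tE; apply/flattenP; exists [:: p.1.2; p.2]; last by rewrite !inE eqxx orbT.
    by apply/mapP; exists p.
  rewrite -ti -tj => tij; have [ij|ji] := leqP i j; first by exists i, j; rewrite ij.
  have tji : t j = t i by apply/eqP; rewrite eq_le tij andbT tle// ltnW.
  by exists i, i; rewrite leqnn ik tji.
(* [c i] is the value of the step function on (t i, t i.+1]. *)
have [c [cB cS]] : exists c : nat -> R,
    (forall w, step_integral B l w = \sum_(i < k) c i * (B (t i.+1) w - B (t i) w)) /\
    (forall x, step_fun l x = \sum_(i < k) c i * \1_(`]t i, t i.+1]%classic) x).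
  (* The grid of the whole list stays fixed while the induction runs over lists included in it. *)
  have : {subset l <= l} by [].
  rewrite /step_integral /step_fun.
  elim: {1 3 4}l => [_|p l' IH pl].
    exists (fun=> 0); split => [w|x]; rewrite big_nil big1// => i _; by rewrite mul0r.
  have [c [IHB IHS]] := IH (fun x xl => pl x (mem_behead (s := p :: l') xl)).
  have [i [j [/andP[ij jk] ti tj]]] := tP p (pl p (mem_head _ _)).
  pose D (m : nat) : R := if (i <= m < j)%N then p.1.1 else 0.
  (* One telescoping identity serves twice: for the path [B ^~ w], and for [u |-> (x <= u)], whose
     increments are the indicators of the intervals []u, v]] at [x]. *)
  have tel (f : R -> R) :
      p.1.1 * (f p.2 - f p.1.2) = \sum_(m < k) D m * (f (t m.+1) - f (t m)).
    rewrite -(big_mkord xpredT (fun m => D m * (f (t m.+1) - f (t m)))).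
    have ik : (i <= k)%N by lia.
    rewrite (big_cat_nat (leq0n i) ik)/= big1_seq ?add0r; last first.
      move=> m; rewrite mem_index_iota => /andP[_ /andP[_ mi]].
      by rewrite /D ifF ?mul0r//; lia.
    rewrite (big_cat_nat ij (ltnW jk))/= [X in _ = _ + X]big1_seq ?addr0; last first.
      move=> m; rewrite mem_index_iota => /andP[_ /andP[jm _]].
      by rewrite /D ifF ?mul0r//; lia.
    rewrite -ti -tj -(telescope_sumr (f \o t) ij) mulr_sumr.
    by apply: eq_big_nat => m mij; rewrite /D mij.
  exists (fun m => c m + D m); split => [w|x]; rewrite big_cons.
    rewrite IHB (tel (B ^~ w)) -big_split/=; apply: eq_bigr => m _.
    by rewrite mulrDl addrC.
  have ind (u v : R) : u <= v -> \1_(`]u, v]%classic) x = (x <= v)%R%:R - (x <= u)%R%:R :> R.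
    move=> uv; rewrite indicE mem_setE /= in_itv/= ltNge.
    have [xu|ux] := leP x u; first by rewrite (le_trans xu uv)/= subrr.
    by rewrite /= subr0.
  rewrite IHS ind ?hl ?pl ?mem_head// (tel (fun u => (x <= u)%R%:R)) -big_split/=.
  by apply: eq_bigr => m _; rewrite ind// mulrDl addrC.
pose I m : set R := `]t m, t m.+1]%classic.
have sq x : step_fun l x ^+ 2 = \sum_(i < k) c i ^+ 2 * \1_(I i) x.
  rewrite cS expr2 big_distrlr/=; apply: eq_bigr => i _.
  rewrite (bigD1 i)//= big1 ?addr0 => [|j ji].
    rewrite indicE; case: (_ \in _); rewrite ?mulr1 ?mulr0//.
  rewrite !indicE; have [xi|] := boolP (x \in _); last by rewrite mulr0 mul0r.
  have [xj|] := boolP (x \in _); last by rewrite !mulr0.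
  move: xi xj; rewrite !inE/= !in_itv/= => /andP[h1 h2] /andP[h3 h4].
  have [ij|ij|/val_inj ij] := ltngtP i j; last by rewrite ij eqxx in ji.
    by have := lt_le_trans h3 (le_trans h2 (tle _ _ ij)); rewrite ltxx.
  by have := lt_le_trans h1 (le_trans h4 (tle _ _ ij)); rewrite ltxx.
have iI m : mu.-integrable setT (EFin \o \1_(I m)) by exact: integrable_indic_itv.
have iI2 i : mu.-integrable setT (EFin \o (fun x => c i ^+ 2 * \1_(I i) x)).
  exact: (integrableZl measurableT (c i ^+ 2) (iI i)).
split; last first.
  have -> : EFin \o (fun x => step_fun l x ^+ 2) =
      (fun x => \sum_(i < k) (c i ^+ 2 * \1_(I i) x)%R%:E)%E.
    by apply/funext => x; rewrite /= sq sumEFin.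
  by apply: integrable_sum => // i _; exact: iI2.
have lI i : lebesgue_measure (I i) = (t i.+1 - t i)%:E.
  rewrite /I lebesgue_measure_itv/= lte_fin; have := tS i; rewrite le_eqVlt.
  by case/predU1P => [->|-> //]; rewrite ltxx subrr.
have E : \int[mu]_x (step_fun l x ^+ 2) = \sum_(i < k) c i ^+ 2 * (t i.+1 - t i).
  rewrite (_ : \int[mu]_x _ = fine (\int[mu]_x (\sum_(i < k) (c i ^+ 2 * \1_(I i) x)%R%:E)%E)).
    rewrite integral_sum//; last by move=> i; exact: iI2.
    rewrite (_ : (\sum_(i < k) _)%E = (\sum_(i < k) (c i ^+ 2 * (t i.+1 - t i))%R%:E)%E); last first.
      apply: eq_bigr => i _; under eq_integral do rewrite EFinM.
      rewrite integralZl//; last exact: iI.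
      rewrite integral_indic ?setIT//; last exact: measurable_itv.
      exact: (congr1 (fun x => ((c i ^+ 2)%:E * x)%E) (lI i)).
    by rewrite sumEFin.
  by congr fine; apply: eq_integral => x _; rewrite sq sumEFin.
have := @char_polar_sum _ _ _ P k (fun i w => B (t i.+1) w - B (t i) w) c
   (fun i => expR (- (c i ^+ 2 * (t i.+1 - t i) / 2))) (fun=> 0).
rewrite E -expR_sum big1_eq.
rewrite (_ : \sum_(i < k) - (c i ^+ 2 * (t i.+1 - t i) / 2) =
   - (\sum_(i < k) c i ^+ 2 * (t i.+1 - t i)) / 2); last first.
  by rewrite mulNr mulr_suml -sumrN.
move=> H; have := H _ _ _; rewrite (_ : step_integral B l =
  (fun w => \sum_(i < k) c i * (B (t i.+1) w - B (t i) w))); last by apply/funext.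
apply.
- by move=> i; exact: measurable_funB.
- exact: iB.
- by move=> i; exact: brownian_increment_polar.
Qed.

Lemma step_fun_cat (l1 l2 : seq (R * R * R)) x : step_fun (l1 ++ l2) x = step_fun l1 x + step_fun l2 x.
Proof. by rewrite /step_fun big_cat. Qed.

Lemma step_integral_cat (l1 l2 : seq (R * R * R)) w :
  step_integral B (l1 ++ l2) w = step_integral B l1 w + step_integral B l2 w.
Proof. by rewrite /step_integral big_cat. Qed.

Definition scale_steps (c : R) (l : seq (R * R * R)) := [seq (c * p.1.1, p.1.2, p.2) | p <- l].

Lemma step_fun_scale c l x : step_fun (scale_steps c l) x = c * step_fun l x.
Proof.
by rewrite /step_fun big_map mulr_sumr; apply: eq_bigr => p _ /=; rewrite mulrA.
Qed.

Lemma step_integral_scale c l w : step_integral B (scale_steps c l) w = c * step_integral B l w.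
Proof.
by rewrite /step_integral big_map mulr_sumr; apply: eq_bigr => p _ /=; rewrite mulrA.
Qed.

Lemma measurable_step_integral l : measurable_fun setT (step_integral B l).
Proof.
have [mB _ _ _ _] := hB; apply: measurable_sum => p.
by apply: measurable_funM => //; exact: measurable_funB.
Qed.

Lemma measurable_step_fun l : measurable_fun setT (@step_fun R l).
Proof.
by apply: measurable_sum => p; apply: measurable_funM => //.
Qed.

End BrownianIntegral.

(** * Mean-square limits *)

Section SquareMean.
Context {R : realType}.

(** The bounds given by [2 |x y| <= eta x ^ 2 + y ^ 2 / eta] have this shape; it replaces the
    Cauchy-Schwarz inequality and its square roots, with [eta] fixed before [n] tends to
    infinity. *)
Lemma cvg_of_eta_bound (u d : nat -> R) (l c : R) (K : R -> R) :
  0 <= c -> (forall eta, 0 < eta -> 0 <= K eta) ->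
  (forall eta, 0 < eta -> \forall n \near \oo, `|u n - l| <= c * eta + K eta * d n) ->
  d n @[n --> \oo] --> 0 -> u n @[n --> \oo] --> l.
Proof.
move=> c0 K0 H d0; apply/cvgrPdist_le => /= e e0.
pose eta := e / (2 * (c + 1)); have eta0 : 0 < eta by rewrite divr_gt0// mulr_gt0// ltr_wpDl.
have K1 : 0 < K eta + 1 by rewrite ltr_wpDl// K0.
have e2 : 0 < e / (2 * (K eta + 1)) by rewrite divr_gt0// mulr_gt0.
have /cvgrPdist_le/(_ _ e2) dn := d0.
near=> n; rewrite distrC.
have Hn : `|u n - l| <= c * eta + K eta * d n by near: n; exact: H.
have dn' : `|0 - d n| <= e / (2 * (K eta + 1)) by near: n; exact: dn.
rewrite (le_trans Hn)// (_ : e = e / 2 + e / 2); last by rewrite -splitr.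
apply: lerD.
  rewrite /eta mulrA ler_pdivrMr ?mulr_gt0 ?ltr_wpDl//.
  by rewrite [leRHS](_ : _ = e * (c + 1)); [nra|field].
rewrite (@le_trans _ _ (K eta * (e / (2 * (K eta + 1)))))//.
  rewrite ler_wpM2l ?K0// (le_trans _ dn')// sub0r normrN ler_norm//.
rewrite mulrA ler_pdivrMr ?mulr_gt0//.
by rewrite [leRHS](_ : _ = e * (K eta + 1)); [nra|field].
Unshelve. all: by end_near. Qed.

Lemma norm_le_eta (x eta : R) : 0 < eta -> `|x| <= eta + eta^-1 * x ^+ 2.
Proof.
move=> e0; rewrite -[x ^+ 2]real_normK ?num_real//; move: `|x| (normr_ge0 x) => a a0.
rewrite -(ler_pM2l e0) mulrDr mulrA divff ?gt_eqF// mul1r.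
by have := sqr_ge0 (eta - a); have := sqr_ge0 (eta + a); nra.
Qed.

Context {d} {T : measurableType d}.

Lemma cvg_mean_square (P : probability T R) (X : T -> R) (Xn : nat -> T -> R) (h : R -> R) :
  measurable_fun setT X -> (forall n, measurable_fun setT (Xn n)) ->
  bounded_rv h -> (forall x y, `|h x - h y| <= `|x - y|) ->
  (\int[P]_w ((X w - Xn n w) ^+ 2)%:E)%E @[n --> \oo] --> 0%E ->
  \int[P]_w h (Xn n w) @[n --> \oo] --> \int[P]_w h (X w).
Proof.
move=> mX mXn [mh [M hM]] hlip /fine_cvgP[ffin f0].
apply: (@cvg_of_eta_bound _ (fun n => \int[P]_w ((X w - Xn n w) ^+ 2)) _ 1 (fun e => e^-1)) => //.
  by move=> eta e0; rewrite invr_ge0 ltW.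
move=> eta e0; near=> n.
have msq : measurable_fun setT (fun w => (X w - Xn n w) ^+ 2).
  by apply: measurable_funX; exact: measurable_funB.
have isq : P.-integrable setT (EFin \o (fun w => (X w - Xn n w) ^+ 2)).
  apply/integrableP; split; first exact/measurable_EFinP.
  under eq_integral do rewrite /= ger0_norm ?sqr_ge0//.
  rewrite -ge0_fin_numE; last by apply: integral_ge0 => w _; rewrite lee_fin sqr_ge0.
  by near: n; exact: ffin.
have bX : bounded_rv (fun w => h (X w)).
  by split; [exact: measurableT_comp|exists M => w; exact: hM].
have bXn : bounded_rv (fun w => h (Xn n w)).
  by split; [exact: measurableT_comp|exists M => w; exact: hM].
rewrite mul1r -RintegralB//; try exact: bounded_rv_integrable.
have ib : P.-integrable setT (EFin \o (fun w => h (Xn n w) - h (X w))).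
  exact/bounded_rv_integrable/bounded_rvB.
rewrite (le_trans (le_normr_Rintegral _ _))//.
have ir : P.-integrable setT (EFin \o (fun w => eta^-1 * (X w - Xn n w) ^+ 2)).
  exact: (integrableZl measurableT eta^-1 isq).
have ic : P.-integrable setT (EFin \o (fun=> eta : R)).
  exact/bounded_rv_integrable/bounded_rv_cst.
rewrite (_ : eta + _ = \int[P]_w (eta + eta^-1 * (X w - Xn n w) ^+ 2)); last first.
  by rewrite RintegralD// RintegralZl// Rintegral_prob_cst.
apply: le_Rintegral => //.
- exact: (integrable_norm ib).
- exact: (integrableD measurableT ic ir).
- by move=> w _; rewrite (le_trans (hlip _ _))// distrC norm_le_eta.
Unshelve. all: by end_near. Qed.

Lemma cvg_square_norm (mu : {measure set T -> \bar R}) (f : T -> R) (fn : nat -> T -> R) :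
  measurable_fun setT f -> (forall n, measurable_fun setT (fn n)) ->
  mu.-integrable setT (EFin \o (fun x => f x ^+ 2)) ->
  (forall n, mu.-integrable setT (EFin \o (fun x => fn n x ^+ 2))) ->
  (\int[mu]_x ((f x - fn n x) ^+ 2)%:E)%E @[n --> \oo] --> 0%E ->
  \int[mu]_x (fn n x ^+ 2) @[n --> \oo] --> \int[mu]_x (f x ^+ 2).
Proof.
move=> mf mfn if2 ifn /fine_cvgP[ffin f0].
have N0 : 0 <= \int[mu]_x (f x ^+ 2) by apply: Rintegral_ge0 => x _; exact: sqr_ge0.
apply: (@cvg_of_eta_bound _ (fun n => \int[mu]_x ((f x - fn n x) ^+ 2)) _ (\int[mu]_x (f x ^+ 2))
   (fun e => 1 + e^-1)) => //.
  by move=> eta e0; rewrite addr_ge0 ?invr_ge0 ?(ltW e0).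
move=> eta e0; near=> n.
have msq : measurable_fun setT (fun w => (f w - fn n w) ^+ 2).
  by apply: measurable_funX; exact: measurable_funB.
have isq : mu.-integrable setT (EFin \o (fun w => (f w - fn n w) ^+ 2)).
  apply/integrableP; split; first exact/measurable_EFinP.
  under eq_integral do rewrite /= ger0_norm ?sqr_ge0//.
  rewrite -ge0_fin_numE; last by apply: integral_ge0 => w _; rewrite lee_fin sqr_ge0.
  by near: n; exact: ffin.
rewrite -RintegralB//.
have ib : mu.-integrable setT (EFin \o (fun w => fn n w ^+ 2 - f w ^+ 2)).
  exact: (integrableB measurableT (ifn n) if2).
rewrite (le_trans (le_normr_Rintegral _ _))//.
have ir : mu.-integrable setT (EFin \o (fun w => (1 + eta^-1) * (f w - fn n w) ^+ 2)).
  exact: (integrableZl measurableT (1 + eta^-1) isq).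
have ic : mu.-integrable setT (EFin \o (fun w => eta * f w ^+ 2)).
  exact: (integrableZl measurableT eta if2).
rewrite [_ * eta]mulrC -!RintegralZl// -RintegralD//.
apply: le_Rintegral => //.
- exact: (integrable_norm ib).
- exact: (integrableD measurableT ic ir).
- move=> w _; set a := f w; set b := fn n w.
  have -> : b ^+ 2 - a ^+ 2 = (a - b) ^+ 2 + 2 * a * (b - a) by ring.
  rewrite (le_trans (ler_normD _ _))// ger0_norm ?sqr_ge0//.
  have ie : eta * eta^-1 = 1 by rewrite divff// gt_eqF.
  have h1 := sqr_ge0 (eta * a - (b - a)); have h2 := sqr_ge0 (eta * a + (b - a)).
  have ei : 0 < eta^-1 by rewrite invr_gt0.
  have e1 : eta^-1 * (eta * a - (b - a)) ^+ 2 = eta * a ^+ 2 - 2 * a * (b - a) + eta^-1 * (a - b) ^+ 2.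
    by field; rewrite gt_eqF.
  have e2 : eta^-1 * (eta * a + (b - a)) ^+ 2 = eta * a ^+ 2 + 2 * a * (b - a) + eta^-1 * (a - b) ^+ 2.
    by field; rewrite gt_eqF.
  have g1 := mulr_ge0 (ltW ei) h1; have g2 := mulr_ge0 (ltW ei) h2.
  rewrite e1 in g1; rewrite e2 in g2.
  have : `|2 * a * (b - a)| <= eta * a ^+ 2 + eta^-1 * (a - b) ^+ 2.
    by rewrite ler_norml; apply/andP; split; lra.
  lra.
Unshelve. all: by end_near. Qed.

Lemma square_sum_cvg0 (mu : {measure set T -> \bar R}) (f g : nat -> T -> R) :
  (forall n, measurable_fun setT (f n)) -> (forall n, measurable_fun setT (g n)) ->
  (\int[mu]_x ((f n x) ^+ 2)%:E)%E @[n --> \oo] --> 0%E ->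
  (\int[mu]_x ((g n x) ^+ 2)%:E)%E @[n --> \oo] --> 0%E ->
  (\int[mu]_x ((f n x + g n x) ^+ 2)%:E)%E @[n --> \oo] --> 0%E.
Proof.
move=> mf mg f0 g0.
have H : (2%:E * (\int[mu]_x ((f n x) ^+ 2)%:E) + 2%:E * (\int[mu]_x ((g n x) ^+ 2)%:E))%E
    @[n --> \oo] --> (2%:E * 0 + 2%:E * 0)%E.
  apply: cvgeD; first by rewrite mule0.
  - exact: cvgeZl.
  - exact: cvgeZl.
rewrite !mule0 adde0 in H.
apply: (squeeze_cvge _ (cvg_cst 0%E) H); near=> n; apply/andP; split.
  by apply: integral_ge0 => x _; rewrite lee_fin sqr_ge0.
have ms (h : nat -> T -> R) : (forall n, measurable_fun setT (h n)) ->
    measurable_fun setT (fun x => (h n x ^+ 2)%:E).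
  by move=> mh; apply/measurable_EFinP; exact: measurable_funX.
rewrite -!ge0_integralZl_EFin//; try exact: ms; try by move=> x _; rewrite lee_fin sqr_ge0.
rewrite -ge0_integralD//; try by move=> x _; rewrite lee_fin mulr_ge0// sqr_ge0.
- apply: ge0_le_integral => //.
  + by move=> x _; rewrite lee_fin sqr_ge0.
  + by apply/measurable_EFinP/measurable_funX; exact: measurable_funD.
  + by apply: emeasurable_funD; apply: measurable_funeM; exact: ms.
  + move=> x _; rewrite -!EFinM -EFinD lee_fin.
    by have := sqr_ge0 (f n x - g n x); nra.
- by apply: measurable_funeM; exact: ms.
- by apply: measurable_funeM; exact: ms.
Unshelve. all: by end_near. Qed.

End SquareMean.

(** * Law and linearity of the Wiener integral *)

Section WienerIntegral.
Context {R : realType} {d} {Om : measurableType d} (P : probability Om R) (B : R -> Om -> R).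
Hypothesis hB : two_sided_brownian_motion P B.
Local Notation mu := (@lebesgue_measure R).

Lemma wiener_integral_polar (f : R -> R) (I : Om -> R) : measurable_fun setT f ->
  mu.-integrable setT (EFin \o (fun x => f x ^+ 2)) -> is_wiener_integral P B f I ->
  char_polar P I (expR (- (\int[mu]_x (f x ^+ 2)) / 2)) 0.
Proof.
move=> mf if2 [mI [l [hl sl El]]].
rewrite unlock in El.
have mS n := measurable_step_integral hB (l n).
have bcos : bounded_rv (@cos R) by exact: (bounded_rv_cos (@measurable_id _ R setT)).
have bsin : bounded_rv (@sin R) by exact: (bounded_rv_sin (@measurable_id _ R setT)).
have Lc := cvg_mean_square mI mS bcos (@cos_lip R) El.
have Ls := cvg_mean_square mI mS bsin (@sin_lip R) El.
have pol n := step_integral_polar hB (hl n).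
have L2 := @cvg_square_norm _ _ (measurableTypeR R) mu f _ mf
  (fun n => measurable_step_fun (l n)) if2 (fun n => (pol n).2) sl.
have Le : expR (- (\int[mu]_x (step_fun (l n) x ^+ 2)) / 2) @[n --> \oo] -->
    expR (- (\int[mu]_x (f x ^+ 2)) / 2).
  apply: (cvg_comp _ expR); last exact: continuous_expR.
  by apply: cvgMl; exact: cvgN.
rewrite /char_polar cos0 sin0 mulr1 mulr0; split.
    move: Lc; under eq_fun do rewrite (pol _).1.1 cos0 mulr1.
  by move=> Lc; apply: (cvg_unique _ Lc Le); exact: Rhausdorff.
move: Ls; under eq_fun do rewrite (pol _).1.2 sin0 mulr0.
by move=> Ls; apply: (cvg_unique _ Ls); [exact: Rhausdorff|exact: cvg_cst].
Qed.

(** Linearity reduces the joint law of Wiener integrals to [wiener_integral_polar] for a single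
    integrand. The approximating step functions are added by scaling and concatenating their
    lists. *)
Lemma wiener_integral_sum J (s : seq J) (f : J -> R -> R) (I : J -> Om -> R) (th : J -> R) :
  (forall j, measurable_fun setT (f j)) -> (forall j, is_wiener_integral P B (f j) (I j)) ->
  is_wiener_integral P B (fun x => \sum_(j <- s) th j * f j x) (fun w => \sum_(j <- s) th j * I j w).
Proof.
move=> mf HI; have mI j : measurable_fun setT (I j) by case: (HI j).
have mF s' : measurable_fun setT (fun x => \sum_(j <- s') th j * f j x).
  by apply: measurable_sum => j; exact: measurable_funM.
have mG s' : measurable_fun setT (fun w => \sum_(j <- s') th j * I j w).
  by apply: measurable_sum => j; exact: measurable_funM.
have mfS j l : measurable_fun setT (fun x => f j x - step_fun l x).
  by apply: measurable_funB; [exact: mf|exact: measurable_step_fun].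
have mFS s' l : measurable_fun setT (fun x => \sum_(j <- s') th j * f j x - step_fun l x).
  by apply: measurable_funB; [exact: mF|exact: measurable_step_fun].
have mIS j l : measurable_fun setT (fun w => I j w - step_integral B l w).
  by apply: measurable_funB; [exact: mI|exact: (measurable_step_integral hB)].
have mGS s' l : measurable_fun setT (fun w => \sum_(j <- s') th j * I j w - step_integral B l w).
  by apply: measurable_funB; [exact: mG|exact: (measurable_step_integral hB)].
split; first exact: mG.
elim: s => [|j s [l [hl sl El]]].
  exists (fun=> [::]); split => //.
    under eq_fun do under eq_integral do rewrite big_nil /step_fun big_nil subrr expr0n/=.
    by rewrite integral0; exact: cvg_cst.
  rewrite unlock; under eq_fun do under eq_integral do rewrite big_nil /step_integral big_nil subrr expr0n/=.
  by rewrite integral0; exact: cvg_cst.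
have [_ [l' [hl' sl' El']]] := HI j.
exists (fun n => scale_steps (th j) (l' n) ++ l n); split.
- move=> n p; rewrite mem_cat => /orP[/mapP[q ql ->]/=|]; last exact: hl.
  exact: (hl' n).
- under eq_fun do under eq_integral do
    rewrite big_cons step_fun_cat step_fun_scale opprD addrACA -mulrBr.
  apply: (@square_sum_cvg0 _ _ (measurableTypeR R)) => //.
  + by move=> n; apply: measurable_funM => //; exact: mfS.
  + by move=> n; exact: mFS.
  + rewrite (_ : (fun _ => _) = (fun n => (th j ^+ 2)%R%:E * \int[mu]_x ((f j x - step_fun (l' n) x) ^+ 2)%:E)%E).
      by rewrite -(mule0 (th j ^+ 2)%:E); exact: cvgeZl.
    apply/funext => n; rewrite -ge0_integralZl_EFin ?sqr_ge0//.
    * by apply: eq_integral => x _; rewrite -EFinM exprMn.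
    * by move=> x _; rewrite lee_fin sqr_ge0.
    * by apply/measurable_EFinP; apply: measurable_funX; exact: mfS.
- rewrite unlock in El' *; rewrite unlock in El.
  under eq_fun do under eq_integral do
    rewrite big_cons step_integral_cat step_integral_scale opprD addrACA -mulrBr.
  apply: square_sum_cvg0 => //.
  + by move=> n; apply: measurable_funM => //; exact: mIS.
  + rewrite (_ : (fun _ => _) = (fun n => (th j ^+ 2)%R%:E * \int[P]_x ((I j x - step_integral B (l' n) x) ^+ 2)%:E)%E).
      by rewrite -(mule0 (th j ^+ 2)%:E); exact: cvgeZl.
    apply/funext => n; rewrite -ge0_integralZl_EFin ?sqr_ge0//.
    * by apply: eq_integral => x _; rewrite -EFinM exprMn.
    * by move=> x _; rewrite lee_fin sqr_ge0.
    * by apply/measurable_EFinP; apply: measurable_funX; exact: mIS.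
Qed.

End WienerIntegral.

(** * From characteristic functions to Lipschitz functions *)

Section BernsteinOperator.
Context {R : realType}.
Implicit Types (u : R) (f g : nat -> R).

(* [bern N u f] is the mean of [f] under the binomial law with parameters [N]
   and [u]. *)
Fixpoint bern (N : nat) u f : R :=
  if N is N'.+1 then u * bern N' u (f \o S) + (1 - u) * bern N' u f else f 0%N.

Lemma eq_bern N u f g : f =1 g -> bern N u f = bern N u g.
Proof.
elim: N f g => [|N IH] f g fg //=.
by congr (_ * _ + _ * _); apply: IH => // p; exact: fg.
Qed.

Lemma ler_bern N u f g : 0 <= u <= 1 -> (forall p, f p <= g p) -> bern N u f <= bern N u g.
Proof.
move=> /andP[u0 u1]; elim: N f g => [|N IH] f g fg //=.
by rewrite lerD// ler_wpM2l ?subr_ge0//; apply: IH => p //=.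
Qed.

Lemma bern_cst N u c : bern N u (fun=> c) = c.
Proof.
elim: N => //= N IH; rewrite [bern N u (_ \o _)](_ : _ = c); last by rewrite -[RHS]IH.
by ring.
Qed.

Lemma bernB N u f g : bern N u (fun p => f p - g p) = bern N u f - bern N u g.
Proof.
elim: N f g => //= N IH f g; rewrite IH.
rewrite [bern N u (_ \o _)](_ : _ = bern N u (f \o S) - bern N u (g \o S)); last by rewrite -IH.
by ring.
Qed.

Lemma bern_affine N u c a f : bern N u (fun p => c + a * f p) = c + a * bern N u f.
Proof.
elim: N f => //= N IH f; rewrite IH.
rewrite [bern N u (_ \o _)](_ : _ = c + a * bern N u (f \o S)); last by rewrite -IH.
by ring.
Qed.

(** The shift [c] is what the induction needs, since composing with [S] moves it by 1. For
    [c = - N u] this is the variance of the binomial law. *)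
Lemma bern_sqr N u c : bern N u (fun p => (p%:R + c) ^+ 2) = (N%:R * u + c) ^+ 2 + N%:R * u * (1 - u).
Proof.
elim: N c => [|N IH] c /=; first by rewrite !mul0r !add0r addr0.
rewrite IH; rewrite [bern N u (_ \o _)](_ : _ = bern N u (fun p => (p%:R + (1 + c)) ^+ 2)); last first.
  by apply: eq_bern => p /=; rewrite -natr1 addrA.
by rewrite IH -natr1; ring.
Qed.

Lemma norm_bern N u f : 0 <= u <= 1 -> `|bern N u f| <= bern N u (fun p => `|f p|).
Proof.
move=> u01; rewrite ler_norml; apply/andP; split.
  have -> : - bern N u (fun p => `|f p|) = bern N u (fun p => 0 + (-1) * `|f p|).
    by rewrite bern_affine add0r mulN1r.
  by apply: ler_bern => // p; rewrite add0r mulN1r lerNl -normrN ler_norm.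
by apply: ler_bern => // p; exact: ler_norm.
Qed.

(** The weighted bound [norm_le_eta] is averaged; after division by [N] the binomial variance is
    [u (1 - u) / N], at most [1 / N]. *)
Lemma bern_dist N u eta : 0 <= u <= 1 -> 0 < eta -> (0 < N)%N ->
  bern N u (fun p => `|p%:R / N%:R - u|) <= eta + (eta * N%:R)^-1.
Proof.
move=> u01 e0 N0; have N0' : 0 < N%:R :> R by rewrite ltr0n.
have H : bern N u (fun p => eta + (eta^-1 / N%:R ^+ 2) * (p%:R + - (N%:R * u)) ^+ 2) <=
    eta + (eta * N%:R)^-1.
  rewrite bern_affine bern_sqr subrr expr0n/= add0r lerD2l.
  have -> : eta^-1 / N%:R ^+ 2 * (N%:R * u * (1 - u)) = (eta * N%:R)^-1 * (u * (1 - u)).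
    by field; rewrite !gt_eqF.
  rewrite ler_piMr ?invr_ge0 ?mulr_ge0 ?(ltW e0)//; move/andP : u01 => [u0 u1]; nra.
apply: le_trans H; apply: ler_bern => // p.
rewrite (le_trans (norm_le_eta (p%:R / N%:R - u) e0))// lerD2l.
rewrite le_eqVlt; apply/orP; left; apply/eqP.
by field; rewrite !gt_eqF.
Qed.

End BernsteinOperator.

(** * Approximation of Lipschitz functions by trigonometric polynomials *)

Section TrigonometricPolynomials.
Context {R : realType} {k : nat}.
Local Notation V := ('I_k -> R).

(* [(c, th, b)] encodes x |-> c cos(<th, x> + b). *)
Definition trig_poly (l : seq (R * V * R)) (x : V) : R :=
  \sum_(q <- l) q.1.1 * cos (\sum_(j < k) q.1.2 j * x j + q.2).

Definition is_trig (f : V -> R) := exists l, forall x, f x = trig_poly l x.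

Lemma is_trig_cst c : is_trig (fun=> c).
Proof.
exists [:: (c, fun=> 0, 0)] => x; rewrite /trig_poly big_seq1/= big1 ?addr0 ?cos0 ?mulr1//.
by move=> j _; rewrite mul0r.
Qed.

Lemma is_trigD f g : is_trig f -> is_trig g -> is_trig (fun x => f x + g x).
Proof. by move=> [l fl] [m gm]; exists (l ++ m) => x; rewrite /trig_poly big_cat/= fl gm. Qed.

Lemma is_trigM f g : is_trig f -> is_trig g -> is_trig (fun x => f x * g x).
Proof.
move=> [l fl] [m gm].
suff : is_trig (fun x => trig_poly l x * trig_poly m x).
  by move=> [l' H]; exists l' => x; rewrite fl gm H.
elim: l {fl} => [|[[c th] b] l [l' IH]].
  by exists [::] => x; rewrite /trig_poly !big_nil mul0r.
suff [l1 H1] : is_trig (fun x => c * cos (\sum_(j < k) th j * x j + b) * trig_poly m x).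
  exists (l1 ++ l') => x; rewrite {1}/trig_poly big_cons mulrDl H1 [X in _ + X]IH.
  by rewrite {3}/trig_poly big_cat.
elim: m {gm IH} => [|[[c' th'] b'] m [l1 IH]].
  by exists [::] => x; rewrite /trig_poly !big_nil mulr0.
exists ([:: (c * c' / 2, fun j => th j + th' j, b + b'); (c * c' / 2, fun j => th j - th' j, b - b')] ++ l1) => x.
rewrite {1}/trig_poly big_cons mulrDr [X in _ + X]IH /trig_poly !big_cons/= addrA; congr (_ + _).
have -> : \sum_(j < k) (th j + th' j) * x j + (b + b') =
    (\sum_(j < k) th j * x j + b) + (\sum_(j < k) th' j * x j + b').
  by rewrite addrACA -big_split/=; congr (_ + _); apply: eq_bigr => j _; rewrite mulrDl.
have -> : \sum_(j < k) (th j - th' j) * x j + (b - b') =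
    (\sum_(j < k) th j * x j + b) - (\sum_(j < k) th' j * x j + b').
  by rewrite opprD addrACA -sumrB/=; congr (_ + _); apply: eq_bigr => j _; rewrite mulrBl.
by move: (_ + b) (_ + b') => y z; rewrite cosD cosB; field.
Qed.

Lemma is_trig_sin (M : R) j : is_trig (fun x => sin (x j / M)).
Proof.
exists [:: (1, fun i => if i == j then M^-1 else 0, - (pi / 2))] => x.
rewrite /trig_poly big_seq1/= mul1r (bigD1 j)//= eqxx big1 ?addr0.
  by rewrite cosBpihalf mulrC.
by move=> i /negbTE ->; rewrite mul0r.
Qed.

(** For fixed [N] the operator is a polynomial in [g], linear in [f], and trigonometric polynomials
    form an algebra. *)
Lemma is_trig_bern N (g : V -> R) (f : nat -> V -> R) : is_trig g -> (forall p, is_trig (f p)) ->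
  is_trig (fun x => bern N (g x) (f ^~ x)).
Proof.
move=> tg; elim: N f => [|N IH] f tf /=; first exact: tf.
apply: is_trigD; first by apply: is_trigM => //; exact: (IH (fun p => f p.+1) (fun p => tf p.+1)).
apply: is_trigM; last exact: IH.
apply: is_trigD; first exact: is_trig_cst.
have [l H] := is_trigM (is_trig_cst (-1)) tg.
by exists l => x; rewrite -H mulN1r.
Qed.

Definition lipschitz_l1 (L : R) (F : V -> R) := forall u v, `|F u - F v| <= L * \sum_(j < k) `|u j - v j|.

Definition upd (u : V) j (c : R) : V := fun i => if i == j then c else u i.

(** Bernstein approximation in one coordinate at a time: [js] lists the coordinates on which [F]
    still depends. A coordinate enters only through [g j x] in [[0, 1]], which is itself
    trigonometric, so that the approximants are trigonometric in [x]. *)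
Lemma trig_approx_box (g : 'I_k -> V -> R) (L : R) : 0 <= L ->
  (forall j, is_trig (g j)) -> (forall j x, 0 <= g j x <= 1) ->
  forall (js : seq 'I_k) (F : V -> R) del, lipschitz_l1 L F -> 0 < del ->
  (forall u v, (forall j, j \in js -> u j = v j) -> F u = F v) ->
  exists2 q, is_trig q & forall x, `|q x - F (g ^~ x)| <= del.
Proof.
move=> L0 tg g01; elim=> [|j js IH] F del LF d0 dF.
  exists (fun=> F (fun=> 0)); first exact: is_trig_cst.
  by move=> x; rewrite (dF _ (g ^~ x))// subrr normr0 ltW.
(* Half of [del] goes to the remaining coordinates. The other half covers [L] times the Bernstein
   error, which is at most [2 * eta] once [(eta * N)^-1 <= eta]. *)
pose eta := del / (4 * (L + 1)).
have L1 : 0 < L + 1 by rewrite ltr_wpDl.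
have e0 : 0 < eta by rewrite divr_gt0// mulr_gt0.
pose N := (Num.truncn (eta^-1 / eta)).+1.
have N0 : 0 < N%:R :> R by rewrite ltr0n.
have eN : (eta * N%:R)^-1 <= eta.
  have H := ltW (truncnS_gt (eta^-1 / eta)); rewrite -/N in H.
  rewrite invfM; rewrite ler_pdivrMr// in H *.
  by rewrite ler_pdivrMr// mulrC.
have d2 : 0 < del / 2 by rewrite divr_gt0.
have /choice[q Hq] : forall p : nat, exists q, is_trig q /\
    forall x, `|q x - F (upd (g ^~ x) j (p%:R / N%:R))| <= del / 2.
  move=> p; have [||q tq Hq] := IH (fun u => F (upd u j (p%:R / N%:R))) (del / 2) _ d2.
  - move=> u v; rewrite (le_trans (LF _ _))// ler_wpM2l// ler_sum// => i _.
    by rewrite /upd; case: eqP => // _; rewrite subrr normr0.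
  - move=> u v uv; apply: dF => i; rewrite inE /upd; case: eqP => //= _; exact: uv.
  - by exists q.
exists (fun x => bern N (g j x) (q ^~ x)).
  by apply: is_trig_bern => // p; case: (Hq p).
move=> x; have gx := g01 j x.
pose Fx p := F (upd (g ^~ x) j (p%:R / N%:R)).
have -> : bern N (g j x) (q ^~ x) - F (g ^~ x) =
    bern N (g j x) (fun p => q p x - Fx p) + bern N (g j x) (fun p => Fx p - F (g ^~ x)).
  by rewrite !bernB bern_cst; ring.
rewrite (le_trans (ler_normD _ _))// [leRHS]splitr lerD//.
  rewrite (le_trans (norm_bern _ _ gx))// -[leRHS](bern_cst N (g j x)); apply: ler_bern => // p.
  by have [_] := Hq p; exact.
rewrite (le_trans (norm_bern _ _ gx))//.
rewrite (@le_trans _ _ (bern N (g j x) (fun p => 0 + L * `|p%:R / N%:R - g j x|)))//.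
  apply: ler_bern => // p; rewrite add0r (le_trans (LF _ _))// ler_wpM2l//.
  rewrite (bigD1 j)//= big1 ?addr0; first by rewrite /upd eqxx.
  by move=> i /negbTE ij; rewrite /upd ij subrr normr0.
rewrite bern_affine add0r (@le_trans _ _ (L * (eta + eta)))//.
  rewrite ler_wpM2l// (le_trans (bern_dist gx e0 _))// lerD2l//.
rewrite (_ : del / 2 = (L + 1) * (eta + eta)); first by rewrite ler_wpM2r ?addr_ge0 ?(ltW e0)// lerDl.
by rewrite /eta; field; rewrite gt_eqF.
Qed.

(** Replacing [x j] by [M * sin (x j / M)] brings the argument into a box without truncation, at a
    cost of at most [2 * x j ^ 2 / M] per coordinate. [M] is chosen to make [2 * L / M <= eta];
    second moments will integrate the quadratic error. *)
Lemma trig_approx (F : V -> R) L eta : 0 <= L -> lipschitz_l1 L F -> 0 < eta ->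
  exists2 q, is_trig q & forall x, `|q x - F x| <= eta * (1 + \sum_(j < k) x j ^+ 2).
Proof.
move=> L0 LF e0.
pose M := 2 * L / eta + 1.
have M0 : 0 < M by rewrite ltr_wpDl// divr_ge0 ?mulr_ge0 ?(ltW e0).
pose g (j : 'I_k) (x : V) := (1 + sin (x j / M)) / 2.
pose G (u : V) := F (fun j => M * (2 * u j - 1)).
have tg j : is_trig (g j).
  apply: is_trigM; last exact: is_trig_cst.
  by apply: is_trigD; [exact: is_trig_cst|exact: is_trig_sin].
have g01 j x : 0 <= g j x <= 1.
  by have := sin_max (x j / M); rewrite ler_norml /g => /andP[]; lra.
have LG : lipschitz_l1 (2 * L * M) G.
  move=> u v; rewrite (le_trans (LF _ _))// [2 * L]mulrC -!mulrA ler_wpM2l//.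
  rewrite mulrA mulr_sumr ler_sum// => j _.
  rewrite -mulrBr normrM ger0_norm ?(ltW M0)// mulrC [2 * M]mulrC -mulrA mulrC ler_wpM2l ?(ltW M0)//.
  by rewrite opprB addrA subrK -mulrBr normrM ger0_norm.
have LM : 0 <= 2 * L * M by rewrite !mulr_ge0 ?(ltW M0).
have [|q tq Hq] := trig_approx_box LM tg g01 LG e0 (js := enum 'I_k).
  by move=> u v uv; congr F; apply/funext => j; rewrite uv// mem_enum.
exists q => // x.
have -> : q x - F x = (q x - G (g ^~ x)) + (G (g ^~ x) - F x) by ring.
rewrite (le_trans (ler_normD _ _))// mulrDr mulr1 lerD// (le_trans (LF _ _))//.
rewrite (@le_trans _ _ (L * \sum_(j < k) (2 / M * x j ^+ 2)))//.
  rewrite ler_wpM2l// ler_sum// => j _.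
  have -> : M * (2 * g j x - 1) - x j = M * (sin (x j / M) - x j / M).
    by rewrite /g; field; rewrite gt_eqF.
  rewrite normrM ger0_norm ?(ltW M0)//.
  rewrite (_ : 2 / M * x j ^+ 2 = M * (2 * (x j / M) ^+ 2)).
    by rewrite ler_wpM2l ?(ltW M0)// sinB_le2.
  by field; rewrite gt_eqF.
rewrite -mulr_sumr mulrA ler_wpM2r ?sumr_ge0//; first by move=> j _; exact: sqr_ge0.
rewrite mulrA ler_pdivrMr//.
have -> : eta * M = L * 2 + eta by rewrite /M; field; rewrite gt_eqF.
by rewrite lerDl ltW.
Qed.

End TrigonometricPolynomials.

(** * From characteristic functions to expectations of Lipschitz functions *)

Section CharacteristicConvergence.
Context {R : realType} {k : nat}.

Lemma measurable_trig d (T : measurableType d) (X : 'I_k -> T -> R) (q : ('I_k -> R) -> R) :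
  (forall j, measurable_fun setT (X j)) -> is_trig q ->
  bounded_rv (fun w => q (X ^~ w)).
Proof.
move=> mX [l ql]; rewrite (_ : (fun w => _) =
   (fun w => \sum_(p <- l) p.1.1 * cos (\sum_(j < k) p.1.2 j * X j w + p.2))); last first.
  by apply/funext => w; rewrite ql.
apply: bounded_rv_sum => p; apply: bounded_rvM; first exact: bounded_rv_cst.
apply: (@bounded_rv_cos _ _ _ (fun w => \sum_(j < k) p.1.2 j * X j w + p.2)).
apply: measurable_funD => //; apply: measurable_sum => j; exact: measurable_funM.
Qed.

(** Such a function is a pointwise limit of the trigonometric polynomials of [trig_approx], taken
    with [eta = 1 / (n+1)]. *)
Lemma measurable_lipschitz d (T : measurableType d) (X : 'I_k -> T -> R) (F : ('I_k -> R) -> R) L :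
  (forall j, measurable_fun setT (X j)) -> 0 <= L -> lipschitz_l1 L F ->
  measurable_fun setT (fun w => F (X ^~ w)).
Proof.
move=> mX L0 LF.
have /choice[q Hq] : forall n : nat, exists q, is_trig q /\
    forall x, `|q x - F x| <= n.+1%:R^-1 * (1 + \sum_(j < k) x j ^+ 2).
  move=> n; have n0 : 0 < n.+1%:R^-1 :> R by rewrite invr_gt0.
  by have [q tq Hq] := trig_approx L0 LF n0; exists q.
apply: (@measurable_fun_cvg _ _ _ setT (fun n w => q n (X ^~ w))) => //.
  by move=> n; have [tq _] := Hq n; have [] := measurable_trig mX tq.
move=> w _; pose c := 1 + \sum_(j < k) X j w ^+ 2.
apply/cvgrPdist_le => /= e e0.
have Hc : harmonic n * c @[n --> \oo] --> (0 : R).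
  by rewrite -(mul0r c); apply: cvgMl; exact: cvg_harmonic.
have /cvgrPdist_le/(_ _ e0) H := Hc.
near=> n; rewrite distrC; have [_ Hn] := Hq n; rewrite (le_trans (Hn _))//.
have Hn' : `|0 - harmonic n * c| <= e by near: n; exact: H.
by rewrite (le_trans _ Hn')// sub0r normrN ler_norm.
Unshelve. all: by end_near. Qed.

Lemma trig_approx_mean d (T : measurableType d) (P : probability T R) (X : 'I_k -> T -> R)
   (F q : ('I_k -> R) -> R) L eta W :
  (forall j, measurable_fun setT (X j)) -> 0 <= L -> lipschitz_l1 L F ->
  (exists M, forall x, `|F x| <= M) -> is_trig q -> 0 < eta ->
  (forall x, `|q x - F x| <= eta * (1 + \sum_(j < k) x j ^+ 2)) ->
  (forall j, (\int[P]_w (X j w ^+ 2)%:E <= W%:E)%E) ->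
  `|\int[P]_w q (X ^~ w) - \int[P]_w F (X ^~ w)| <= eta * (1 + k%:R * W).
Proof.
move=> mX L0 LF [M FM] tq e0 qF XW.
have bq := measurable_trig mX tq.
have bF : bounded_rv (fun w => F (X ^~ w)).
  by split; [exact: measurable_lipschitz L0 LF|exists M => w; exact: FM].
have mX2 j : measurable_fun setT (fun w => X j w ^+ 2) by exact: measurable_funX.
have iX j : P.-integrable setT (EFin \o (fun w => X j w ^+ 2)).
  apply/integrableP; split; first exact/measurable_EFinP.
  under eq_integral do rewrite /= ger0_norm ?sqr_ge0//.
  by rewrite (le_lt_trans (XW j))// ltry.
have iS : P.-integrable setT (EFin \o (fun w => \sum_(j < k) X j w ^+ 2)).
  rewrite (_ : EFin \o _ = (fun w => \sum_(j < k) (X j w ^+ 2)%R%:E)%E).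
    by apply: integrable_sum => // j _; exact: iX.
  by apply/funext => w; rewrite /= sumEFin.
rewrite -RintegralB//; try exact: bounded_rv_integrable.
have iB := bounded_rv_integrable P (bounded_rvB bq bF).
rewrite (le_trans (le_normr_Rintegral _ _))//.
have ic : P.-integrable setT (EFin \o (fun=> 1 : R)).
  exact/bounded_rv_integrable/bounded_rv_cst.
have i1 := integrableD measurableT ic iS.
have i2 : P.-integrable setT (EFin \o (fun w => eta * (1 + \sum_(j < k) X j w ^+ 2))).
  exact: (integrableZl measurableT eta i1).
rewrite (@le_trans _ _ (\int[P]_w (eta * (1 + \sum_(j < k) X j w ^+ 2))))//.
  by apply: le_Rintegral => //; exact: (integrable_norm iB).
rewrite RintegralZl// ler_wpM2l ?(ltW e0)// RintegralD// Rintegral_prob_cst lerD2l.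
rewrite Rintegral_sum// (@le_trans _ _ (\sum_(j < k) W))//; last first.
  by rewrite sumr_const card_ord mulr_natl.
apply: ler_sum => j _; rewrite -lee_fin /Rintegral fineK//.
exact: (integrable_fin_num measurableT (iX j)).
Qed.

Lemma char_cvg_lipschitz (d : nat -> measure_display) (Om : forall n, measurableType (d n))
    (P : forall n, probability (Om n) R) (X : forall n, 'I_k -> Om n -> R)
    (d' : measure_display) (Om' : measurableType d') (P' : probability Om' R) (Y : 'I_k -> Om' -> R)
    (F : ('I_k -> R) -> R) L W :
  (\forall n \near \oo, forall j, measurable_fun setT (X n j)) ->
  (forall j, measurable_fun setT (Y j)) ->
  (\forall n \near \oo, forall j, (\int[P n]_w (X n j w ^+ 2)%:E <= W%:E)%E) ->
  (forall j, (\int[P']_w (Y j w ^+ 2)%:E <= W%:E)%E) ->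
  (forall th, \int[P n]_w cos (\sum_(j < k) th j * X n j w) @[n --> \oo] -->
     \int[P']_w cos (\sum_(j < k) th j * Y j w)) ->
  (forall th, \int[P n]_w sin (\sum_(j < k) th j * X n j w) @[n --> \oo] -->
     \int[P']_w sin (\sum_(j < k) th j * Y j w)) ->
  0 <= L -> lipschitz_l1 L F -> (exists M, forall x, `|F x| <= M) ->
  \int[P n]_w F (X n ^~ w) @[n --> \oo] --> \int[P']_w F (Y ^~ w).
Proof.
move=> mX mY XW YW Hc Hs L0 LF bF.
have trig_cvg q : is_trig q -> \int[P n]_w q (X n ^~ w) @[n --> \oo] --> \int[P']_w q (Y ^~ w).
  move=> [l ql].
  pose E d0 (T : measurableType d0) (Q : probability T R) (Z : 'I_k -> T -> R) :=
    \sum_(p <- l) (p.1.1 * (cos p.2 * \int[Q]_w cos (\sum_(j < k) p.1.2 j * Z j w) -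
       sin p.2 * \int[Q]_w sin (\sum_(j < k) p.1.2 j * Z j w))).
  have EE d0 (T : measurableType d0) (Q : probability T R) (Z : 'I_k -> T -> R) :
     (forall j, measurable_fun setT (Z j)) -> \int[Q]_w q (Z ^~ w) = E _ _ Q Z.
    move=> mZ; under eq_Rintegral do rewrite ql /trig_poly.
    have mS p : measurable_fun setT (fun w => \sum_(j < k) p j * Z j w).
      by apply: measurable_sum => j; exact: measurable_funM.
    have bc p : bounded_rv (fun w => cos (\sum_(j < k) p j * Z j w)) := bounded_rv_cos (mS p).
    have bs p : bounded_rv (fun w => sin (\sum_(j < k) p j * Z j w)) := bounded_rv_sin (mS p).
    have bcc p c := bounded_rvM (bc p) (bounded_rv_cst c).
    have bss p c := bounded_rvM (bs p) (bounded_rv_cst c).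
    rewrite Rintegral_sum.
      apply: eq_bigr => p _; under eq_Rintegral do rewrite cosD.
      rewrite RintegralZl//; last by apply: bounded_rv_integrable; exact: bounded_rvB (bcc _ _) (bss _ _).
      rewrite RintegralB//; [|exact: bounded_rv_integrable (bcc _ _)|exact: bounded_rv_integrable (bss _ _)].
      rewrite !RintegralZr//; [|exact: bounded_rv_integrable (bs _)|exact: bounded_rv_integrable (bc _)].
      by rewrite [_ * cos p.2]mulrC [_ * sin p.2]mulrC.
    move=> p; apply/bounded_rv_integrable/bounded_rvM; first exact: bounded_rv_cst.
    apply: (@bounded_rv_cos _ _ _ (fun w => \sum_(j < k) p.1.2 j * Z j w + p.2)).
    by apply: measurable_funD.
  rewrite EE//.
  have : E _ _ (P n) (X n) @[n --> \oo] --> E _ _ P' Y.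
    rewrite /E; elim: {ql E EE}l => [|p l IH].
      by under eq_fun do rewrite big_nil; rewrite big_nil; exact: cvg_cst.
    under eq_fun do rewrite big_cons.
    rewrite big_cons; apply: cvgD IH; apply: cvgMr; apply: cvgB; apply: cvgMr; [exact: Hc|exact: Hs].
  move=> H; apply: cvg_trans H; apply: near_eq_cvg; near=> n; rewrite EE//.
  by near: n; exact: mX.
have KW : 0 <= 1 + k%:R * `|W| by rewrite addr_ge0// mulr_ge0.
apply/cvgrPdist_le => /= e e0.
(* The two approximation errors are [e / 4] each, leaving [e / 2] for the trigonometric polynomial.
   The absolute value of [W] keeps the denominator positive whatever its sign. *)
pose eta := e / (4 * (1 + k%:R * `|W|)).
have KW' : 0 < 1 + k%:R * `|W| by rewrite ltr_pwDl// mulr_ge0.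
have eta0 : 0 < eta by rewrite divr_gt0// mulr_gt0.
have [q tq Hq] := trig_approx L0 LF eta0.
have e2 : 0 < e / 2 by rewrite divr_gt0.
have /cvgrPdist_le/(_ _ e2) Tq := trig_cvg q tq.
have WW : (W%:E <= `|W|%:E)%E by rewrite lee_fin ler_norm.
near=> n.
have T1 : `|\int[P']_w q (Y ^~ w) - \int[P n]_w q (X n ^~ w)| <= e / 2 by near: n; exact: Tq.
have mXn : forall j, measurable_fun setT (X n j) by near: n; exact: mX.
have XnW : forall j, (\int[P n]_w (X n j w ^+ 2)%:E <= W%:E)%E by near: n; exact: XW.
have T2 := @trig_approx_mean _ _ (P n) (X n) F q L eta `|W| mXn L0 LF bF tq eta0 Hq
  (fun j => le_trans (XnW j) WW).
have T3 := @trig_approx_mean _ _ P' Y F q L eta `|W| mY L0 LF bF tq eta0 Hq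
  (fun j => le_trans (YW j) WW).
have eE : eta * (1 + k%:R * `|W|) = e / 4 by rewrite /eta; field; rewrite gt_eqF.
rewrite eE in T2 T3; move: T1 T2 T3.
by rewrite !ler_norml => /andP[? ?] /andP[? ?] /andP[? ?]; apply/andP; split; lra.
Unshelve. all: by end_near. Qed.

End CharacteristicConvergence.

(** * Moments from characteristic functions *)

Section LevyMoments.
Context {R : realType} (nu : {measure set (measurableTypeR R) -> \bar R}) (gamma b : R).
Hypothesis i2 : nu.-integrable setT (EFin \o (fun x : R => x ^+ 2)).
Hypothesis i3 : nu.-integrable setT (EFin \o (fun x : R => `|x| ^+ 3)).
Hypothesis i4 : nu.-integrable setT (EFin \o (fun x : R => x ^+ 4)).

Let D : set (measurableTypeR R) := [set~ 0].

Let mD : measurable D. Proof. by apply: measurableC; exact: measurable_set1. Qed.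

Let M2 := \int[nu]_x (x ^+ 2).
Let M3 := \int[nu]_x (`|x| ^+ 3).
Let M4 := \int[nu]_x (x ^+ 4).

Let Rint_D (f : R -> R) : f 0 = 0 -> \int[nu]_(x in D) f x = \int[nu]_x f x.
Proof.
move=> f0; rewrite Rintegral_mkcond; apply: eq_Rintegral => x _.
by rewrite patchE; case: ifPn => //; rewrite notin_setE /D/= => /contrapT ->.
Qed.

Let int_D (f : R -> R) : nu.-integrable setT (EFin \o f) -> nu.-integrable D (EFin \o f).
Proof. by apply: integrableS => //; exact: measurableT. Qed.

Let dom_int (c : R) (f g : R -> R) : measurable_fun setT f -> nu.-integrable setT (EFin \o g) ->
  (forall x, `|f x| <= c * g x) -> nu.-integrable D (EFin \o f).
Proof.
move=> mf ig fg; apply: int_D.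
apply: (le_integrable measurableT _ _ (integrableZl measurableT c ig)) => [|x _].
  exact/measurable_EFinP.
by rewrite /= lee_fin (le_trans (fg x))// ler_norm.
Qed.

Let mmul (y : R) : measurable_fun setT (fun x : R => y * x). Proof. exact: mulrl_measurable. Qed.

Let mcos (y : R) : measurable_fun setT (fun x : R => cos (y * x)).
Proof. by have [] := bounded_rv_cos (mmul y). Qed.

Let msin (y : R) : measurable_fun setT (fun x : R => sin (y * x)).
Proof. by have [] := bounded_rv_sin (mmul y). Qed.

Let icos (y : R) : nu.-integrable D (EFin \o (fun x : R => cos (y * x) - 1)).
Proof.
apply: (@dom_int (y ^+ 2) _ (fun x => x ^+ 2)) => // [|x]; first exact: measurable_funB.
by rewrite (le_trans (cosB1_le _))// exprMn.
Qed.

Let K (y : R) := \int[nu]_(x in D) (cos (y * x) - 1).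

Let Zcos (c y : R) : \int[nu]_(x in D) (c * (cos (y * x) - 1)) = c * K y.
Proof. exact: (RintegralZl c mD (icos y)). Qed.

Let reE y : re_exponent b nu y = - (2^-1 * b ^+ 2 * y ^+ 2) + K y.
Proof. by []. Qed.

Lemma re_exponent_le0 y : re_exponent b nu y <= 0.
Proof.
rewrite reE addrC subr_le0 (@le_trans _ _ 0)//; last first.
  by rewrite mulr_ge0 ?sqr_ge0// mulr_ge0 ?sqr_ge0// invr_ge0.
rewrite -oppr_ge0 -mulN1r -Zcos.
by apply: Rintegral_ge0 => x _; rewrite mulN1r opprB subr_ge0 cos_le1.
Qed.

(** The bound [1 - cos y <= y ^ 2] loses a factor 2 on the jump part only, hence the combination
    [b ^ 2 / 2 + M2]. *)
Lemma re_exponent_ge y : - (y ^+ 2 * (b ^+ 2 / 2 + M2)) <= re_exponent b nu y.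
Proof.
rewrite reE mulrDr opprD lerD//; first by rewrite lerN2; lra.
have -> : y ^+ 2 * M2 = \int[nu]_(x in D) (y ^+ 2 * x ^+ 2).
  by rewrite /M2 -(RintegralZl _ measurableT i2) -Rint_D// expr0n/= mulr0.
rewrite lerNl -mulN1r -Zcos; apply: le_Rintegral => //.
- exact: (integrableZl mD (-1) (icos y)).
- exact: (integrableZl mD (y ^+ 2) (int_D i2)).
- by move=> x _; rewrite -exprMn (le_trans _ (cosB1_le _))// mulN1r -normrN ler_norm.
Qed.

(** Here the quadratic coefficient is exact, since it produces the limiting variance; the third
    absolute moment bounds the remainder. *)
Lemma re_exponent_taylor y :
  `|re_exponent b nu y + y ^+ 2 * (b ^+ 2 + M2) / 2| <= 2 * `|y| ^+ 3 * M3.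
Proof.
have E : re_exponent b nu y + y ^+ 2 * (b ^+ 2 + M2) / 2 =
    \int[nu]_(x in D) (cos (y * x) - 1 + (y * x) ^+ 2 / 2).
  have i2' : nu.-integrable D (EFin \o (fun x : R => (y ^+ 2 / 2) * x ^+ 2)).
    exact: (integrableZl mD (y ^+ 2 / 2) (int_D i2)).
  transitivity (\int[nu]_(x in D) ((cos (y * x) - 1) + (y ^+ 2 / 2) * x ^+ 2)).
    rewrite RintegralD// RintegralZl//; last exact: int_D.
    rewrite (Rint_D (f := fun x => x ^+ 2)) ?expr0n// reE /K -/M2; lra.
  by apply: eq_Rintegral => x _; rewrite exprMn mulrAC.
have ib : nu.-integrable D (EFin \o (fun x : R => cos (y * x) - 1 + (y * x) ^+ 2 / 2)).
  apply: (@dom_int (2 * `|y| ^+ 3) _ (fun x => `|x| ^+ 3)) => // [|x].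
    apply: measurable_funD; first exact: measurable_funB.
    by apply: measurable_funM => //; exact: measurable_funX.
  by rewrite (le_trans (cosB_le3 _))// normrM exprMn mulrA.
rewrite E (le_trans (le_normr_Rintegral _ _))//.
rewrite -RintegralZl// -(Rint_D (f := fun x => 2 * `|y| ^+ 3 * `|x| ^+ 3)); last first.
  by rewrite normr0 expr0n/= mulr0.
apply: le_Rintegral => //.
- exact: (integrable_norm ib).
- exact: (integrableZl mD (2 * `|y| ^+ 3) (int_D i3)).
- by move=> x _; rewrite (le_trans (cosB_le3 _))// normrM exprMn mulrA.
Qed.

(** The mean of the basis per unit area: the drift [gamma] plus the jumps larger than 1, which the
    exponent leaves uncompensated. *)
Definition levy_mean : R := gamma + \int[nu]_(x in D) (x * (1 - \1_(`[-1, 1]%classic) x)).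

(** Subtracting the mean compensates all jumps, so that the integrand becomes [sin (y * x) - y * x],
    which is cubic. *)
Lemma im_exponent_le3 y : `|im_exponent gamma nu y - levy_mean * y| <= `|y| ^+ 3 * M3.
Proof.
have m1 : measurable_fun setT (\1_(`[-1, 1]%classic) : R -> R) by exact: measurable_indic.
have i01 (x : R) : x * (1 - \1_(`[-1, 1]%classic) x) <> 0 -> 1 <= `|x|.
  rewrite indicE; case: (boolP (x \in _)) => [_|]; first by rewrite subrr mulr0.
  rewrite notin_setE/= in_itv/= -ler_norml => /negP; rewrite -ltNge => /ltW //.
have ix : nu.-integrable D (EFin \o (fun x : R => x * (1 - \1_(`[-1, 1]%classic) x))).
  apply: (@dom_int 1 _ (fun x => x ^+ 2)) => // [|x].
    by apply: measurable_funM => //; exact: measurable_funB.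
  rewrite mul1r; have [->|/eqP/i01 x1] := eqVneq (x * (1 - \1_(`[-1, 1]%classic) x)) 0.
    by rewrite normr0 sqr_ge0.
  rewrite normrM -real_normK ?num_real// expr2 ler_wpM2l//.
  rewrite (le_trans _ x1)// indicE; case: (_ \in _); rewrite ?subrr ?normr0// subr0 normr1//.
have is_ : nu.-integrable D (EFin \o (fun x : R => sin (y * x) - y * x)).
  apply: (@dom_int (2 * y ^+ 2) _ (fun x => x ^+ 2)) => // [|x]; first exact: measurable_funB.
  by rewrite (le_trans (sinB_le2 _))// exprMn mulrA.
have E : im_exponent gamma nu y - levy_mean * y = \int[nu]_(x in D) (sin (y * x) - y * x).
  rewrite /im_exponent /levy_mean.
  have -> : \int[nu]_(x in D) (sin (y * x) - y * x * \1_(`[-1, 1]%classic) x) =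
      \int[nu]_(x in D) (sin (y * x) - y * x) +
      \int[nu]_(x in D) (y * (x * (1 - \1_(`[-1, 1]%classic) x))).
    rewrite -RintegralD//; last exact: (integrableZl mD y ix).
    by apply: eq_Rintegral => x _; ring.
  by rewrite RintegralZl//; ring.
rewrite E (le_trans (le_normr_Rintegral _ _))//.
rewrite -RintegralZl// -(Rint_D (f := fun x => `|y| ^+ 3 * `|x| ^+ 3)); last first.
  by rewrite normr0 expr0n/= mulr0.
apply: le_Rintegral => //.
- exact: (integrable_norm is_).
- exact: (integrableZl mD (`|y| ^+ 3) (int_D i3)).
- by move=> x _; rewrite (le_trans (sinB_le3 _))// normrM exprMn.
Qed.

(* The left-hand side is the integral of (1 - cos (u x)) (1 - cos (v x)). *)
Lemma re_exponent_mixed (u v : R) :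
  - re_exponent b nu u - re_exponent b nu v +
    (re_exponent b nu (u + v) + re_exponent b nu (u - v)) / 2 <= u ^+ 2 * v ^+ 2 * M4.
Proof.
have ip : nu.-integrable D (EFin \o (fun x : R => (1 - cos (u * x)) * (1 - cos (v * x)))).
  apply: (@dom_int (u ^+ 2 * v ^+ 2) _ (fun x => x ^+ 4)) => // [|x].
    by apply: measurable_funM; apply: measurable_funB.
  rewrite normrM ![`|1 - _|]distrC (_ : _ * x ^+ 4 = (u * x) ^+ 2 * (v * x) ^+ 2); last by ring.
  by rewrite ler_pM// cosB1_le.
have E : - re_exponent b nu u - re_exponent b nu v +
    (re_exponent b nu (u + v) + re_exponent b nu (u - v)) / 2 =
    \int[nu]_(x in D) ((1 - cos (u * x)) * (1 - cos (v * x))).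
  transitivity (\int[nu]_(x in D) ((-1) * (cos (u * x) - 1) + (-1) * (cos (v * x) - 1) +
     2^-1 * ((cos ((u + v) * x) - 1) + (cos ((u - v) * x) - 1)))); last first.
    apply: eq_Rintegral => x _; rewrite mulrDl mulrBl cosD cosB; by field.
  have j1 := integrableZl mD (-1) (icos u); have j2 := integrableZl mD (-1) (icos v).
  have j12 := integrableD mD j1 j2.
  have j34 := integrableD mD (icos (u + v)) (icos (u - v)).
  rewrite (RintegralD mD j12 (integrableZl mD 2^-1 j34)) (RintegralD mD j1 j2).
  rewrite (RintegralZl _ mD j34) (RintegralD mD (icos (u + v)) (icos (u - v))).
  rewrite !Zcos.
  by rewrite !reE /K; field.
rewrite E -RintegralZl// -(Rint_D (f := fun x => u ^+ 2 * v ^+ 2 * x ^+ 4)); last first.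
  by rewrite expr0n/= mulr0.
apply: le_Rintegral => //; first exact: (integrableZl mD (u ^+ 2 * v ^+ 2) (int_D i4)).
move=> x _; rewrite (_ : _ * x ^+ 4 = (u * x) ^+ 2 * (v * x) ^+ 2); last by ring.
have h (y : R) : 1 - cos y <= y ^+ 2 by rewrite (le_trans _ (cosB1_le _))// distrC ler_norm.
by apply: ler_pM; rewrite ?h// subr_ge0; exact: cos_le1.
Qed.

End LevyMoments.

(** * Limits of trigonometric quotients at the origin *)

Section Fatou.
Context {R : realType} d {T : measurableType d}.

Lemma fatou_bound (mu : {measure set T -> \bar R}) (f : nat -> T -> R) (h : T -> R) (c : nat -> R) (l : R) :
  (forall n, measurable_fun setT (f n)) -> (forall n w, 0 <= f n w) ->
  (forall w, f n w @[n --> \oo] --> h w) ->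
  (forall n, (\int[mu]_w (f n w)%:E <= (c n)%:E)%E) -> c n @[n --> \oo] --> l ->
  (\int[mu]_w (h w)%:E <= l%:E)%E.
Proof.
move=> mf f0 fh fc cl.
have := @fatou _ _ _ mu setT measurableT (fun n w => (f n w)%:E)
  (fun n => (@measurable_EFinP _ _ _ _ _).2 (mf n)) (fun n w _ => f0 n w).
have -> : (\int[mu]_w limn_einf (fun n => (f n w)%:E) = \int[mu]_w (h w)%:E)%E.
  apply: eq_integral => w _; apply: (cvg_limn_einf_sup _).1.
  by apply: cvg_EFin; [exact: nearW|exact: fh].
move=> H; apply: (le_trans H).
have cl' : (c n)%:E @[n --> \oo] --> l%:E by apply: cvg_EFin; [exact: nearW|exact: cl].
rewrite -(cvg_limn_einf_sup cl').1; rewrite !limn_einf_lim; apply: lee_lim.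
- exact: is_cvg_einfs.
- exact: is_cvg_einfs.
apply: nearW => n; apply: le_ereal_inf_tmp => _ [k nk <-].
by rewrite (le_trans _ (fc k))//; apply: ereal_inf_lbound; exists k.
Qed.

Lemma one_minus_cos_cvg (u : R) (z : nat -> R) : (forall n, 0 < z n) -> z n @[n --> \oo] --> 0 ->
  (1 - cos (z n * u)) / z n ^+ 2 @[n --> \oo] --> u ^+ 2 / 2.
Proof.
move=> z0 zc; apply/cvgrPdist_le => /= e e0.
have H : z n * (2 * `|u| ^+ 3) @[n --> \oo] --> (0 : R).
  by rewrite -(mul0r (2 * `|u| ^+ 3)); apply: cvgMl.
have /cvgrPdist_le/(_ _ e0) H' := H.
near=> n; have Hn : `|0 - z n * (2 * `|u| ^+ 3)| <= e by near: n; exact: H'.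
rewrite (le_trans _ Hn)// sub0r normrN (le_trans _ (ler_norm _))//.
rewrite (_ : _ - _ = (cos (z n * u) - 1 + (z n * u) ^+ 2 / 2) / z n ^+ 2); last first.
  by field; rewrite gt_eqF.
rewrite normrM normfV (ger0_norm (sqr_ge0 _)) ler_pdivrMr ?exprn_gt0//.
rewrite (le_trans (cosB_le3 _))// normrM (gtr0_norm (z0 n)) le_eqVlt; apply/orP; left; apply/eqP; ring.
Unshelve. all: by end_near. Qed.

Lemma harmonic_gt0 n : 0 < @harmonic R n. Proof. by rewrite invr_gt0. Qed.

Lemma harmonic_le1 n : @harmonic R n <= 1. Proof. by rewrite invf_le1// ler1n. Qed.

End Fatou.

Section Moments.
Context {R : realType} d {T : measurableType d} (P : probability T R).

(** No moment of [U] is assumed finite: Fatou's lemma for [2 (1 - cos (z U)) / z ^ 2] along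
    [z = 1 / (n+1)] derives it from the characteristic function near 0. The term in [K'] disappears
    in the limit. *)
Lemma second_moment_bound (U : T -> R) (K K' : R) : measurable_fun setT U ->
  (forall z, 0 < z <= 1 -> 1 - \int[P]_w cos (z * U w) <= K * z ^+ 2 + K' * z ^+ 3) ->
  (\int[P]_w (U w ^+ 2)%:E <= (2 * K)%:E)%E.
Proof.
move=> mU HK.
have mzU (z : R) : measurable_fun setT (fun w => z * U w) by exact: measurable_funM.
pose z := @harmonic R.
have z0 n : 0 < z n by exact: harmonic_gt0.
have bc n : bounded_rv (fun w => 2 * ((1 - cos (z n * U w)) / z n ^+ 2)).
  apply: bounded_rvM; first exact: bounded_rv_cst.
  apply: (@bounded_rvM _ _ _ (fun w => 1 - cos (z n * U w)) (cst _)); last exact: bounded_rv_cst.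
  by apply: (@bounded_rvB _ _ _ (cst 1)); [exact: bounded_rv_cst|exact: bounded_rv_cos].
apply: (@fatou_bound _ _ _ P (fun n w => 2 * ((1 - cos (z n * U w)) / z n ^+ 2)) _
    (fun n => 2 * K + 2 * K' * z n)).
- by move=> n; case: (bc n).
- by move=> n w; rewrite mulr_ge0// divr_ge0 ?sqr_ge0// subr_ge0 cos_le1.
- move=> w; rewrite (_ : U w ^+ 2 = 2 * (U w ^+ 2 / 2)); last by field.
  by apply: cvgMr; apply: one_minus_cos_cvg => //; exact: cvg_harmonic.
- move=> n; rewrite -[leLHS]fineK; last first.
    by apply: (integrable_fin_num measurableT); exact: bounded_rv_integrable (bc n).
  rewrite lee_fin; have := HK (z n); rewrite z0 harmonic_le1 => /(_ isT) H.
  have -> : fine (\int[P]_w (2 * ((1 - cos (z n * U w)) / z n ^+ 2))%:E)%E =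
      2 / z n ^+ 2 * (1 - \int[P]_w cos (z n * U w)).
    have b1 : P.-integrable setT (EFin \o cst (1 : R)) by exact/bounded_rv_integrable/bounded_rv_cst.
    have b2 : P.-integrable setT (EFin \o (fun w => cos (z n * U w))).
      exact/bounded_rv_integrable/bounded_rv_cos.
    rewrite -[X in X - _](Rintegral_prob_cst P) -(RintegralB measurableT b1 b2).
    rewrite -RintegralZl//; last exact: (integrableB measurableT b1 b2).
    by apply: eq_Rintegral => w _; rewrite /cst; ring.
  rewrite (le_trans (ler_wpM2l _ H))//; first by rewrite divr_ge0 ?sqr_ge0.
  by rewrite le_eqVlt; apply/orP; left; apply/eqP; field; rewrite gt_eqF.
- rewrite -[X in _ --> X]addr0 -[in X in _ --> X](mulr0 (2 * K')).
  by apply: cvgD; [exact: cvg_cst|apply: cvgMr; exact: cvg_harmonic].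
Qed.

(** The left-hand side of the hypothesis is the expectation of [(1 - cos (z U)) (1 - cos (z V))],
    expanded by the addition formulas; the factor 4 comes from the two limits [U ^ 2 / 2] and
    [V ^ 2 / 2]. *)
Lemma mixed_moment_bound (U V : T -> R) (K K' : R) : measurable_fun setT U -> measurable_fun setT V ->
  (forall z, 0 < z <= 1 ->
    1 - \int[P]_w cos (z * U w) - \int[P]_w cos (z * V w) +
    (\int[P]_w cos (z * (U w + V w)) + \int[P]_w cos (z * (U w - V w))) / 2
      <= K * z ^+ 4 + K' * z ^+ 5) ->
  (\int[P]_w (U w ^+ 2 * V w ^+ 2)%:E <= (4 * K)%:E)%E.
Proof.
move=> mU mV HK.
pose z := @harmonic R.
have z0 n : 0 < z n by exact: harmonic_gt0.
have b1 : bounded_rv (cst 1 : T -> R) by exact: bounded_rv_cst.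
have bcos (f : T -> R) n : measurable_fun setT f -> bounded_rv (fun w => cos (z n * f w)).
  by move=> mf; apply: bounded_rv_cos; exact: measurable_funM.
have mUV := measurable_funD mU mV; have mUV' := measurable_funB mU mV.
have bc n : bounded_rv (fun w => 4 * (((1 - cos (z n * U w)) / z n ^+ 2) *
    ((1 - cos (z n * V w)) / z n ^+ 2))).
  apply: bounded_rvM; first exact: bounded_rv_cst.
  by apply: bounded_rvM; apply: (@bounded_rvM _ _ _ _ (cst _)); try exact: bounded_rv_cst;
     apply: bounded_rvB => //; exact: bcos.
apply: (@fatou_bound _ _ _ P (fun n w => 4 * (((1 - cos (z n * U w)) / z n ^+ 2) *
    ((1 - cos (z n * V w)) / z n ^+ 2))) _ (fun n => 4 * K + 4 * K' * z n)).
- by move=> n; case: (bc n).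
- by move=> n w; rewrite mulr_ge0// mulr_ge0// divr_ge0 ?sqr_ge0// subr_ge0 cos_le1.
- move=> w; rewrite (_ : U w ^+ 2 * _ = 4 * ((U w ^+ 2 / 2) * (V w ^+ 2 / 2))); last by field.
  by apply: cvgMr; apply: cvgM; apply: one_minus_cos_cvg => //; exact: cvg_harmonic.
- move=> n; rewrite -[leLHS]fineK; last first.
    by apply: (integrable_fin_num measurableT); exact: bounded_rv_integrable (bc n).
  rewrite lee_fin; have := HK (z n); rewrite z0 harmonic_le1 => /(_ isT) H.
  have i1 := bounded_rv_integrable P b1.
  have iU := bounded_rv_integrable P (bcos U n mU).
  have iV := bounded_rv_integrable P (bcos V n mV).
  have iUV := bounded_rv_integrable P (bcos _ n mUV).
  have iUV' := bounded_rv_integrable P (bcos _ n mUV').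
  have -> : fine (\int[P]_w (4 * (((1 - cos (z n * U w)) / z n ^+ 2) *
        ((1 - cos (z n * V w)) / z n ^+ 2)))%:E)%E =
      4 / z n ^+ 4 * (1 - \int[P]_w cos (z n * U w) - \int[P]_w cos (z n * V w) +
    (\int[P]_w cos (z n * (U w + V w)) + \int[P]_w cos (z n * (U w - V w))) / 2).
    have iA := integrableB measurableT (integrableB measurableT i1 iU) iV.
    have iB := integrableD measurableT iUV iUV'.
    have iB2 := integrableZl measurableT 2^-1 iB.
    transitivity (\int[P]_w (4 / z n ^+ 4 * ((cst 1 w - cos (z n * U w) - cos (z n * V w)) +
        2^-1 * (cos (z n * (U w + V w)) + cos (z n * (U w - V w)))))).
      apply: eq_Rintegral => w _; rewrite (mulrDr (z n)) (mulrBr (z n)) cosD cosB /cst; field.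
      by rewrite gt_eqF.
    rewrite (RintegralZl _ measurableT (integrableD measurableT iA iB2)).
    rewrite (RintegralD measurableT iA iB2) (RintegralZl _ measurableT iB).
    rewrite (RintegralD measurableT iUV iUV').
    rewrite (RintegralB measurableT (integrableB measurableT i1 iU) iV).
    by rewrite (RintegralB measurableT i1 iU) Rintegral_prob_cst; field; rewrite gt_eqF.
  rewrite (le_trans (ler_wpM2l _ H))//; first by rewrite divr_ge0 ?exprn_ge0// ltW.
  by rewrite le_eqVlt; apply/orP; left; apply/eqP; field; rewrite gt_eqF.
- rewrite -[X in _ --> X]addr0 -[in X in _ --> X](mulr0 (4 * K')).
  by apply: cvgD; [exact: cvg_cst|apply: cvgMr; exact: cvg_harmonic].
Qed.

Lemma square_integrable (U : T -> R) : measurable_fun setT U -> (\int[P]_w (U w ^+ 2)%:E < +oo)%E ->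
  P.-integrable setT (EFin \o U).
Proof.
move=> mU U2; have i1 := bounded_rv_integrable P (@bounded_rv_cst _ _ T (1 : R)).
have isq : P.-integrable setT (EFin \o (fun w => U w ^+ 2)).
  apply/integrableP; split; first by apply/measurable_EFinP; exact: measurable_funX.
  by under eq_integral do rewrite /= ger0_norm ?sqr_ge0//.
apply: (le_integrable measurableT _ _ (integrableD measurableT i1 isq)) => [|w _].
  exact/measurable_EFinP.
rewrite /= lee_fin /cst [leRHS]ger0_norm ?addr_ge0 ?sqr_ge0//.
rewrite -(real_normK (num_real (U w))); move: (`|U w|) => x; have := sqr_ge0 (x - 1).
rewrite sqrrB1; have := sqr_ge0 x; rewrite !expr2; lra.
Qed.

(** The mean is the derivative at [z = 0] of the expectation of [sin (z U)], which the hypothesis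
    makes vanish; the quotients are dominated by [|U|]. *)
Lemma mean_zero (U : T -> R) (K : R) : measurable_fun setT U ->
  P.-integrable setT (EFin \o U) ->
  (forall z, 0 < z <= 1 -> `|\int[P]_w sin (z * U w)| <= K * z ^+ 2) ->
  \int[P]_w U w = 0.
Proof.
move=> mU iU HK.
pose z := @harmonic R.
have z0 n : 0 < z n by exact: harmonic_gt0.
have H1 : \int[P]_w (sin (z n * U w) / z n) @[n --> \oo] --> \int[P]_w U w.
  have mf n : measurable_fun setT (fun w => (sin (z n * U w) / z n)%:E).
    apply/measurable_EFinP; apply: measurable_funM => //.
    by case: (@bounded_rv_sin _ _ _ (fun w => z n * U w)) => //; exact: measurable_funM.
  have Hlim w : (sin (z n * U w) / z n)%:E @[n --> \oo] --> (U w)%:E.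
    apply: cvg_EFin; first exact: nearW.
    apply/cvgrPdist_le => /= e e0.
    have H : z n * (2 * U w ^+ 2) @[n --> \oo] --> (0 : R).
      by rewrite -(mul0r (2 * U w ^+ 2)); apply: cvgMl; exact: cvg_harmonic.
    have /cvgrPdist_le/(_ _ e0) H' := H.
    near=> n; have Hn : `|0 - z n * (2 * U w ^+ 2)| <= e by near: n; exact: H'.
    rewrite (le_trans _ Hn)// sub0r normrN (le_trans _ (ler_norm _))//.
    rewrite distrC (_ : _ - _ = (sin (z n * U w) - z n * U w) / z n); last first.
      by field; rewrite gt_eqF.
    rewrite normrM normfV (gtr0_norm (z0 _)) ler_pdivrMr//.
    rewrite (le_trans (sinB_le2 _))// le_eqVlt; apply/orP; left; apply/eqP; ring.
  have dom : {ae P, forall w n, setT w -> (`|(sin (z n * U w) / z n)%:E| <= `|(U w)%:E|)%E}.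
    apply: aeW => w n _; rewrite /= lee_fin normrM normfV (gtr0_norm (z0 n)) ler_pdivrMr//.
    by rewrite (le_trans (sin_le_norm _))// normrM (gtr0_norm (z0 n)) mulrC.
  have mU' : measurable_fun setT (EFin \o U) by exact/measurable_EFinP.
  have [_ _ H] := dominated_convergence measurableT mf mU' (aeW _ (fun w _ => Hlim w))
    (integrable_norm iU) dom.
  apply: fine_cvg; rewrite fineK; first exact: H.
  exact: (integrable_fin_num measurableT).
have H2 : \int[P]_w (sin (z n * U w) / z n) @[n --> \oo] --> (0 : R).
  apply/cvgrPdist_le => /= e e0.
  have H : z n * K @[n --> \oo] --> (0 : R).
    by rewrite -(mul0r K); apply: cvgMl; exact: cvg_harmonic.
  have /cvgrPdist_le/(_ _ e0) H' := H.
  near=> n; have Hn : `|0 - z n * K| <= e by near: n; exact: H'.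
  rewrite (le_trans _ Hn)// !sub0r !normrN (le_trans _ (ler_norm _))//.
  under eq_Rintegral do rewrite mulrC.
  rewrite RintegralZl//; last first.
    by apply/bounded_rv_integrable/bounded_rv_sin; exact: measurable_funM.
  rewrite normrM normfV (gtr0_norm (z0 n)) ler_pdivrMl// (le_trans (HK _ _))//.
    by rewrite z0 harmonic_le1.
  by rewrite le_eqVlt; apply/orP; left; apply/eqP; rewrite expr2; ring.
exact: (cvg_unique _ H1 H2).
Unshelve. all: by end_near. Qed.

End Moments.

(** * Moments of a finite family with prescribed joint exponent *)

Section LevyFamily.
Context {R : realType} d {Om : measurableType d} (P : probability Om R) (k : nat).
Context (nu : {measure set (measurableTypeR R) -> \bar R}) (gamma b : R).
Context (Z : 'I_k -> Om -> R) (q : {set 'I_k} -> R).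

(** The geometry enters only through the weights [q] of the atoms. The mean has been removed from
    the phase. *)
Definition centered_polar := forall th : 'I_k -> R,
  char_polar P (fun w => \sum_(j < k) th j * Z j w)
    (expR (\sum_S q S * re_exponent b nu (\sum_(j in S) th j)))
    (\sum_S q S * (im_exponent gamma nu (\sum_(j in S) th j) -
                   levy_mean nu gamma * \sum_(j in S) th j)).

Hypothesis mZ : forall j, measurable_fun setT (Z j).
Hypothesis q0 : forall S, 0 <= q S.
Hypothesis i2 : nu.-integrable setT (EFin \o (fun x : R => x ^+ 2)).
Hypothesis i3 : nu.-integrable setT (EFin \o (fun x : R => `|x| ^+ 3)).
Hypothesis i4 : nu.-integrable setT (EFin \o (fun x : R => x ^+ 4)).
Hypothesis polarZ : centered_polar.

Let v2 := b ^+ 2 / 2 + \int[nu]_x (x ^+ 2).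
Let M3 := \int[nu]_x (`|x| ^+ 3).
Let M4 := \int[nu]_x (x ^+ 4).
Let su (th : 'I_k -> R) (S : {set 'I_k}) := \sum_(j in S) th j.
Let re_sum th := - \sum_S q S * re_exponent b nu (su th S).
Let q2 th := \sum_S q S * su th S ^+ 2.
Let q3 th := \sum_S q S * `|su th S| ^+ 3.

Let suZ z th S : su (fun j => z * th j) S = z * su th S.
Proof. by rewrite /su mulr_sumr. Qed.

Let q2_ge0 th : 0 <= q2 th.
Proof. by apply: sumr_ge0 => S _; rewrite mulr_ge0 ?sqr_ge0. Qed.

Let q3_ge0 th : 0 <= q3 th.
Proof. by apply: sumr_ge0 => S _; rewrite mulr_ge0 ?exprn_ge0. Qed.

Let M3_ge0 : 0 <= M3. Proof. by apply: Rintegral_ge0 => x _; exact: exprn_ge0. Qed.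

Let re_sum_ge0 th : 0 <= re_sum th.
Proof.
by rewrite oppr_ge0; apply: sumr_le0 => S _; apply: mulr_ge0_le0 => //; exact: re_exponent_le0.
Qed.

Let re_sum_le z th : re_sum (fun j => z * th j) <= z ^+ 2 * (v2 * q2 th).
Proof.
rewrite /re_sum lerNl /q2 !mulr_sumr -sumrN; apply: ler_sum => S _.
rewrite (_ : - _ = q S * - ((z * su th S) ^+ 2 * v2)); last by ring.
by rewrite suZ ler_wpM2l//; exact: re_exponent_ge.
Qed.

Let phase_le z th : 0 <= z -> `|\sum_S q S * (im_exponent gamma nu (su (fun j => z * th j) S) -
   levy_mean nu gamma * su (fun j => z * th j) S)| <= z ^+ 3 * (M3 * q3 th).
Proof.
move=> z0; rewrite (le_trans (ler_norm_sum _ _ _))// /q3 !mulr_sumr; apply: ler_sum => S _.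
rewrite normrM ger0_norm// suZ (_ : z ^+ 3 * _ = q S * ((z * `|su th S|) ^+ 3 * M3)); last by ring.
have -> : z * `|su th S| = `|z * su th S| by rewrite normrM (ger0_norm z0).
by rewrite ler_wpM2l//; exact: im_exponent_le3.
Qed.

Let sum_scale z th w : \sum_(j < k) (z * th j) * Z j w = z * \sum_(j < k) th j * Z j w.
Proof. by rewrite mulr_sumr; apply: eq_bigr => j _; rewrite mulrA. Qed.

Let cosE z th : \int[P]_w cos (z * \sum_(j < k) th j * Z j w) =
  \int[P]_w cos (\sum_(j < k) (z * th j) * Z j w).
Proof. by apply: eq_Rintegral => w _; rewrite sum_scale. Qed.

(** The centred phase is of order [z ^ 3], so its cosine costs at most order [z ^ 6], which is below
    the order [z ^ 4] seen by mixed moments. *)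
Let cos_ge z th : 0 <= z <= 1 ->
  1 - \int[P]_w cos (z * \sum_(j < k) th j * Z j w) <=
    re_sum (fun j => z * th j) + z ^+ 5 * (M3 * q3 th) ^+ 2.
Proof.
move=> /andP[z0 z1]; rewrite cosE (polarZ (fun j => z * th j)).1.
set be := \sum_S q S * (_ - _); have hbe : `|be| <= _ := phase_le th z0.
have al0 := re_sum_ge0 (fun j => z * th j).
rewrite -[X in expR X]opprK -/(re_sum (fun j => z * th j)).
set al := re_sum _ in al0 *.
have e1 : 1 - al <= expR (- al) by exact: expR_ge1Dx.
have e2 : expR (- al) <= 1 by rewrite expR_le1 oppr_le0.
have c1 : 1 - cos be <= be ^+ 2 by rewrite (le_trans _ (cosB1_le be))// distrC ler_norm.
have b2 : be ^+ 2 <= z ^+ 5 * (M3 * q3 th) ^+ 2.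
  rewrite -(real_normK (num_real be)) (@le_trans _ _ ((z ^+ 3 * (M3 * q3 th)) ^+ 2))//.
    by rewrite ler_pXn2r ?nnegrE ?mulr_ge0 ?exprn_ge0.
  rewrite exprMn -exprM ler_wpM2r ?sqr_ge0// -[(3 * 2)%N]/(6%N) exprS; apply: ler_piMl => //.
  exact: exprn_ge0.
have e0 := expR_gt0 (- al).
have : expR (- al) * (1 - cos be) <= be ^+ 2.
  by rewrite (le_trans _ c1)// ler_piMl// subr_ge0 cos_le1.
rewrite mulrBr mulr1; lra.
Qed.

(** The phase is dropped by [cos <= 1] and the exponential expanded by [expRN_le]. The square of
    order [z ^ 4] is the source of the quadratic term in [family_mixed_moment]. *)
Let cos_le z th : \int[P]_w cos (z * \sum_(j < k) th j * Z j w) <=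
  1 - re_sum (fun j => z * th j) + (z ^+ 2 * (v2 * q2 th)) ^+ 2.
Proof.
rewrite cosE (polarZ (fun j => z * th j)).1.
have al0 := re_sum_ge0 (fun j => z * th j).
rewrite -[X in expR X]opprK -/(re_sum (fun j => z * th j)).
rewrite (le_trans (ler_wpM2l (expR_ge0 _) (cos_le1 _)))// mulr1 (le_trans (expRN_le al0))//.
by rewrite lerD2l ler_pXn2r ?nnegrE ?re_sum_le// (le_trans al0)// re_sum_le.
Qed.

Let msum th : measurable_fun setT (fun w => \sum_(j < k) th j * Z j w).
Proof. by apply: measurable_sum => j; exact: measurable_funM. Qed.

Lemma family_second_moment th :
  (\int[P]_w ((\sum_(j < k) th j * Z j w) ^+ 2)%:E <=
     (2 * (v2 * \sum_S q S * (\sum_(j in S) th j) ^+ 2))%:E)%E.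
Proof.
apply: (@second_moment_bound _ _ _ _ _ _ ((M3 * q3 th) ^+ 2)) => // z /andP[z0 z1].
rewrite (le_trans (cos_ge _ _)) ?(ltW z0)// lerD//; first by rewrite mulrC; exact: re_sum_le.
rewrite mulrC ler_wpM2l ?sqr_ge0// -(subnKC (isT : (3 <= 5)%N)) exprD.
by rewrite ler_piMr ?exprn_ge0 ?exprn_ile1// ltW.
Qed.

Lemma family_mean th : \int[P]_w (\sum_(j < k) th j * Z j w) = 0.
Proof.
apply: (@mean_zero _ _ _ _ _ (M3 * q3 th)) => //.
  by apply: square_integrable => //; rewrite (le_lt_trans (family_second_moment th))// ltry.
move=> z /andP[z0 z1].
have -> : \int[P]_w sin (z * (\sum_(j < k) th j * Z j w)) =
    \int[P]_w sin (\sum_(j < k) (z * th j) * Z j w).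
  by apply: eq_Rintegral => w _; rewrite sum_scale.
rewrite (polarZ (fun j => z * th j)).2.
have -> : \sum_S q S * re_exponent b nu (\sum_(j in S) z * th j) = - re_sum (fun j => z * th j).
  by rewrite opprK.
rewrite normrM ger0_norm ?expR_ge0//.
rewrite (@le_trans _ _ (1 * `|sin (\sum_S q S * (im_exponent gamma nu (su (fun j => z * th j) S) -
   levy_mean nu gamma * su (fun j => z * th j) S))|))//.
  by rewrite ler_wpM2r// expR_le1 oppr_le0.
rewrite mul1r (le_trans (sin_le_norm _))// (le_trans (phase_le _ (ltW z0)))// mulrC.
rewrite ler_wpM2l ?mulr_ge0// exprS ler_piMl ?exprn_ge0//; exact: ltW.
Qed.

(** The parts linear in the exponent combine atom by atom into [re_exponent_mixed], which gives the
    term in [M4]: jumps contributing to both sums. The squares left by [cos_le] at [th + th'] and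
    [th - th'] give the other term, of the size of a product of variances. *)
Lemma family_mixed_moment th th' :
  (\int[P]_w ((\sum_(j < k) th j * Z j w) ^+ 2 * (\sum_(j < k) th' j * Z j w) ^+ 2)%:E <=
     (4 * (M4 * (\sum_S q S * ((\sum_(j in S) th j) ^+ 2 * (\sum_(j in S) th' j) ^+ 2)) +
           4 * (v2 * \sum_S q S * ((\sum_(j in S) th j) ^+ 2 + (\sum_(j in S) th' j) ^+ 2)) ^+ 2))%:E)%E.
Proof.
pose q4 := \sum_S q S * (su th S ^+ 2 * su th' S ^+ 2).
pose Q := \sum_S q S * (su th S ^+ 2 + su th' S ^+ 2).
have v20 : 0 <= v2 by rewrite addr_ge0 ?divr_ge0 ?sqr_ge0//; apply: Rintegral_ge0 => x _; exact: sqr_ge0.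
have suD S : su (fun j => th j + th' j) S = su th S + su th' S by rewrite /su big_split.
have suB S : su (fun j => th j - th' j) S = su th S - su th' S.
  by rewrite /su big_split/= sumrN.
have hD : q2 (fun j => th j + th' j) <= 2 * Q.
  rewrite /q2 /Q mulr_sumr; apply: ler_sum => S _.
  rewrite [leRHS]mulrCA ler_wpM2l// suD; have := sqr_ge0 (su th S - su th' S); nra.
have hB : q2 (fun j => th j - th' j) <= 2 * Q.
  rewrite /q2 /Q mulr_sumr; apply: ler_sum => S _.
  rewrite [leRHS]mulrCA ler_wpM2l// suB; have := sqr_ge0 (su th S + su th' S); nra.
apply: (@mixed_moment_bound _ _ _ _ _ _ _ ((M3 * q3 th) ^+ 2 + (M3 * q3 th') ^+ 2)) => // z z01.
have /andP[z0 z1] := z01; have z01' : 0 <= z <= 1 by rewrite (ltW z0).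
have eD : \int[P]_w cos (z * (\sum_(j < k) th j * Z j w + \sum_(j < k) th' j * Z j w)) =
    \int[P]_w cos (z * \sum_(j < k) (th j + th' j) * Z j w).
  apply: eq_Rintegral => w _; congr (cos (z * _)); rewrite -big_split; apply: eq_bigr => j _.
  by rewrite mulrDl.
have eB : \int[P]_w cos (z * (\sum_(j < k) th j * Z j w - \sum_(j < k) th' j * Z j w)) =
    \int[P]_w cos (z * \sum_(j < k) (th j - th' j) * Z j w).
  apply: eq_Rintegral => w _; congr (cos (z * _)); rewrite -sumrB; apply: eq_bigr => j _.
  by rewrite mulrBl.
rewrite eD eB.
have sq th0 : q2 th0 <= 2 * Q -> (z ^+ 2 * (v2 * q2 th0)) ^+ 2 <= 4 * (v2 * Q) ^+ 2 * z ^+ 4.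
  move=> h; rewrite (_ : 4 * _ * _ = (z ^+ 2 * (v2 * (2 * Q))) ^+ 2); last by ring.
  have Q0 : 0 <= 2 * Q by exact: le_trans h.
  rewrite ler_pXn2r ?nnegrE ?(mulr_ge0 (sqr_ge0 _)) ?(mulr_ge0 v20)//.
  by rewrite ler_wpM2l ?sqr_ge0// ler_wpM2l.
have lin : re_sum (fun j => z * th j) + re_sum (fun j => z * th' j) -
   (re_sum (fun j => z * (th j + th' j)) + re_sum (fun j => z * (th j - th' j))) / 2 <=
   M4 * q4 * z ^+ 4.
  pose r th0 S := q S * re_exponent b nu (z * su th0 S).
  have rE th0 : re_sum (fun j => z * th0 j) = - \sum_S r th0 S.
    by congr (- _); apply: eq_bigr => S _; rewrite suZ.
  rewrite !rE (@le_trans _ _ (\sum_S ((-1) * r th S + (-1) * r th' S +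
     2^-1 * r (fun j => th j + th' j) S + 2^-1 * r (fun j => th j - th' j) S)))//.
    by rewrite !big_split/= -!mulr_sumr; lra.
  rewrite /q4 mulr_sumr mulr_suml; apply: ler_sum => S _; rewrite /r suD suB.
  have h := re_exponent_mixed b i2 i4 (z * su th S) (z * su th' S).
  rewrite (_ : _ * z ^+ 4 = q S * ((z * su th S) ^+ 2 * (z * su th' S) ^+ 2 * M4)); last by ring.
  rewrite (le_trans _ (ler_wpM2l (q0 S) h))// le_eqVlt; apply/orP; left; apply/eqP.
  by rewrite (mulrDr z) (mulrBr z); field.
have h1 := cos_ge th z01'; have h2 := cos_ge th' z01'.
have h3 := cos_le z (fun j => th j + th' j); have h4 := cos_le z (fun j => th j - th' j).
have h5 := sq _ hD; have h6 := sq _ hB.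
rewrite -/q4 -/Q.
rewrite [_ * z ^+ 4]mulrDl [_ * z ^+ 5]mulrDl; lra.
Qed.

End LevyFamily.

(** * Modulus of continuity under a three-point moment bound *)

Section Chaining.
Context {R : realType}.

Definition dyadic (a h : R) m j : R := a + j%:R * h / 2 ^+ m.

Lemma dyadic_double a h m j : dyadic a h m.+1 j.*2 = dyadic a h m j.
Proof. by rewrite /dyadic -muln2 natrM exprS; congr (_ + _); field; rewrite expf_neq0. Qed.

Lemma dyadicS a h m j : dyadic a h m j.+1 = dyadic a h m j + h / 2 ^+ m.
Proof. by rewrite /dyadic -(natr1 j); ring. Qed.

Lemma dyadic_mid a h m j : dyadic a h m.+1 j.*2.+1 = dyadic a h m j + h / 2 ^+ m / 2.
Proof. by rewrite dyadicS dyadic_double exprS invfM; congr (_ + _); ring. Qed.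

(** Only the smaller of the two increments at a midpoint is constrained, since a path may jump on
    one side of it. The weights [(1 - q) * q ^ m] sum to 1 over the levels when [0 <= q < 1]. *)
Definition small_midpoint (x : R -> R) (a h lam q : R) m j :=
  Num.min `|x (dyadic a h m.+1 j.*2.+1) - x (dyadic a h m j)|
          `|x (dyadic a h m j.+1) - x (dyadic a h m.+1 j.*2.+1)| <= lam * ((1 - q) * q ^+ m).

(** A new dyadic point is close to one of its two neighbours of the previous level and inherits from
    it the endpoint near which that neighbour's value lies, at the cost of one more weight. *)
Lemma dyadic_min (x : R -> R) a h lam q : 0 <= lam -> 0 <= q ->
  (forall m j, (j < 2 ^ m)%N -> small_midpoint x a h lam q m j) ->
  forall m j, (j <= 2 ^ m)%N ->
    Num.min `|x (dyadic a h m j) - x a| `|x (a + h) - x (dyadic a h m j)| <= lam * (1 - q ^+ m).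
Proof.
move=> l0 q0 H; elim=> [|m IH] j.
  rewrite expn0 expr0 subrr mulr0 /dyadic expr0 divr1; case: j => [|[|//]] _.
    by rewrite mul0r addr0 subrr normr0 ge_min lexx.
  by rewrite mul1r subrr normr0 ge_min lexx orbT.
have step s s' c M : Num.min `|x s - x a| `|x (a + h) - x s| <= M -> `|x s' - x s| <= c ->
    Num.min `|x s' - x a| `|x (a + h) - x s'| <= M + c.
  move=> H1 H2; move: H1; rewrite !ge_min => /orP[] H1; apply/orP; [left|right].
    by rewrite (le_trans (ler_distD (x s) _ _))// addrC lerD.
  by rewrite (le_trans (ler_distD (x s) _ _))// lerD// distrC.
rewrite expnS mul2n => hj.
have E : lam * (1 - q ^+ m.+1) = lam * (1 - q ^+ m) + lam * ((1 - q) * q ^+ m) by rewrite exprS; ring.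
rewrite -(odd_double_half j) in hj *.
case: (odd j) hj => /= hj; last first.
  rewrite add0n dyadic_double (le_trans (IH _ _))//; first by rewrite -leq_double; lia.
  rewrite E lerDl.
  (* That the weight is nonnegative is read off from the hypothesis itself, as it bounds a minimum
     of absolute values. *)
  have := H m 0%N; rewrite expn_gt0 => /(_ isT); apply: le_trans.
  by rewrite le_min !normr_ge0.
have hj2 : (j./2 < 2 ^ m)%N by lia.
rewrite add1n E; have := H m _ hj2; rewrite /small_midpoint ge_min => /orP[] H1.
  by apply: step H1; apply: IH; lia.
by apply: (step (dyadic a h m j./2.+1)); [apply: IH; lia|rewrite distrC].
Qed.

(** Once the two end values are within [lam], being close to either of them means being within
    [2 * lam] of the left one; right-continuity extends this from dyadic points to [t]. *)
Lemma block_oscillation (x : R -> R) a h lam q : 0 < h -> 0 <= lam -> 0 <= q ->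
  (forall m j, (j < 2 ^ m)%N -> small_midpoint x a h lam q m j) ->
  `|x (a + h) - x a| <= lam ->
  forall t, a <= t < a + h -> x s @[s --> t^'+] --> x t -> `|x t - x a| <= 2 * lam.
Proof.
move=> h0 l0 q0 H Hab t /andP[at_ tb] cx.
have Hd m j : (j <= 2 ^ m)%N -> `|x (dyadic a h m j) - x a| <= 2 * lam.
  move=> hj; have := dyadic_min l0 q0 H hj.
  have h1 : lam * (1 - q ^+ m) <= lam by rewrite ler_piMr// gerBl exprn_ge0.
  rewrite ge_min => /orP[] h2; first by rewrite (le_trans h2)// (le_trans h1)//; lra.
  rewrite (le_trans (ler_distD (x (a + h)) _ _))// [`|x (dyadic _ _ _ _) - _|]distrC.
  have := le_trans h2 h1; lra.
apply/ler_addgt0Pr => e e0.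
move/cvgrPdist_le : cx => /(_ e e0)[/= del del0 Hdel].
have [m hm] : exists m, h / 2 ^+ m < del.
  have /cvgrPdist_lt/(_ del del0) : h * 2^-1 ^+ n @[n --> \oo] --> (0 : R).
    rewrite -[X in _ --> X](mulr0 h); apply: cvgMr; apply: cvg_expr.
    by rewrite ger0_norm// invf_lt1// ltr1n.
  move=> [m _ /(_ m (leqnn m))]; rewrite sub0r normrN => /(le_lt_trans (ler_norm _)) hm.
  by exists m; rewrite -exprVn.
(* The dyadic point just to the right of [t], of index [j + 1], is used because only the right limit
   at [t] is known to be [x t]. *)
pose u := (t - a) * 2 ^+ m / h; pose j := Num.truncn u.
have p0 : 0 < 2 ^+ m :> R by rewrite exprn_gt0.
have u0 : 0 <= u by rewrite !mulr_ge0 ?invr_ge0 ?subr_ge0// ltW.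
have /andP[ju uj] := truncn_itv u0.
have um : u < 2 ^+ m by rewrite /u ltr_pdivrMr// mulrC ltr_pM2l//; lra.
have jm : (j < 2 ^ m)%N by rewrite -(ltr_nat R) natrX (le_lt_trans ju).
have ts : t < dyadic a h m j.+1.
  rewrite /dyadic -ltrBlDl ltr_pdivlMr//.
  by move: uj; rewrite /u ltr_pdivrMr.
have st : dyadic a h m j.+1 <= t + h / 2 ^+ m.
  rewrite /dyadic -natr1 (mulrDl j%:R) mul1r mulrDl addrA lerD2r -lerBrDl ler_pdivrMr//.
  by move: ju; rewrite /u ler_pdivlMr.
have hs : `|x t - x (dyadic a h m j.+1)| <= e.
  apply: Hdel => //=; rewrite distrC ger0_norm; first by lra.
  by rewrite subr_ge0 ltW.
rewrite (le_trans (ler_distD (x (dyadic a h m j.+1)) _ _))// addrC lerD//; exact: Hd.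
Qed.

End Chaining.

(** * Probability of a bad dyadic midpoint *)

Section Modulus.
Context {R : realType} d {Om : measurableType d} (P : probability Om R).

Lemma prob_le_integral (Q : Om -> \bar R) E : measurable E -> measurable_fun setT Q ->
  (forall w, 0 <= Q w)%E -> (forall w, E w -> 1 <= Q w)%E -> (P E <= \int[P]_w Q w)%E.
Proof.
move=> mE mQ Q0 EQ; rewrite -[X in P X]setIT -integral_indic//.
apply: ge0_le_integral => //.
- by apply/measurable_EFinP; exact: measurable_indic.
- move=> w _; rewrite indicE; case: (boolP (w \in E)) => [/set_mem/EQ //|_].
  exact: Q0.
Qed.

(** Markov's inequality is applied once, to the sum of all the [S m]; where it is at most 1, so is
    every term. *)
Lemma geometric_markov (S : nat -> Om -> R) (A p : R) : 0 <= A -> 0 <= p < 1 ->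
  (forall m, measurable_fun setT (S m)) -> (forall m w, 0 <= S m w) ->
  (forall m, (\int[P]_w (S m w)%:E <= (A * p ^+ m)%:E)%E) ->
  exists E, [/\ measurable E, (P E <= (A / (1 - p))%:E)%E & forall w, ~ E w -> forall m, S m w <= 1].
Proof.
move=> A0 /andP[p0 p1] mS S0 HS.
pose Q w := (\sum_(m <oo) (S m w)%:E)%E.
have mS' m : measurable_fun setT (fun w => (S m w)%:E) by exact/measurable_EFinP.
have mQ : measurable_fun setT Q.
  by apply: (@ge0_emeasurable_sum _ _ _ setT (fun m w => (S m w)%:E) xpredT) => [m w _ _|m _];
    [rewrite lee_fin|exact: mS'].
have Q0 w : (0 <= Q w)%E by apply: nneseries_ge0 => m _ _; rewrite lee_fin.
pose E := [set w | (1 < Q w)%E].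
have mE : measurable E.
  by rewrite /E -[X in measurable X]setTI; exact: emeasurable_fun_o_infty.
exists E; split => //.
  rewrite (le_trans (prob_le_integral mE mQ Q0 _))//; first by move=> w /ltW.
  rewrite /Q integral_nneseries//; last by move=> m w _; rewrite lee_fin.
  have c0 m : (0 <= \int[P]_w (S m w)%:E)%E by apply: integral_ge0 => w _; rewrite lee_fin.
  apply: lime_le; first by apply: is_cvg_nneseries => m _ _.
  apply: nearW => n; rewrite (@le_trans _ _ (\sum_(0 <= m < n) (A * p ^+ m)%:E)%E)//.
    exact: lee_sum.
  rewrite sumEFin lee_fin; have := congr1 (@^~ n) (@geometric_seriesE _ A p (negbT (lt_eqF p1))).
  rewrite /series/= => ->.
  by rewrite ler_pM2r ?invr_gt0 ?subr_gt0// ler_piMr// gerBl exprn_ge0.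
move=> w /negP; rewrite -leNgt => Qw m; rewrite -lee_fin (le_trans _ Qw)//.
rewrite (le_trans _ (@nneseries_lim_ge _ _ _ _ m.+1 _))//; last by move=> i _ _; rewrite lee_fin.
by rewrite big_nat_recr//= leeDr// sume_ge0// => i _; rewrite lee_fin.
Qed.

Context (Z : R -> Om -> R) (T K eps : R).
Hypothesis T0 : 0 < T.
Hypothesis eps0 : 0 < eps.
Hypothesis K0 : 0 <= K.
Hypothesis mZ : forall t, 0 <= t <= T -> measurable_fun setT (Z t).
Hypothesis rcZ : forall w t, 0 <= t < T -> Z s w @[s --> t^'+] --> Z t w.
Hypothesis Z3 : forall r s t, 0 <= r -> r <= s -> s <= t -> t <= T ->
  (\int[P]_w ((Z s w - Z r w) ^+ 2 * (Z t w - Z s w) ^+ 2)%:E <= (K * (t - r) `^ (1 + eps))%:E)%E.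

(* Chosen so that the probabilities of the level-m events, of order
   2^m * (2^-m)^(1 + eps) / q^(4 m), decay geometrically with ratio q^4. *)
Let q : R := 2^-1 `^ (eps / 8).

Let q01 : 0 < q < 1.
Proof.
rewrite powR_gt0 ?invr_gt0//=.
have e8 : 0 < eps / 8 by rewrite divr_gt0.
have := @gt0_ltr_powR R _ e8 2^-1 1; rewrite powR1 !nnegrE invr_ge0 ler0n ler01.
by apply => //; rewrite invf_lt1 ?ltr1n.
Qed.

Let q_pow m : (2^-1 ^+ m : R) `^ (1 + eps) = 2^-1 ^+ m * q ^+ (8 * m).
Proof.
have h0 : 0 <= 2^-1 :> R by rewrite invr_ge0.
have E1 : q ^+ (8 * m) = 2^-1 `^ (eps / 8 * (8 * m)%:R) by rewrite powRrM powR_mulrn ?powR_ge0.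
have E2 : (2^-1 ^+ m : R) `^ eps = 2^-1 `^ (m%:R * eps) by rewrite powRrM powR_mulrn.
rewrite powRD; last by apply/implyP => _; rewrite expf_neq0// invr_eq0 pnatr_eq0.
rewrite powRr1 ?exprn_ge0// E1 E2; congr (_ * (_ `^ _)).
by rewrite natrM; field.
Qed.

Definition grid k i : R := T * i%:R / k%:R.

(** The factor [(1 - q) ^ 4] comes from the thresholds of [small_midpoint], and [1 - q ^ 4] from
    summing the geometric series over the levels. *)
Definition chain_const : R := K / ((1 - q) ^+ 4 * (1 - q ^+ 4)).

Lemma grid_mem k i : (i <= k)%N -> (0 < k)%N -> 0 <= grid k i <= T.
Proof.
move=> ik k0; rewrite /grid divr_ge0 ?mulr_ge0 ?ler0n ?(ltW T0)//=.
by rewrite ler_pdivrMr ?ltr0n// ler_pM2l// ler_nat.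
Qed.

Lemma gridS k i : (0 < k)%N -> grid k i.+1 = grid k i + T / k%:R.
Proof. by move=> k0; rewrite /grid -natr1; ring. Qed.

Let pt k i m j := dyadic (grid k i) (T / k%:R) m j.

Let pt_mem k i m j : (i < k)%N -> (j <= 2 ^ m)%N -> 0 <= pt k i m j <= T.
Proof.
move=> ik jm; have k0 : (0 < k)%N by exact: leq_ltn_trans ik.
have /andP[g0 _] := grid_mem (ltnW ik) k0; have /andP[_ g1] := grid_mem ik k0.
have h0 : 0 <= T / k%:R by rewrite divr_ge0// ltW.
rewrite /pt /dyadic addr_ge0//=; last first.
  by apply: mulr_ge0; [exact: mulr_ge0|rewrite invr_ge0 exprn_ge0].
rewrite (le_trans _ g1)// gridS// lerD2l ler_pdivrMr ?exprn_gt0// mulrC ler_wpM2l//.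
by rewrite -natrX ler_nat.
Qed.

(** The increments along the grid appear as a hypothesis on the path: the three-point bound says
    nothing about a jump inside a block when the path is nearly constant on both sides of it. *)
Lemma modulus k lam : (0 < k)%N -> 0 < lam -> exists E, [/\ measurable E,
  (P E <= (chain_const / lam ^+ 4 * (k%:R * (T / k%:R) `^ (1 + eps)))%:E)%E &
  forall w, ~ E w -> (forall i, (i < k)%N -> `|Z (grid k i.+1) w - Z (grid k i) w| <= lam) ->
  forall t, 0 <= t <= T -> `|Z t w - Z (grid k (Num.truncn (k%:R * t / T))) w| <= 2 * lam].
Proof.
move=> k0 l0; have /andP[q0 q1] := q01.
have h0 : 0 < T / k%:R by rewrite divr_gt0// ltr0n.
pose h := T / k%:R; pose c m := lam * ((1 - q) * q ^+ m).
have c0 m : 0 < c m by rewrite mulr_gt0// mulr_gt0 ?subr_gt0// exprn_gt0.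
pose U i m j w := Z (pt k i m.+1 j.*2.+1) w - Z (pt k i m j) w.
pose V i m j w := Z (pt k i m j.+1) w - Z (pt k i m.+1 j.*2.+1) w.
(* If [S m w <= 1], no midpoint of level [m] has both increments above the threshold [c m]. *)
pose S m w := \sum_(i < k) \sum_(j < 2 ^ m) (U i m j w ^+ 2 * V i m j w ^+ 2) / c m ^+ 4.
have mid j m : (j < 2 ^ m)%N -> (j.*2.+1 <= 2 ^ m.+1)%N by rewrite expnS; lia.
have mUV (i : 'I_k) m (j : 'I_(2 ^ m)) : measurable_fun setT (fun w => (U i m j w ^+ 2 * V i m j w ^+ 2) / c m ^+ 4).
  apply: measurable_funM; last exact: measurable_cst.
  apply: measurable_funM; apply: measurable_funX; apply: measurable_funB; apply: mZ; apply: pt_mem => //;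
    by [apply: mid|apply: ltnW].
have UV0 i m j w : 0 <= (U i m j w ^+ 2 * V i m j w ^+ 2) / c m ^+ 4.
  by apply: divr_ge0; [rewrite mulr_ge0 ?sqr_ge0|rewrite exprn_ge0 ?ltW].
have mS m : measurable_fun setT (S m).
  by apply: measurable_sum => i; apply: measurable_sum => j; exact: mUV.
have S0 m w : 0 <= S m w by apply: sumr_ge0 => i _; apply: sumr_ge0 => j _.
pose A := K * h `^ (1 + eps) * k%:R / (lam * (1 - q)) ^+ 4.
have A0 : 0 <= A.
  apply: divr_ge0; first by rewrite !mulr_ge0 ?powR_ge0.
  by rewrite exprn_ge0// mulr_ge0 ?subr_ge0// ltW.
have p01 : 0 <= q ^+ 4 < 1 by rewrite exprn_ge0 ?(ltW q0)//= exprn_ilt1 ?(ltW q0).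
have HS m : (\int[P]_w (S m w)%:E <= (A * (q ^+ 4) ^+ m)%:E)%E.
  under eq_integral do rewrite /S -sumEFin.
  rewrite ge0_integral_sum//; last 2 first.
  - by move=> i; apply/measurable_EFinP; apply: measurable_sum => j; exact: mUV.
  - by move=> i w _; rewrite lee_fin; apply: sumr_ge0.
  pose B := K * (h / 2 ^+ m) `^ (1 + eps) / c m ^+ 4.
  rewrite (@le_trans _ _ (\sum_(i < k) \sum_(j < 2 ^ m) B%:E)%E)//.
    apply: lee_sum => i _; under eq_integral do rewrite -sumEFin.
    rewrite ge0_integral_sum//; last 2 first.
    - by move=> j; apply/measurable_EFinP; exact: mUV.
    - by move=> j w _; rewrite lee_fin.
    apply: lee_sum => j _; under eq_integral do rewrite mulrC EFinM.
    rewrite ge0_integralZl//; last 3 first.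
    - apply/measurable_EFinP; apply: measurable_funM; apply: measurable_funX; apply: measurable_funB;
        apply: mZ; apply: pt_mem => //; by [apply: mid|apply: ltnW].
    - by move=> w _; rewrite lee_fin mulr_ge0 ?sqr_ge0.
    - by rewrite lee_fin invr_ge0 exprn_ge0// ltW.
    rewrite /B (mulrC _ (c m ^- 4)) [leRHS]EFinM lee_wpmul2l//; first by rewrite lee_fin invr_ge0 exprn_ge0// ltW.
    have /andP[r0 _] := pt_mem (ltn_ord i) (ltnW (ltn_ord j)).
    have /andP[_ t1] := pt_mem (ltn_ord i) (ltn_ord j).
    have e1 : pt k i m j.+1 = pt k i m j + h / 2 ^+ m.
      exact: dyadicS.
    have e2 : pt k i m.+1 j.*2.+1 = pt k i m j + h / 2 ^+ m / 2 by exact: dyadic_mid.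
    have d0 : 0 < h / 2 ^+ m by rewrite divr_gt0// exprn_gt0.
    rewrite (le_trans (Z3 r0 _ _ t1)) ?lee_fin// ?e1 ?e2; try lra.
    by rewrite (addrC (pt k i m j)) addrK.
  rewrite le_eqVlt; apply/orP; left; apply/eqP.
  under eq_bigr do rewrite sumEFin sumr_const card_ord.
  rewrite sumEFin sumr_const card_ord -mulrnA -mulr_natr natrM; congr EFin.
  have y1 : (q ^+ 4) ^+ m = (q ^+ m) ^+ 4 by rewrite -!exprM mulnC.
  (* Of the factor [q ^ (8 m)] gained from [eps], one half pays for the threshold [c m ^ 4] and the
     other is the geometric rate. *)
  have y2 : q ^+ (8 * m) = (q ^+ m) ^+ 4 * (q ^+ m) ^+ 4.
    by rewrite -!exprM -exprD; congr (_ ^+ _); lia.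
  rewrite /B powRM ?(ltW h0) ?invr_ge0 ?exprn_ge0// -exprVn q_pow y1 y2 /A /c natrX exprVn.
  have Y0 : q ^+ m != 0 by rewrite expf_neq0// gt_eqF.
  have z0 : (2 ^+ m : R) != 0 by rewrite expf_neq0// pnatr_eq0.
  have w0 : 1 - q != 0 by rewrite gt_eqF// subr_gt0.
  move: (q ^+ m) (2 ^+ m : R) (h `^ _) Y0 z0 => Y z p Y0 z0; field.
  by rewrite Y0 z0 w0 gt_eqF.
have [E [mE PE HE]] := geometric_markov A0 p01 mS S0 HS.
exists E; split => //.
  rewrite (le_trans PE)// lee_fin le_eqVlt; apply/orP; left; apply/eqP.
  rewrite /A /chain_const -/h exprMn; field.
  by case/andP: p01 => _ p1; rewrite !gt_eqF ?subr_gt0.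
move=> w /HE Sw Hg t /andP[t0 tT].
(* The half-open blocks miss [t = T], where the index is [k] and the grid point is [t] itself. *)
have [->|tT'] := eqVneq t T.
  rewrite mulfK ?gt_eqF// natrK /grid mulfK ?gt_eqF ?ltr0n//.
  by rewrite subrr normr0 mulr_ge0// ltW.
have {tT} tT : t < T by rewrite lt_neqAle tT'.
set u := k%:R * t / T; pose i := Num.truncn u.
have u0 : 0 <= u by rewrite /u divr_ge0 ?mulr_ge0// ltW.
have /andP[iu ui] := truncn_itv u0.
have ik : (i < k)%N.
  by rewrite -(ltr_nat R) (le_lt_trans iu)// /u ltr_pdivrMr// ltr_pM2l ?ltr0n.
rewrite -/i; apply: (@block_oscillation _ (Z ^~ w) (grid k i) h lam q) => //; try exact: ltW.
- move=> m j jm; rewrite /small_midpoint -/(c m) ge_min.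
  have : (U i m j w ^+ 2 * V i m j w ^+ 2) / c m ^+ 4 <= 1.
    rewrite (le_trans _ (Sw m))// /S (bigD1 (Ordinal ik))//= (bigD1 (Ordinal jm))//= -addrA lerDl.
    by rewrite addr_ge0// sumr_ge0// => i' _; rewrite sumr_ge0.
  rewrite ler_pdivrMr ?exprn_gt0// mul1r => H.
  rewrite -/(pt k i m.+1 j.*2.+1) -/(pt k i m j) -/(pt k i m j.+1) -/(U i m j w) -/(V i m j w).
  rewrite leNgt [X in _ || X]leNgt -negb_and; apply/negP => /andP[h1 h2].
  move: H; apply/negP; rewrite -ltNge -[U i m j w ^+ 2]real_normK ?num_real//.
  rewrite -[V i m j w ^+ 2]real_normK ?num_real// (_ : c m ^+ 4 = c m ^+ 2 * c m ^+ 2); last by ring.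
  by rewrite ltr_pM ?sqr_ge0// ltr_pXn2r ?nnegrE// ltW.
- by rewrite -gridS//; exact: Hg.
- apply/andP; split.
    rewrite /grid ler_pdivrMr ?ltr0n//; move: iu; rewrite {1}/u ler_pdivlMr// -/i => iu; lra.
  rewrite -gridS// /grid ltr_pdivlMr ?ltr0n//.
  by move: ui; rewrite {1}/u ltr_pdivrMr// -/i => ui; lra.
- by apply: rcZ; rewrite t0.
Qed.

End Modulus.

(** * Areas of trawl sets *)

Section Reflection.
Context {R : realType}.
Local Notation mu := (@lebesgue_measure R).

Let reflect (c x : measurableTypeR R) : measurableTypeR R := c - x.

Let mreflect c : measurable_fun setT (reflect c).
Proof.
have : measurable_fun setT (fun x : R => c - x) by exact: measurable_funB.
by [].
Qed.

Lemma lebesgue_measure_reflect (c : R) (A : set (measurableTypeR R)) : measurable A ->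
  pushforward mu (reflect c) A = mu A.
Proof.
move=> mA; apply/esym/lebesgue_measure_unique => //= _ [[a b]] _ <-.
rewrite /pushforward (_ : _ @^-1` _ = `[c - b, c - a[%classic); last first.
  apply/seteqP; split => x /=; rewrite !in_itv/= /reflect => /andP[h1 h2]; apply/andP; split; lra.
by rewrite !lebesgue_measure_itv/= !lte_fin ltrD2l ltrN2; case: ifP => // _; rewrite -!EFinB; congr EFin; ring.
Qed.

Lemma ge0_integral_reflect (c : R) (f : R -> \bar R) : measurable_fun setT f ->
  (forall x, 0 <= f x)%E -> (\int[mu]_x f x = \int[mu]_x f (c - x)%R)%E.
Proof.
move=> mf f0.
have := @ge0_integral_pushforward _ _ (measurableTypeR R) (measurableTypeR R) R (reflect c) (mreflect c) mu setT f measurableT mf (fun y _ => f0 y).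
rewrite preimage_setT => H; rewrite -[RHS]H.
by apply: eq_measure_integral => //= A mA _; rewrite lebesgue_measure_reflect.
Qed.

Lemma integrable_reflect (c : R) (f : R -> R) : mu.-integrable setT (EFin \o f) ->
  mu.-integrable setT (EFin \o (fun x => f (c - x))).
Proof.
move=> /integrableP[/measurable_EFinP mf fi]; apply/integrableP; split.
  by apply/measurable_EFinP; apply: (measurableT_comp mf); exact: mreflect.
rewrite (le_lt_trans _ fi)// (@ge0_integral_reflect c (fun x => `|(f x)%:E|%E))//.
by apply: measurableT_comp => //; exact/measurable_EFinP.
Qed.

Lemma Rintegral_reflect (c : R) (f : R -> R) : mu.-integrable setT (EFin \o f) ->
  \int[mu]_x f x = \int[mu]_x f (c - x).
Proof.
move=> fi; have /integrableP[mf _] := fi.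
rewrite /Rintegral; congr fine.
have := @integral_pushforward _ _ (measurableTypeR R) (measurableTypeR R) R (reflect c) (mreflect c) mu setT (EFin \o f) mf (integrable_reflect c fi) measurableT.
rewrite preimage_setT => H; rewrite -[RHS]H.
by apply: eq_measure_integral => //= A mA _; rewrite lebesgue_measure_reflect.
Qed.

(** A translation is a composition of two reflections. *)
Lemma Rintegral_shift (c : R) (f : R -> R) : mu.-integrable setT (EFin \o f) ->
  \int[mu]_x f x = \int[mu]_x f (c + x).
Proof.
move=> fi; rewrite (Rintegral_reflect c fi) (Rintegral_reflect 0 (integrable_reflect c fi)).
by apply: eq_Rintegral => x _; rewrite sub0r opprK.
Qed.

Lemma integrable_shift (c : R) (f : R -> R) : mu.-integrable setT (EFin \o f) ->
  mu.-integrable setT (EFin \o (fun x => f (c + x))).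
Proof.
move=> fi; have := integrable_reflect 0 (integrable_reflect c fi).
by congr (mu.-integrable setT (EFin \o _)); apply/funext => x; rewrite sub0r opprK.
Qed.

End Reflection.

(** * Intersections of trawl sets *)

Section TrawlArea.
Context {R : realType} (a : R -> R).
Hypothesis ha : trawl_function a.
Local Notation mu := (@lebesgue_measure R).

Let a0 h : 0 <= h -> 0 <= a h. Proof. by case: ha => + _ _; apply. Qed.

Let amono h k : 0 <= h -> h <= k -> a k <= a h. Proof. by case: ha => _ + _; apply. Qed.

(** Extension by zero turns integrals over the half-line into integrals over [R], to which
    reflections and shifts apply. *)
Definition half_line (f : R -> R) (u : R) : R := if 0 <= u then f u else 0.

Lemma half_line_patch f : half_line f = f \_ `[0, +oo[%classic.
Proof.
apply/funext => u; rewrite /half_line patchE; case: ifPn => u0.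
  by rewrite mem_set// /= in_itv/= u0.
by rewrite memNset// /= in_itv/= andbT; exact/negP.
Qed.

Lemma integrable_half_line f : mu.-integrable `[0, +oo[ (EFin \o f) ->
  mu.-integrable setT (EFin \o half_line f).
Proof.
rewrite half_line_patch => H.
rewrite (_ : EFin \o _ = (EFin \o f) \_ `[0, +oo[%classic); last first.
  by apply/funext => u; rewrite /= !patchE; case: ifP.
by apply/(integrable_mkcond _ _).1 => //; exact: measurable_itv.
Qed.

Lemma Rintegral_half_line f : \int[mu]_(x in `[0, +oo[) f x = \int[mu]_x half_line f x.
Proof. by rewrite Rintegral_mkcond half_line_patch. Qed.

Let iext : mu.-integrable setT (EFin \o half_line a).
Proof. by apply: integrable_half_line; case: ha. Qed.

Let mext : measurable_fun setT (half_line a).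
Proof. by have /integrableP[/measurable_EFinP] := iext. Qed.

(** The integral of [a] over [[h, oo)], which is the area of [A_s] intersected with [A_(s + h)]. *)
Definition tail_area (h : R) : R := \int[mu]_(u in `[0, +oo[) a (h + u).

Lemma in_shifted_trawl_set t (p : measurableTypeR R * measurableTypeR R) :
  shifted_trawl_set a t p <-> p.1 <= t /\ 0 <= p.2 <= a (t - p.1).
Proof.
split=> [[[r y] /= [r0 y0] <-/=]|].
  by split; [rewrite gerDr|rewrite opprD addrCA subrr addr0].
case: p => x y /= [rt y0]; exists (x - t, y); last by rewrite /= subrK.
by split => /=; [rewrite subr_le0|rewrite opprB].
Qed.

Lemma measurable_shifted_trawl_set t : measurable (shifted_trawl_set a t).
Proof.
have m1 : measurable_fun setT (fun p : measurableTypeR R * measurableTypeR R => t - p.1).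
  by apply: measurable_funB => //; exact: measurable_fst.
have m2 : measurable_fun setT (fun p : measurableTypeR R * measurableTypeR R => (p.2 : R)).
  exact: measurable_snd.
have m3 : measurable_fun setT (fun p : measurableTypeR R * measurableTypeR R => half_line a (t - p.1) - p.2).
  by apply: measurable_funB => //; exact: (measurableT_comp mext m1).
have -> : shifted_trawl_set a t =
    ((fun p => t - p.1) @^-1` `[0, +oo[) `&` (snd @^-1` `[0, +oo[) `&`
    ((fun p => half_line a (t - p.1) - p.2) @^-1` `[0, +oo[).
  apply/seteqP; split => p.
    move/in_shifted_trawl_set => [h1 /andP[h2 h3]].
    have h4 : 0 <= t - p.1 by rewrite subr_ge0.
    by rewrite /= !in_itv/= !andbT /half_line h4 subr_ge0.
  rewrite /= !in_itv/= !andbT => -[[h1 h2]]; rewrite /half_line h1 subr_ge0 => h3.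
  by apply/in_shifted_trawl_set; rewrite h2 h3 -subr_ge0.
have I0 : measurable (`[0, +oo[%classic : set R) by exact: measurable_itv.
apply: measurableI; first apply: measurableI.
- by rewrite -[X in measurable X]setTI; exact: m1.
- by rewrite -[X in measurable X]setTI; exact: m2.
- by rewrite -[X in measurable X]setTI; exact: m3.
Qed.

Let shift_ext h : 0 <= h -> mu.-integrable setT (EFin \o half_line (fun u => a (h + u))).
Proof.
move=> h0; have mf : measurable_fun setT (half_line (fun u => a (h + u))).
  have -> : half_line (fun u => a (h + u)) =
      (fun u => half_line a (h + u)) \_ `[0, +oo[%classic.
    apply/funext => u; rewrite -half_line_patch /half_line; case: ifPn => // u0.
    by rewrite addr_ge0.
  apply/(measurable_restrictT _ _).1; first exact: measurable_itv.
  by apply: measurable_funTS; apply: (measurableT_comp mext); exact: measurable_funD.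
apply: (le_integrable measurableT _ _ iext); first exact/measurable_EFinP.
move=> u _; rewrite /= lee_fin /half_line; case: ifPn => // u0.
rewrite !ger0_norm ?a0 ?addr_ge0//; apply: amono => //; lra.
Qed.

(** As [a] is non-increasing, the section of the intersection at [x <= s] is [[0, a (t - x)]]; a
    reflection about [s] then gives the tail. *)
Lemma area_shifted_trawl_setI s t : s <= t ->
  leb2 (shifted_trawl_set a s `&` shifted_trawl_set a t) = (tail_area (t - s))%:E.
Proof.
move=> st; have ts : 0 <= t - s by rewrite subr_ge0.
pose f (x : R) := half_line (fun u => a (t - s + u)) (s - x).
have f0 u : 0 <= half_line (fun u => a (t - s + u)) u.
  by rewrite /half_line; case: ifP => // u0; rewrite a0// addr_ge0.
rewrite /leb2 /product_measure1 /=.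
transitivity (\int[mu]_x (f x)%:E)%E.
  apply: eq_integral => x _; rewrite /f /half_line subr_ge0.
  have [xs|xs] := leP x s.
    rewrite (_ : xsection _ _ = `[0, a (t - s + (s - x))]%classic); last first.
      apply/seteqP; split => y; rewrite /xsection/= inE/=.
        by move=> [_ /in_shifted_trawl_set/= [_]]; rewrite in_itv/= subrKA.
      rewrite in_itv/= subrKA => /andP[y0 ya]; split; apply/in_shifted_trawl_set => /=.
        by rewrite xs y0; split => //; rewrite (le_trans ya)//; apply: amono; lra.
      by rewrite (le_trans xs st) y0.
    have h : 0 <= a (t - s + (s - x)) by apply: a0; lra.
    rewrite lebesgue_measure_itv/= lte_fin lt_neqAle h andbT.
    by case: eqVneq => [<-//|_ /=]; rewrite sube0.
  rewrite (_ : xsection _ _ = set0) ?measure0//.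
  apply/seteqP; split => y //; rewrite /xsection/= inE/=.
  by move=> [/in_shifted_trawl_set/= [+ _] _]; rewrite leNgt xs.
have E := @ge0_integral_reflect R s (EFin \o half_line (fun u => a (t - s + u))).
rewrite -E => [| |u]; first last.
- by rewrite /= lee_fin f0.
- by have /integrableP[] := shift_ext ts.
rewrite /tail_area Rintegral_half_line /Rintegral fineK//.
exact: (integrable_fin_num measurableT (shift_ext ts)).
Qed.

Lemma finite_borel_shifted_trawl_set t : finite_borel (shifted_trawl_set a t).
Proof.
split; first exact: measurable_shifted_trawl_set.
by rewrite -[X in leb2 X]setIid area_shifted_trawl_setI// ltry.
Qed.

Let tail h (x : R) := if h <= x then a x else 0.

Let itail h : 0 <= h -> mu.-integrable setT (EFin \o tail h).
Proof.
move=> h0; have := integrable_shift (- h) (shift_ext h0).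
congr (mu.-integrable setT (EFin \o _)); apply/funext => x; rewrite /half_line /tail addrC subr_ge0.
by case: ifP => // _; rewrite addrCA subrr addr0.
Qed.

Let tail_areaE h : 0 <= h -> tail_area h = \int[mu]_x tail h x.
Proof.
move=> h0; rewrite (Rintegral_shift h (itail h0)) /tail_area Rintegral_half_line.
by apply: eq_Rintegral => x _; rewrite /tail /half_line lerDl.
Qed.

(** Two-sided bounds take the place of a derivative because [a] is not assumed continuous;
    [overlap_diff] gives the same ones for the overlap. *)
Lemma tail_area_diff h k : 0 <= h -> h <= k ->
  a k * (k - h) <= tail_area h - tail_area k <= a h * (k - h).
Proof.
move=> h0 hk; have k0 := le_trans h0 hk.
rewrite !tail_areaE// -(RintegralB measurableT (itail h0) (itail k0)).
pose I : R -> R := \1_(`[h, k[%classic).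
have II : (\int[mu]_x (I x)%:E = (k - h)%:E)%E.
  rewrite integral_indic//= setIT lebesgue_measure_itv/= lte_fin; case: ltP => [_|kh]; first by rewrite -EFinB.
  by rewrite (@le_anti _ _ h k) ?hk// subrr.
have ii : mu.-integrable setT (EFin \o I).
  apply/integrableP; split; first by apply/measurable_EFinP; apply: measurable_indic; exact: measurable_itv.
  by under eq_integral do rewrite /= ger0_norm//; rewrite II ltry.
have Ik : \int[mu]_x I x = k - h by rewrite /Rintegral II.
have iB := integrableB measurableT (itail h0) (itail k0).
rewrite -Ik -!(RintegralZl _ measurableT ii); apply/andP; split; apply: le_Rintegral => //.
- exact: (integrableZl measurableT _ ii).
- move=> x _; rewrite /I indicE /tail; have [xh|xh] := boolP (x \in _).
    move: xh; rewrite inE/= in_itv/= => /andP[hx xk].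
    by rewrite hx (lt_geF xk) subr0 mulr1; apply: amono; [exact: le_trans hx|exact: ltW].
  rewrite mulr0; case: (leP k x) => kx; last by case: ifP => // hx; rewrite subr0 a0// (le_trans h0).
  by rewrite (le_trans hk kx) subrr.
- exact: (integrableZl measurableT _ ii).
- move=> x _; rewrite /I indicE /tail; have [xh|xh] := boolP (x \in _).
    move: xh; rewrite inE/= in_itv/= => /andP[hx xk].
    by rewrite hx (lt_geF xk) subr0 mulr1; exact: amono.
  case: (leP k x) => kx; first by rewrite (le_trans hk kx) subrr mulr0.
  case: (leP h x) => hx; last by rewrite subr0 mulr0.
  by move: xh; rewrite notin_setE/= in_itv/= hx kx.
Qed.

Lemma tail_area_ge0 h : 0 <= h -> 0 <= tail_area h.
Proof. by move=> h0; apply: Rintegral_ge0 => u; rewrite /= in_itv/= andbT => u0; rewrite a0// addr_ge0. Qed.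

Lemma tail_area_cvg0 : tail_area n%:R @[n --> \oo] --> 0.
Proof.
pose f (n : nat) := half_line (fun u => a (n%:R + u)).
have fE n : tail_area n%:R = \int[mu]_x f n x by rewrite /tail_area Rintegral_half_line.
have mf n : measurable_fun setT (EFin \o f n) by have /integrableP[] := shift_ext (ler0n R n).
have f_le n x : `|f n x| <= half_line a x.
  rewrite /f /half_line; case: ifP => u0; last by rewrite normr0.
  by rewrite ger0_norm ?a0 ?addr_ge0//; apply: amono => //; rewrite lerDr.
have f_cvg x : f n x @[n --> \oo] --> 0.
  (* [a (n+1)] tends to 0 because [(n+1) * a (n+1)] is at most the integral of [a]; the index is
     shifted to match [harmonic]. *)
  rewrite -(cvg_shiftS (fun n => f n x)) /=; set c := tail_area 0.
  have H : harmonic n * c @[n --> \oo] --> (0 : R).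
    by rewrite -(mul0r c); apply: cvgMl; exact: cvg_harmonic.
  apply: (squeeze_cvgr _ (cvg_cst 0) H); apply: nearW => n; rewrite /f /half_line.
  have n0 := ler0n R n.+1; have /andP[+ _] := tail_area_diff (lexx 0) n0.
  rewrite subr0 -/c => h1; have h2 := tail_area_ge0 n0.
  have c0 : 0 <= c by exact: tail_area_ge0.
  case: ifP => u0; last by rewrite lexx mulr_ge0// invr_ge0.
  rewrite a0 ?addr_ge0//= (@le_trans _ _ (a n.+1%:R))//; first by apply: amono => //; rewrite lerDl.
  by rewrite /harmonic mulrC ler_pdivlMr ?ltr0n// (le_trans h1)// gerBl.
have mz : measurable_fun setT (EFin \o (fun=> 0 : R) : R -> \bar R) by exact/measurable_EFinP.
have fc x : (EFin \o f n) x @[n --> \oo] --> (0 : R)%:E.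
  by apply: cvg_EFin; [exact: nearW|exact: f_cvg].
have dom : {ae mu, forall x n, setT x -> (`|(EFin \o f n) x| <= (half_line a x)%:E)%E}.
  by apply: aeW => x n _; rewrite /= lee_fin.
have fc' : {ae mu, forall x, setT x -> (EFin \o f n) x @[n --> \oo] --> 0%E}.
  by apply: aeW => x _; exact: fc.
have [_ _] := @dominated_convergence _ (measurableTypeR R) R mu setT measurableT (fun n => EFin \o f n)
  (fun=> 0%E) (EFin \o half_line a) mf mz fc' iext dom.
rewrite integral0 => H; rewrite (_ : (fun n => _) = (fun n => \int[mu]_x f n x)); last exact/funext.
exact: (fine_cvg H).
Qed.

End TrawlArea.

(** * Autocorrelation of the kernel *)

Section Overlap.
Context {R : realType} (g a : R -> R).
Hypothesis hga : trawl_from_kernel g a.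
Hypothesis ha : trawl_function a.
Local Notation mu := (@lebesgue_measure R).

Let a0 h : 0 <= h -> 0 <= a h. Proof. by case: ha => + _ _; apply. Qed.

Let amono h k : 0 <= h -> h <= k -> a k <= a h. Proof. by case: ha => _ + _; apply. Qed.

Lemma moving_average_half_line t s : moving_average_kernel g t s = half_line g (t - s).
Proof. by rewrite /moving_average_kernel /half_line subr_ge0. Qed.

Let iprod h : 0 <= h -> mu.-integrable setT (EFin \o half_line (fun s => g s * g (h + s))).
Proof. by move=> h0; apply: integrable_half_line; have [H _] := hga; exact: H. Qed.

Lemma overlap_kernel s t : s <= t ->
  mu.-integrable setT (EFin \o (fun x => moving_average_kernel g s x * moving_average_kernel g t x)) /\
  \int[mu]_x (moving_average_kernel g s x * moving_average_kernel g t x) = overlap g (t - s).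
Proof.
move=> st; have ts : 0 <= t - s by rewrite subr_ge0.
have E : (fun x => moving_average_kernel g s x * moving_average_kernel g t x) =
    (fun x => half_line (fun u => g u * g (t - s + u)) (s - x)).
  apply/funext => x; rewrite /moving_average_kernel /half_line subr_ge0.
  by case: ifP => xs; rewrite ?mul0r// (le_trans xs st) subrKA.
rewrite E /overlap Rintegral_half_line; split; first exact: (integrable_reflect s (iprod ts)).
by rewrite -(Rintegral_reflect s (iprod ts)).
Qed.

Let quotient_close h e : 0 <= h -> 0 < e -> exists2 del, 0 < del &
  forall k, `|k| < del -> k != 0 -> 0 <= h + k ->
    `|- a h - (overlap g (h + k) - overlap g h) / k| <= e.
Proof.
move=> h0 e0; have [_ /(_ h h0)/cvgrPdist_le/(_ e e0)[del /= del0 H]] := hga.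
by exists del => // k kd k0 hk; apply: H => //=; rewrite sub0r normrN.
Qed.

Let overlap_close h : 0 <= h -> exists2 del, 0 < del &
  forall k, `|k| < del -> 0 <= h + k -> `|overlap g h - overlap g (h + k)| <= `|k| * (a h + 1).
Proof.
move=> h0; have [del del0 H] := quotient_close h0 ltr01; exists del => // k kd hk.
have [->|k0] := eqVneq k 0; first by rewrite addr0 subrr normr0 mul0r.
have {}H := H k kd k0 hk.
rewrite -(ler_pdivrMl _ _ (_ : 0 < `|k|)) ?normr_gt0// mulrC -normfV -normrM -opprB mulNr normrN.
rewrite -[X in `|X|](subrK (- a h)) (le_trans (ler_normD _ _))// addrC lerD//.
  by rewrite normrN ger0_norm ?a0.
by rewrite distrC.
Qed.

(** Mean value theorem: the derivative [- a] is used in the open interval only, and continuity at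
    the ends comes from [overlap_close], which also covers [h = 0], where the derivative is
    one-sided. *)
Lemma overlap_diff h k : 0 <= h -> h < k ->
  a k * (k - h) <= overlap g h - overlap g k <= a h * (k - h).
Proof.
move=> h0 hk.
have der x : x \in `]h, k[%R -> is_derive x 1 (overlap g) (- a x).
  rewrite in_itv/= => /andP[hx xk]; have x0 : 0 < x by exact: le_lt_trans hx.
  have D : y^-1 *: (overlap g (y *: 1 + x) - overlap g x) @[y --> 0^'] --> - a x.
    apply/cvgrPdist_le => /= e e0; have [del del0 H] := quotient_close (ltW x0) e0.
    exists (Num.min del x); first by rewrite /= lt_min del0.
    move=> y /=; rewrite sub0r normrN lt_min => /andP[y1 y2] y0.
    rewrite /GRing.scale/= mulr1 (addrC y) mulrC; apply: H => //.
    by move: y2; rewrite ltr_norml => /andP[y2 _]; lra.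
  by apply: DeriveDef; [apply/cvg_ex; exists (- a x)|exact/cvg_lim].
have cont : {within `[h, k], continuous (overlap g)}.
  apply/continuous_within_itvP => //; split.
  - move=> x /der [d _]; apply: differentiable_continuous; exact/derivable1_diffP.
  - apply/cvgrPdist_le => /= e e0; have [del del0 H] := overlap_close h0.
    have c0 : 0 < a h + 1 by rewrite ltr_wpDl// a0.
    exists (Num.min del (e / (a h + 1))); first by rewrite /= lt_min del0 divr_gt0.
    move=> y /=; rewrite distrC lt_min => /andP[y1 y2] hy.
    rewrite -(subrKC h y) (le_trans (H _ y1 _))//; first by rewrite subrKC (le_trans h0)// ltW.
    by rewrite -ler_pdivlMr// ltW.
  - have k0 : 0 <= k by rewrite (le_trans h0)// ltW.
    apply/cvgrPdist_le => /= e e0; have [del del0 H] := overlap_close k0.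
    have c0 : 0 < a k + 1 by rewrite ltr_wpDl// a0.
    exists (Num.min (Num.min del (k - h)) (e / (a k + 1))).
      by rewrite /= !lt_min del0 subr_gt0 hk divr_gt0.
    move=> y /=; rewrite distrC !lt_min => /andP[/andP[y1 y3] y2] hy.
    rewrite -(subrKC k y) (le_trans (H _ y1 _))//; last by rewrite -ler_pdivlMr// ltW.
    by move: y3; rewrite ltr_norml subrKC => /andP[y3 _]; lra.
have [c] := MVT hk der cont.
rewrite in_itv/= => /andP[hc ck] E.
have -> : overlap g h - overlap g k = a c * (k - h).
  by rewrite -opprB E mulNr opprK.
have c0 : 0 <= c by rewrite (le_trans h0)// ltW.
by rewrite !ler_pM2r ?subr_gt0// !amono// ltW.
Qed.

(** Square integrability of [g] is the integrability clause of [trawl_from_kernel] at [h = 0]. *)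
Let isq : mu.-integrable setT (EFin \o half_line (fun s => g s ^+ 2)).
Proof.
have := iprod (lexx 0); congr (mu.-integrable setT (EFin \o half_line _)).
by apply/funext => s; rewrite add0r expr2.
Qed.

(** The product [g s * g (n + s)] is split by a weight [eta] into the full square norm of [g] and
    its tail beyond [n], which tends to 0. *)
Lemma overlap_cvg0 : overlap g n%:R @[n --> \oo] --> 0.
Proof.
pose tail (n : nat) (x : R) := if n%:R <= x then g x ^+ 2 else 0.
have itail n : mu.-integrable setT (EFin \o tail n).
  apply: (le_integrable measurableT _ _ isq).
    have mg : measurable_fun setT (half_line (fun s => g s ^+ 2)).
      by have /integrableP[/measurable_EFinP] := isq.
    have -> : EFin \o tail n = EFin \o ((half_line (fun s => g s ^+ 2)) \_ `[n%:R, +oo[%classic).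
      apply/funext => x; rewrite /= patchE /tail /half_line; case: ifPn => nx.
        by rewrite mem_set/= ?in_itv/= ?nx// (le_trans _ nx).
      by rewrite memNset//= in_itv/= andbT; exact/negP.
    apply/measurable_EFinP/(measurable_restrictT _ _).1; first exact: measurable_itv.
    exact: measurable_funTS.
  move=> x _; rewrite /= lee_fin /tail /half_line; case: ifPn => nx; last by rewrite normr0.
  by rewrite (le_trans _ nx).
have tail0 (x : R) : tail n x @[n --> \oo] --> (0 : R).
  apply/cvgrPdist_le => /= e e0; near=> n.
  have xn : x < n%:R.
    have h : (Num.truncn `|x| < n)%N by near: n; exact: nbhs_infty_gt.
    rewrite (le_lt_trans (ler_norm x))// (lt_le_trans (truncnS_gt _))//.
    by rewrite ler_nat.
  by rewrite /tail (lt_geF xn) subrr normr0 ltW.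
have tail_cvg : \int[mu]_x tail n x @[n --> \oo] --> (0 : R).
  have mt n : measurable_fun setT (EFin \o tail n) by have /integrableP[] := itail n.
  have mz : measurable_fun setT (EFin \o (fun=> 0 : R) : R -> \bar R) by exact/measurable_EFinP.
  have fc : {ae mu, forall x, setT x -> (EFin \o tail n) x @[n --> \oo] --> 0%E}.
    by apply: aeW => x _; apply: cvg_EFin; [exact: nearW|exact: tail0].
  have dom : {ae mu, forall x n, setT x -> (`|(EFin \o tail n) x| <= (half_line (fun s => g s ^+ 2) x)%:E)%E}.
    apply: aeW => x n _; rewrite /= lee_fin /tail /half_line; case: ifPn => nx.
      by rewrite (le_trans _ nx)// ger0_norm ?sqr_ge0.
    by rewrite normr0; case: ifP => // _; exact: sqr_ge0.
  have [_ _] := @dominated_convergence _ (measurableTypeR R) R mu setT measurableT (fun n => EFin \o tail n)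
    (fun=> 0%E) (EFin \o half_line (fun s => g s ^+ 2)) mt mz fc isq dom.
  by rewrite integral0 => H; exact: (fine_cvg H).
pose K := \int[mu]_x half_line (fun s => g s ^+ 2) x.
have bound n eta : 0 < eta -> `|overlap g n%:R| <= eta * K + eta^-1 * \int[mu]_x tail n x.
  move=> e0; rewrite /overlap Rintegral_half_line (le_trans (le_normr_Rintegral _ (iprod (ler0n R n))))//.
  rewrite (Rintegral_shift n%:R (itail n)).
  have i1 := integrableZl measurableT eta isq.
  have i2 := integrableZl measurableT eta^-1 (integrable_shift n%:R (itail n)).
  rewrite -(RintegralZl _ measurableT isq) -(RintegralZl _ measurableT (integrable_shift n%:R (itail n))).
  rewrite -(RintegralD measurableT i1 i2); apply: le_Rintegral => //.
  - exact: (integrable_norm (iprod (ler0n R n))).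
  - exact: (integrableD measurableT i1 i2).
  - move=> x _; rewrite /half_line /tail lerDl; case: ifP => _; last by rewrite normr0 !mulr0 addr0.
    set u := g x; set v := g _; rewrite normrM -(real_normK (num_real u)) -(real_normK (num_real v)).
    have s0 : eta^-1 * eta = 1 by rewrite mulVf// gt_eqF.
    have h : 0 <= eta^-1 * (eta * `|u| - `|v|) ^+ 2 by rewrite mulr_ge0 ?sqr_ge0// invr_ge0 ltW.
    have : eta^-1 * (eta * `|u| - `|v|) ^+ 2 =
        (eta^-1 * eta) * eta * `|u| ^+ 2 + eta^-1 * `|v| ^+ 2 - 2 * (eta^-1 * eta) * (`|u| * `|v|) by ring.
    rewrite s0 => E; have := mulr_ge0 (normr_ge0 u) (normr_ge0 v); lra.
apply: (@cvg_of_eta_bound _ (fun n => overlap g n%:R) (fun n => \int[mu]_x tail n x) 0 K (fun eta => eta^-1)) => //.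
- by apply: Rintegral_ge0 => x _; rewrite /half_line; case: ifP => // _; exact: sqr_ge0.
- by move=> eta e0; rewrite invr_ge0 ltW.
- by move=> eta e0; apply: nearW => n; rewrite subr0 mulrC; exact: bound.
Unshelve. all: by end_near. Qed.

(** By the common bounds, the difference [D] varies by at most [(a x - a y) * (y - x)] on [[x, y]].
    Cutting the interval into [N + 1] equal pieces, the sum of these bounds telescopes to
    [(a x - a y) * (y - x) / (N + 1)], so [D] is constant without any continuity of [a]; its limit
    at infinity is 0. *)
Lemma overlap_tail_area h : 0 <= h -> overlap g h = tail_area a h.
Proof.
pose D h := overlap g h - tail_area a h.
have Dstep x y : 0 <= x -> x < y -> `|D y - D x| <= (a x - a y) * (y - x).
  move=> x0 xy; have /andP[b1 b2] := overlap_diff x0 xy.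
  have /andP[b3 b4] := tail_area_diff ha x0 (ltW xy).
  by rewrite mulrBl ler_norml /D; lra.
have Dcst x y : 0 <= x -> x < y -> D y = D x.
  move=> x0 xy; apply/eqP; rewrite -subr_eq0 -normr_le0; apply/ler_addgt0Pr => e e0; rewrite add0r.
  pose B := (a x - a y) * (y - x).
  have [N hN] : exists N : nat, B / N.+1%:R <= e.
    exists (Num.truncn (B / e)); rewrite ler_pdivrMr ?ltr0n// mulrC -ler_pdivrMr//.
    exact/ltW/truncnS_gt.
  pose p i := x + i%:R * ((y - x) / N.+1%:R).
  have d0 : 0 < (y - x) / N.+1%:R by rewrite divr_gt0 ?subr_gt0.
  have pS i : p i.+1 - p i = (y - x) / N.+1%:R by rewrite /p -(natr1 i); ring.
  have p0 i : 0 <= p i by rewrite addr_ge0// mulr_ge0// ltW.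
  have pN : p N.+1 = y by rewrite /p mulrC divfK ?pnatr_eq0// addrC subrK.
  have pZ : p 0%N = x by rewrite /p mul0r addr0.
  rewrite (le_trans _ hN)// -{1}pN -{1}pZ -(telescope_sumr (fun i => D (p i)))//.
  rewrite (le_trans (ler_norm_sum _ _ _))//.
  rewrite (@le_trans _ _ (\sum_(0 <= i < N.+1) - (a (p i.+1) - a (p i)) * ((y - x) / N.+1%:R)))//.
    apply: ler_sum => i _; rewrite (opprB (a _)).
    have pp : p i < p i.+1 by rewrite -subr_gt0 pS.
    by have := Dstep _ _ (p0 i) pp; rewrite pS.
  rewrite -mulr_suml sumrN (telescope_sumr (fun i => a (p i)))// pN pZ opprB /B.
  by rewrite mulrA.
have D0 : D 0 = 0.
  have L : D n%:R @[n --> \oo] --> (0 : R).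
    by rewrite -(subrr 0); apply: cvgB; [exact: overlap_cvg0|exact: tail_area_cvg0].
  have L' : D n%:R @[n --> \oo] --> D 0.
    rewrite -(cvg_shiftS (fun n => D n%:R)) (_ : [sequence _]_n = cst (D 0)); first exact: cvg_cst.
    by apply/funext => n; exact: Dcst.
  exact: (cvg_unique _ L' L).
rewrite le_eqVlt => /orP[/eqP<-|h0]; apply/eqP; rewrite -subr_eq0.
  exact/eqP/D0.
by rewrite -/(D h) (Dcst 0)// D0.
Qed.

End Overlap.

Lemma char_polar_shift {R : realType} d {T : measurableType d} (P : probability T R) (Y : T -> R)
    rho beta c : measurable_fun setT Y -> char_polar P Y rho beta ->
  char_polar P (fun w => Y w - c) rho (beta - c).
Proof.
move=> mY [Hc Hs].
have ic := bounded_rv_integrable P (bounded_rv_cos mY).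
have is_ := bounded_rv_integrable P (bounded_rv_sin mY).
split.
  transitivity (\int[P]_w (cos c * cos (Y w) + sin c * sin (Y w))).
    by apply: eq_Rintegral => w _; rewrite cosB; ring.
  rewrite (RintegralD measurableT (integrableZl measurableT _ ic) (integrableZl measurableT _ is_)).
  rewrite (RintegralZl _ measurableT ic) (RintegralZl _ measurableT is_) Hc Hs cosB; ring.
transitivity (\int[P]_w (cos c * sin (Y w) + (- sin c) * cos (Y w))).
  by apply: eq_Rintegral => w _; rewrite sinB; ring.
rewrite (RintegralD measurableT (integrableZl measurableT _ is_) (integrableZl measurableT _ ic)).
by rewrite (RintegralZl _ measurableT ic) (RintegralZl _ measurableT is_) Hc Hs sinB; ring.
Qed.

Definition increment {R : realType} {k} (i j l : 'I_k) : R := (l == j)%:R - (l == i)%:R.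

Lemma sum_increment {R : realType} k (i j : 'I_k) (f : 'I_k -> R) :
  \sum_(l < k) increment i j l * f l = f j - f i.
Proof.
have D (m : 'I_k) : \sum_(l < k) (l == m)%:R * f l = f m.
  rewrite (bigD1 m)//= eqxx mul1r big1 ?addr0// => l /negbTE ->; exact: mul0r.
by rewrite -!D -sumrB; apply: eq_bigr => l _; rewrite mulrBl.
Qed.

Lemma sum_increment_mem {R : realType} k (i j : 'I_k) (S : {set 'I_k}) :
  \sum_(l in S) increment i j l = (j \in S)%:R - (i \in S)%:R :> R.
Proof.
rewrite big_mkcond -(sum_increment i j (fun l => (l \in S)%:R)); apply: eq_bigr => l _.
by case: ifP; rewrite ?mulr1 ?mulr0.
Qed.

(** * Sums over atoms as areas *)

Section AtomSums.
Context {R : realType} d {T : measurableType d} (mu : {measure set T -> \bar R}) (k : nat)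
  (A : 'I_k -> set T).
Hypothesis mA : forall j, measurable (A j).
Hypothesis fA : forall j, (mu (A j) < +oo)%E.

Definition atom_mass (S : {set 'I_k}) : R := fine (mu (atom A S)).

Let fin_atom S : mu (atom A S) \is a fin_num.
Proof.
have [->|/set0Pn[j jS]] := eqVneq S finset.set0; first by rewrite /atom eqxx measure0.
rewrite ge0_fin_numE// (le_lt_trans _ (fA j))//; apply: le_measure; rewrite ?inE//.
  exact: atom_measurable.
exact: sub_atom.
Qed.

Lemma atom_mass_ge0 S : 0 <= atom_mass S. Proof. exact: fine_ge0. Qed.

Lemma sum_atom_mass (C : pred {set 'I_k}) :
  mu (\bigcup_(S in [set S | C S]) atom A S) = (\sum_(S | C S) atom_mass S)%:E.
Proof.
rewrite measure_fin_bigcup; last 3 first.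
- exact: finite_finset.
- by apply: sub_trivIset (@atom_trivIset _ _ A).
- by move=> S _; exact: atom_measurable.
rewrite (fsbigE (enum C)); last 3 first.
- exact: enum_uniq.
- by move=> S /=; rewrite mem_enum.
- by move=> S /= CS; rewrite mem_enum => /negP[].
rewrite big_enum_cond/= -sumEFin; apply: eq_big => [S|S _]; last by rewrite /atom_mass fineK.
rewrite unfold_in; case: (boolP (C S)) => //= CS; exact/mem_set.
Qed.

Lemma sum_atom_mass_mem i j :
  fine (mu (A i `&` A j)) = \sum_S atom_mass S * ((i \in S)%:R * (j \in S)%:R).
Proof.
have -> : A i `&` A j = \bigcup_(S in [set S : {set 'I_k} | (i \in S) && (j \in S)]) atom A S.
  apply/seteqP; split => p; last by move=> [S /= /andP[iS jS] pS]; split; exact: sub_atom pS.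
  move=> [pi pj]; move: (pi); rewrite {1}(bigcup_atom A i) => -[S /= iS pS]; exists S => //=.
  by move: pS pj; rewrite iS/= /atom; case: eqP => // _ h /h.
rewrite sum_atom_mass/= [LHS]big_mkcond/=; apply: eq_bigr => S _.
by case: (i \in S); case: (j \in S); rewrite ?mulr1 ?mulr0 ?mul0r ?mulr0.
Qed.

Lemma sum_atom_mass_square (th : 'I_k -> R) :
  \sum_S atom_mass S * (\sum_(j in S) th j) ^+ 2 =
  \sum_i \sum_j th i * th j * fine (mu (A i `&` A j)).
Proof.
under [RHS]eq_bigr do under eq_bigr do rewrite sum_atom_mass_mem mulr_sumr.
under [RHS]eq_bigr do rewrite exchange_big.
rewrite exchange_big/=; apply: eq_bigr => S _.
rewrite expr2 big_mkcond/= big_distrl/= mulr_sumr; apply: eq_bigr => i _.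
rewrite big_distrr/= mulr_sumr; apply: eq_bigr => j _.
by case: (i \in S); case: (j \in S); rewrite ?mul0r ?mulr0 ?mulr1//; ring.
Qed.

Lemma sum_atom_mass_linear (th : 'I_k -> R) :
  \sum_S atom_mass S * (\sum_(j in S) th j) = \sum_j th j * fine (mu (A j)).
Proof.
under [RHS]eq_bigr do rewrite -[A _]setIid sum_atom_mass_mem mulr_sumr.
rewrite exchange_big/=; apply: eq_bigr => S _.
rewrite big_mkcond/= mulr_sumr; apply: eq_bigr => j _.
by case: (j \in S); rewrite ?mulr0 ?mulr1//; ring.
Qed.

Lemma sum_atom_mass_diff i j :
  \sum_S atom_mass S * ((j \in S)%:R - (i \in S)%:R) ^+ 2 =
  fine (mu (A i)) + fine (mu (A j)) - 2 * fine (mu (A i `&` A j)).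
Proof.
rewrite -{1}(setIid (A i)) -{1}(setIid (A j)) !sum_atom_mass_mem mulr_sumr -big_split -sumrB/=.
by apply: eq_bigr => S _; ring.
Qed.

(** Both squares are nonzero only if membership changes from [r] to [s] and again from [s] to [t],
    that is, for points in [A s] alone or in all but [A s]. *)
Lemma sum_atom_mass_mixed r s t :
  \sum_S atom_mass S * (((s \in S)%:R - (r \in S)%:R) ^+ 2 * ((t \in S)%:R - (s \in S)%:R) ^+ 2) =
  fine (mu ((A s `\` A t) `\` A r)) + fine (mu ((A r `&` A t) `\` A s)).
Proof.
have E1 : (A s `\` A t) `\` A r =
    \bigcup_(S in [set S : {set 'I_k} | [&& s \in S, t \notin S & r \notin S]]) atom A S.
  apply/seteqP; split => p.
    move=> [[ps pt] pr]; move: (ps); rewrite {1}(bigcup_atom A s) => -[S /= sS pS]; exists S => //=.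
    rewrite sS/=; apply/andP; split; apply/negP => h; [apply: pt|apply: pr]; exact: sub_atom pS.
  move=> [S /= /and3P[sS tS rS] pS]; split; first split; first exact: sub_atom pS.
    by move: pS tS; rewrite /atom; case: eqP => // _ h /negP tS /h.
  by move: pS rS; rewrite /atom; case: eqP => // _ h /negP rS /h.
have E2 : (A r `&` A t) `\` A s =
    \bigcup_(S in [set S : {set 'I_k} | [&& r \in S, t \in S & s \notin S]]) atom A S.
  apply/seteqP; split => p.
    move=> [[pr pt] ps]; move: (pr); rewrite {1}(bigcup_atom A r) => -[S /= rS pS]; exists S => //=.
    rewrite rS/=; apply/andP; split; last by apply/negP => h; apply: ps; exact: sub_atom pS.
    by move: pS pt; rewrite /atom; case: eqP => // _ h /h.
  move=> [S /= /and3P[rS tS sS] pS]; split; first by split; apply: sub_atom pS.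
  by move: pS sS; rewrite /atom; case: eqP => // _ h /negP sS /h.
rewrite E1 E2 !sum_atom_mass/= [X in _ = X + _]big_mkcond [X in _ = _ + X]big_mkcond -big_split/=.
apply: eq_bigr => S _; case: (r \in S); case: (s \in S); case: (t \in S) => /=; ring.
Qed.

End AtomSums.

Lemma expectation_ge0E {R : realType} d {T : measurableType d} (P : probability T R) (f : T -> R) :
  ('E_P[f] = \int[P]_w (f w)%:E)%E.
Proof. by rewrite unlock. Qed.

(** * The limit process *)

Section GaussianProcess.
Context {R : realType} d {Om : measurableType d} (P : probability Om R) (B : R -> Om -> R).
Hypothesis hB : two_sided_brownian_motion P B.
Context (g a : R -> R) (T C eps : R) (Y : R -> Om -> R).
Hypothesis hg : lebesgue_measure.-integrable `[0, +oo[ (EFin \o g).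
Hypothesis hga : trawl_from_kernel g a.
Hypothesis ha : trawl_function a.
Hypothesis hY : forall t, 0 <= t <= T -> is_wiener_integral P B (moving_average_kernel g t) (Y t).
Hypothesis harea : forall h, 0 <= h -> tail_area a 0 - tail_area a h <= C * h `^ (1 / 2 + eps / 2).
Local Notation mu := (@lebesgue_measure R).

Lemma measurable_moving_average_kernel t : measurable_fun setT (moving_average_kernel g t).
Proof.
rewrite (_ : moving_average_kernel g t = (fun x => half_line g (t - x))); last first.
  by apply/funext => x; rewrite moving_average_half_line.
by have /integrableP[/measurable_EFinP] := integrable_reflect t (integrable_half_line hg).
Qed.

Lemma kernel_covariance s t :
  mu.-integrable setT (EFin \o (fun x => moving_average_kernel g s x * moving_average_kernel g t x)) /\
  \int[mu]_x (moving_average_kernel g s x * moving_average_kernel g t x) = tail_area a `|s - t|.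
Proof.
wlog st : s t / s <= t => [hw|].
  have [|/ltW ts] := leP s t; first exact: hw.
  have [h1 h2] := hw _ _ ts; rewrite distrC -h2.
  have E : (fun x => moving_average_kernel g s x * moving_average_kernel g t x) =
     (fun x => moving_average_kernel g t x * moving_average_kernel g s x).
    by apply/funext => x; rewrite mulrC.
  by rewrite E.
have [h1 h2] := overlap_kernel hga st; split => //.
have ts : 0 <= t - s by rewrite subr_ge0.
by rewrite h2 (overlap_tail_area hga ha ts) distrC ger0_norm.
Qed.

Lemma gaussian_polar k (t th : 'I_k -> R) : (forall j, 0 <= t j <= T) ->
  char_polar P (fun w => \sum_(j < k) th j * Y (t j) w)
    (expR (- (\sum_i \sum_j th i * th j * tail_area a `|t i - t j|) / 2)) 0.
Proof.
move=> ht; pose f j := moving_average_kernel g (t j).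
have HW := wiener_integral_sum hB (index_enum 'I_k) th
  (fun j => measurable_moving_average_kernel (t j)) (fun j => hY (ht j)).
have E x : (\sum_(j < k) th j * f j x) ^+ 2 = \sum_(i < k) \sum_(j < k) th i * th j * (f i x * f j x).
  rewrite expr2 big_distrl/=; apply: eq_bigr => i _.
  by rewrite big_distrr/=; apply: eq_bigr => j _; ring.
have I2 i j : mu.-integrable setT (EFin \o (fun x => th i * th j * (f i x * f j x))).
  exact: (integrableZl measurableT _ (kernel_covariance (t i) (t j)).1).
have I1 i : mu.-integrable setT (EFin \o (fun x => \sum_(j < k) th i * th j * (f i x * f j x))).
  exact: (@integrable_bigsum _ _ (measurableTypeR R) mu _ _ _ (I2 i)).
have I0 : mu.-integrable setT (EFin \o (fun x => (\sum_(j < k) th j * f j x) ^+ 2)).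
  rewrite (_ : EFin \o _ = EFin \o (fun x => \sum_(i < k) \sum_(j < k) th i * th j * (f i x * f j x))).
    exact: (@integrable_bigsum _ _ (measurableTypeR R) mu _ _ _ I1).
  by apply/funext => x; rewrite /= E.
have -> : \sum_i \sum_j th i * th j * tail_area a `|t i - t j| =
    \int[mu]_x ((\sum_(j < k) th j * f j x) ^+ 2).
  under [RHS]eq_Rintegral do rewrite E.
  rewrite (Rintegral_sum _ I1); apply: eq_bigr => i _.
  rewrite (Rintegral_sum _ (I2 i)); apply: eq_bigr => j _.
  by rewrite (RintegralZl _ measurableT (kernel_covariance (t i) (t j)).1) (kernel_covariance _ _).2.
apply: (wiener_integral_polar hB _ I0 HW).
by apply: measurable_sum => j; apply: measurable_funM => //; exact: measurable_moving_average_kernel.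
Qed.

Let mY t : 0 <= t <= T -> measurable_fun setT (Y t). Proof. by move=> /hY[]. Qed.

(** The variance of [Y t - Y s]. *)
Let gap (s t : R) : R := 2 * (tail_area a 0 - tail_area a `|t - s|).

Let cos_increment s t z : 0 <= s <= T -> 0 <= t <= T ->
  \int[P]_w cos (z * (Y t w - Y s w)) = expR (- (z ^+ 2 * gap s t / 2)).
Proof.
move=> hs ht; pose tt (j : 'I_2) := if j == ord0 then s else t.
have htt j : 0 <= tt j <= T by rewrite /tt; case: ifP.
have [+ _] := gaussian_polar (fun j => if j == ord0 then - z else z) htt.
rewrite !big_ord_recl !big_ord0 /tt /= cos0 mulr1 !subrr normr0 !addr0 (distrC s t) => E.
transitivity (expR (- (- z * - z * tail_area a 0 + - z * z * tail_area a `|t - s| +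
     (z * - z * tail_area a `|t - s| + z * z * tail_area a 0)) / 2)).
  rewrite -E; apply: eq_Rintegral => w _; rewrite !big_ord_recl big_ord0/= addr0; congr cos; ring.
by congr expR; rewrite /gap; field.
Qed.

Let gap_ge0 s t : 0 <= gap s t.
Proof.
rewrite /gap mulr_ge0//; have [b1 _] := andP (tail_area_diff ha (lexx 0) (normr_ge0 (t - s))).
by rewrite (le_trans _ b1)// subr0 mulr_ge0//; case: ha => + _ _; exact.
Qed.

Let gap_le s t : gap s t <= 2 * C * `|t - s| `^ (1 / 2 + eps / 2).
Proof. by rewrite /gap -mulrA ler_wpM2l// harea. Qed.

(** The mixed bound with both variables equal. The Gaussian value is [3 * gap ^ 2]; only the order
    in the variance matters. *)
Let fourth_moment s t : 0 <= s <= T -> 0 <= t <= T ->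
  (\int[P]_w ((Y t w - Y s w) ^+ 2 * (Y t w - Y s w) ^+ 2)%:E <= (8 * gap s t ^+ 2)%:E)%E.
Proof.
move=> hs ht; rewrite (_ : 8 * _ = 4 * (2 * gap s t ^+ 2)); last by ring.
have mU : measurable_fun setT (fun w => Y t w - Y s w) by apply: measurable_funB; exact: mY.
apply: (@mixed_moment_bound _ _ _ P _ _ _ 0) => // z _.
have E2 : \int[P]_w cos (z * (Y t w - Y s w + (Y t w - Y s w))) = expR (- ((2 * z) ^+ 2 * gap s t / 2)).
  by rewrite -cos_increment//; apply: eq_Rintegral => w _; congr cos; ring.
have E0 : \int[P]_w cos (z * (Y t w - Y s w - (Y t w - Y s w))) = 1.
  by rewrite -[RHS](Rintegral_prob_cst P); apply: eq_Rintegral => w _; rewrite subrr mulr0 cos0.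
rewrite E2 E0 cos_increment// mul0r addr0.
have g0 := gap_ge0 s t; set x := z ^+ 2 * gap s t / 2.
have x0 : 0 <= x by rewrite divr_ge0// mulr_ge0// sqr_ge0.
have -> : (2 * z) ^+ 2 * gap s t / 2 = 4 * x by rewrite /x; field.
have -> : 2 * gap s t ^+ 2 * z ^+ 4 = 8 * x ^+ 2 by rewrite /x; field.
have h1 := expR_ge1Dx (- x); have h2 : expR (- (4 * x)) <= 1 - 4 * x + (4 * x) ^+ 2.
  by apply: expRN_le; rewrite mulr_ge0.
have -> : 8 * x ^+ 2 = (4 * x) ^+ 2 / 2 by field.
lra.
Qed.

(** The product is bounded by half the sum of the fourth powers, so no correlation of adjacent
    increments is needed; squaring the area bound gives the exponent [1 + eps]. *)
Lemma gaussian_three_point r s t : 0 <= r -> r <= s -> s <= t -> t <= T -> 0 <= C -> 0 < eps ->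
  (\int[P]_w ((Y s w - Y r w) ^+ 2 * (Y t w - Y s w) ^+ 2)%:E <=
    (32 * C ^+ 2 * (t - r) `^ (1 + eps))%:E)%E.
Proof.
move=> r0 rs st tT C0 e0.
have hr : 0 <= r <= T by rewrite r0 (le_trans rs)// (le_trans st).
have hs : 0 <= s <= T by rewrite (le_trans r0 rs) (le_trans st).
have ht : 0 <= t <= T by rewrite tT (le_trans r0)// (le_trans rs).
have mU u v : 0 <= u <= T -> 0 <= v <= T -> measurable_fun setT (fun w => (Y v w - Y u w) ^+ 2 : R).
  by move=> hu hv; apply: measurable_funX; apply: measurable_funB; exact: mY.
have mU4 u v : 0 <= u <= T -> 0 <= v <= T ->
    measurable_fun setT (fun w => ((Y v w - Y u w) ^+ 2 * (Y v w - Y u w) ^+ 2)%:E : \bar R).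
  by move=> hu hv; apply/measurable_EFinP; apply: measurable_funM; exact: mU.
have sq4 (x : R) : 0 <= x ^+ 2 * x ^+ 2 by rewrite mulr_ge0 ?sqr_ge0.
rewrite (@le_trans _ _ (\int[P]_w ((2^-1)%:E * (((Y s w - Y r w) ^+ 2 * (Y s w - Y r w) ^+ 2)%R%:E +
   ((Y t w - Y s w) ^+ 2 * (Y t w - Y s w) ^+ 2)%R%:E)))%E)//.
  apply: ge0_le_integral => //.
  - by move=> w _; rewrite lee_fin mulr_ge0 ?sqr_ge0.
  - by apply/measurable_EFinP; apply: measurable_funM; exact: mU.
  - by apply: measurable_funeM; apply: emeasurable_funD; exact: mU4.
  - move=> w _; rewrite -EFinD -EFinM lee_fin.
    set x := (_ ^+ 2); set y := (_ ^+ 2); have := sqr_ge0 (x - y); rewrite sqrrB; lra.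
rewrite ge0_integralZl//; last 2 first.
- by apply: emeasurable_funD; exact: mU4.
- by move=> w _; rewrite -EFinD lee_fin addr_ge0.
rewrite ge0_integralD//; last 4 first.
- by move=> w _; rewrite lee_fin.
- exact: mU4.
- by move=> w _; rewrite lee_fin.
- exact: mU4.
have bnd u v : 0 <= u <= T -> 0 <= v <= T -> u <= v -> v - u <= t - r ->
    (\int[P]_w ((Y v w - Y u w) ^+ 2 * (Y v w - Y u w) ^+ 2)%:E <= (32 * C ^+ 2 * (t - r) `^ (1 + eps))%:E)%E.
  move=> hu hv uv vu; rewrite (le_trans (fourth_moment hu hv))// lee_fin.
  have tr : 0 <= t - r by lra.
  have p0 : 0 < 1 / 2 + eps / 2 by lra.
  rewrite (_ : 1 + eps = (1 / 2 + eps / 2) * 2%:R); last by field.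
  rewrite powRrM powR_mulrn ?powR_ge0//.
  have h : gap u v <= 2 * C * (t - r) `^ (1 / 2 + eps / 2).
    rewrite (le_trans (gap_le u v))// ler_wpM2l// ?mulr_ge0//.
    by rewrite ger0_norm ?subr_ge0//; apply: ge0_ler_powR; rewrite ?nnegrE//; lra.
  rewrite (_ : 32 * _ * _ = 8 * (2 * C * (t - r) `^ (1 / 2 + eps / 2)) ^+ 2); last by ring.
  by rewrite ler_wpM2l// ler_pXn2r ?nnegrE// (le_trans _ h).
rewrite (@le_trans _ _ ((2^-1)%:E * ((32 * C ^+ 2 * (t - r) `^ (1 + eps))%R%:E + (32 * C ^+ 2 * (t - r) `^ (1 + eps))%R%:E))%E)//.
  rewrite lee_wpmul2l ?lee_fin ?invr_ge0//; apply: leeD; apply: bnd => //; lra.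
by rewrite -EFinD -EFinM lee_fin; lra.
Qed.

Lemma gaussian_fourth_moment s t : 0 <= s -> s <= t -> t <= T -> 0 <= C ->
  (\int[P]_w ((Y t w - Y s w) ^+ 2 * (Y t w - Y s w) ^+ 2)%:E <=
    (32 * C ^+ 2 * (t - s) `^ (1 + eps))%:E)%E.
Proof.
move=> s0 st tT C0.
have hs : 0 <= s <= T by rewrite s0 (le_trans st).
have ht : 0 <= t <= T by rewrite tT (le_trans s0).
rewrite (le_trans (fourth_moment hs ht))// lee_fin.
rewrite (_ : 1 + eps = (1 / 2 + eps / 2) * 2%:R); last by field.
rewrite powRrM powR_mulrn ?powR_ge0//.
rewrite (_ : 32 * _ * _ = 8 * (2 * C * (t - s) `^ (1 / 2 + eps / 2)) ^+ 2); last by ring.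
have h := gap_le s t; rewrite ger0_norm ?subr_ge0// in h.
by rewrite ler_wpM2l// ler_pXn2r ?nnegrE// (le_trans _ h).
Qed.

Lemma gaussian_second_moment t : 0 <= t <= T ->
  (\int[P]_w (Y t w ^+ 2)%:E <= (tail_area a 0)%:E)%E.
Proof.
move=> ht; rewrite (_ : tail_area a 0 = 2 * (tail_area a 0 / 2)); last by field.
apply: (@second_moment_bound _ _ _ P _ _ 0) => [|z _]; first exact: mY.
have [+ _] := @gaussian_polar 1 (fun=> t) (fun=> z) (fun=> ht).
rewrite !big_ord_recl !big_ord0 !addr0 cos0 mulr1 subrr normr0 => E.
have -> : \int[P]_w cos (z * Y t w) = expR (- (z * z * tail_area a 0) / 2).
  by rewrite -E; apply: eq_Rintegral => w _; rewrite big_ord_recl big_ord0 addr0.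
have := expR_ge1Dx (- (z * z * tail_area a 0) / 2); rewrite mul0r addr0; lra.
Qed.

End GaussianProcess.

(** * The trawl processes *)

Section TrawlProcess.
Context {R : realType} (a : R -> R).
Hypothesis ha : trawl_function a.
Local Notation plane := (measurableTypeR R * measurableTypeR R)%type.

(** The set function [leb2] with its measure structure, as required by the sums over atoms. *)
Definition leb2_measure : {measure set plane -> \bar R} :=
  (@lebesgue_measure R \x @lebesgue_measure R)%E.

Lemma area_trawl_overlap s t :
  fine (leb2_measure (shifted_trawl_set a s `&` shifted_trawl_set a t)) = tail_area a `|s - t|.
Proof.
have h u v : u <= v -> fine (leb2_measure (shifted_trawl_set a u `&` shifted_trawl_set a v)) = tail_area a `|u - v|.
  by move=> uv; rewrite -[leb2_measure _]/(leb2 _) area_shifted_trawl_setI//= distrC ger0_norm ?subr_ge0.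
have [st|/ltW ts] := leP s t; first exact: h.
by rewrite setIC distrC h.
Qed.

Context d {Om : measurableType d} (P : probability Om R) (L : set plane -> Om -> R) (gamma b : R)
  (nu : {measure set (measurableTypeR R) -> \bar R}) (T : R) (X : R -> Om -> R).
Hypothesis hL : levy_basis P L gamma b nu.
Hypothesis mX : forall t, 0 <= t <= T -> measurable_fun setT (X t).
Hypothesis hX : forall t, 0 <= t <= T -> {ae P, forall w, X t w = L (shifted_trawl_set a t) w}.

Definition trawl_center : R := levy_mean nu gamma * tail_area a 0.

Let mass k (t : 'I_k -> R) := atom_mass leb2_measure (fun j => shifted_trawl_set a (t j)).

Let mA k (t : 'I_k -> R) j : measurable (shifted_trawl_set a (t j)).
Proof. exact: measurable_shifted_trawl_set. Qed.

Let fA k (t : 'I_k -> R) j : (leb2_measure (shifted_trawl_set a (t j)) < +oo)%E.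
Proof. by case: (finite_borel_shifted_trawl_set ha (t j)). Qed.

Lemma trawl_polar k (t : 'I_k -> R) : (forall j, 0 <= t j <= T) ->
  centered_polar P nu gamma b (fun j w => X (t j) w - trawl_center) (mass t).
Proof.
move=> ht th.
have H := levy_basis_joint_polar hL th (fun j => finite_borel_shifted_trawl_set ha (t j)).
have mS : measurable_fun setT (fun w => \sum_(j < k) th j * X (t j) w).
  by apply: measurable_sum => j; apply: measurable_funM => //; exact: mX.
have mL : measurable_fun setT (fun w => \sum_(j < k) th j * L (shifted_trawl_set a (t j)) w).
  case: hL => mL _ _ _; apply: measurable_sum => j; apply: measurable_funM => //.
  exact/mL/finite_borel_shifted_trawl_set.
have aeS : {ae P, forall w, \sum_(j < k) th j * L (shifted_trawl_set a (t j)) w =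
    \sum_(j < k) th j * X (t j) w}.
  have : {ae P, forall w, forall j, X (t j) w = L (shifted_trawl_set a (t j)) w}.
    by apply: filter_forall => j; exact: hX.
  by apply: filterS => w h; apply: eq_bigr => j _; rewrite h.
have H' := char_polar_shift (\sum_(j < k) th j * trawl_center) mS (ae_char_polar mL mS aeS H).
have E : \sum_S mass t S * (im_exponent gamma nu (\sum_(j in S) th j) -
      levy_mean nu gamma * \sum_(j in S) th j) =
    \sum_S mass t S * im_exponent gamma nu (\sum_(j in S) th j) - \sum_(j < k) th j * trawl_center.
  under eq_bigr do rewrite mulrBr; rewrite sumrB; congr (_ - _).
  under eq_bigr do rewrite mulrCA.
  rewrite -mulr_sumr (sum_atom_mass_linear (mA t) (fA t)) mulr_sumr; apply: eq_bigr => j _.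
  by rewrite -[X in leb2_measure X]setIid area_trawl_overlap subrr normr0 mulrCA.
rewrite E; case: H' => Hc Hs; split; [apply: etrans Hc|apply: etrans Hs];
  by apply: eq_Rintegral => w _; congr (_ _); rewrite -sumrB; apply: eq_bigr => j _; rewrite mulrBr.
Qed.

Hypothesis i2 : nu.-integrable setT (EFin \o (fun x : R => x ^+ 2)).
Hypothesis i3 : nu.-integrable setT (EFin \o (fun x : R => `|x| ^+ 3)).
Hypothesis i4 : nu.-integrable setT (EFin \o (fun x : R => x ^+ 4)).

Let v2 := b ^+ 2 / 2 + \int[nu]_x (x ^+ 2).
Let M4 := \int[nu]_x (x ^+ 4).

Let mZ k (t : 'I_k -> R) : (forall j, 0 <= t j <= T) ->
  forall j, measurable_fun setT (fun w => X (t j) w - trawl_center).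
Proof. by move=> ht j; apply: measurable_funB => //; exact: mX. Qed.

Lemma trawl_second_moment t : 0 <= t <= T ->
  (\int[P]_w ((X t w - trawl_center) ^+ 2)%:E <= (2 * (v2 * tail_area a 0))%:E)%E.
Proof.
move=> ht; have ht' (j : 'I_1) : 0 <= (fun=> t) j <= T by [].
have := family_second_moment (mZ ht') (atom_mass_ge0 _ _) i2 i3 (trawl_polar ht') (fun=> 1).
rewrite (sum_atom_mass_square (mA _) (fA _)) !big_ord_recl !big_ord0 !addr0 !mul1r.
rewrite area_trawl_overlap subrr normr0; apply: le_trans.
by under [leRHS]eq_integral do rewrite big_ord_recl big_ord0 addr0 mul1r.
Qed.

Lemma trawl_mean t : 0 <= t <= T -> 'E_P[X t]%E = trawl_center%:E.
Proof.
move=> ht; have ht' (j : 'I_1) : 0 <= (fun=> t) j <= T by [].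
have h := family_mean (mZ ht') (atom_mass_ge0 _ _) i2 i3 (trawl_polar ht') (fun=> 1).
have iZ : P.-integrable setT (EFin \o (fun w => X t w - trawl_center)).
  apply: square_integrable; first by apply: measurable_funB => //; exact: mX.
  by rewrite (le_lt_trans (trawl_second_moment ht))// ltry.
have ic := bounded_rv_integrable P (@bounded_rv_cst _ _ Om trawl_center).
rewrite unlock.
have E : (\int[P]_w (X t w)%:E = \int[P]_w (((X t w - trawl_center)%:E + (cst trawl_center w)%:E)))%E.
  by apply: eq_integral => w _; rewrite -EFinD /cst subrK.
rewrite E integralD_EFin//.
have -> : (\int[P]_w (X t w - trawl_center)%:E = 0)%E.
  rewrite -[LHS]fineK ?(integrable_fin_num measurableT)//; congr EFin; rewrite -[RHS]h.
  by apply: eq_Rintegral => w _; rewrite big_ord_recl big_ord0 addr0 mul1r.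
rewrite add0e -[LHS]fineK ?(integrable_fin_num measurableT)//.
by congr EFin; exact: (Rintegral_prob_cst P).
Qed.

Lemma trawl_three_point r s t : 0 <= r -> r <= s -> s <= t -> t <= T ->
  (\int[P]_w ((X s w - X r w) ^+ 2 * (X t w - X s w) ^+ 2)%:E <=
   (4 * (M4 * fine (leb2 ((shifted_trawl_set a s `\` shifted_trawl_set a t) `\` shifted_trawl_set a r)) +
     4 * (v2 * (2 * (tail_area a 0 - tail_area a (s - r)) + 2 * (tail_area a 0 - tail_area a (t - s)))) ^+ 2))%:E)%E.
Proof.
move=> r0 rs st tT.
pose tt (j : 'I_3) := nth 0 [:: r; s; t] j.
have htt j : 0 <= tt j <= T by case: j => -[|[|[|//]]] j3; rewrite /tt /=; apply/andP; split; lra.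
pose j0 : 'I_3 := Ordinal (isT : (0 < 3)%N); pose j1 : 'I_3 := Ordinal (isT : (1 < 3)%N).
pose j2 : 'I_3 := Ordinal (isT : (2 < 3)%N).
have := family_mixed_moment (mZ htt) (atom_mass_ge0 _ _) i2 i3 i4 (trawl_polar htt)
  (increment j0 j1) (increment j1 j2).
have -> : (\int[P]_w ((\sum_(j < 3) increment j0 j1 j * (X (tt j) w - trawl_center)) ^+ 2 *
    (\sum_(j < 3) increment j1 j2 j * (X (tt j) w - trawl_center)) ^+ 2)%:E =
   \int[P]_w ((X s w - X r w) ^+ 2 * (X t w - X s w) ^+ 2)%:E)%E.
  apply: eq_integral => w _; rewrite !sum_increment.
  have sub u v c : u - c - (v - c) = u - v :> R by rewrite opprB addrA subrK.
  by rewrite !sub.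
move=> H; apply: (le_trans H); rewrite -/v2 -/M4 lee_fin le_eqVlt; apply/orP; left; apply/eqP.
congr (4 * (M4 * _ + 4 * (v2 * _) ^+ 2)).
  transitivity (\sum_S mass tt S * (((j1 \in S)%:R - (j0 \in S)%:R) ^+ 2 * ((j2 \in S)%:R - (j1 \in S)%:R) ^+ 2)).
    by apply: eq_bigr => S _; rewrite !sum_increment_mem.
  (* For [r <= s <= t] a point of both [A_r] and [A_t] lies in [A_s], since [a] is non-increasing;
     one of the two areas is therefore 0. *)
  rewrite (sum_atom_mass_mixed (mA tt) (fA tt)) (_ : (_ `&` _) `\` _ = set0).
    by rewrite measure0 addr0.
  apply/seteqP; split => p // [[/in_shifted_trawl_set[p1 p2] /in_shifted_trawl_set[p3 p4]]].
  apply; apply/in_shifted_trawl_set; split; first exact: le_trans rs.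
  move: p2 p4 => /andP[-> p2] /andP[_ p4]; rewrite (le_trans p4)//.
  by case: ha => _ am _; apply: am; rewrite ?subr_ge0 ?lerD2r// (le_trans p1 rs).
transitivity (\sum_S mass tt S * ((j1 \in S)%:R - (j0 \in S)%:R) ^+ 2 +
    \sum_S mass tt S * ((j2 \in S)%:R - (j1 \in S)%:R) ^+ 2).
  by rewrite -big_split; apply: eq_bigr => S _; rewrite !sum_increment_mem mulrDr.
rewrite (sum_atom_mass_diff (mA tt) (fA tt) j0 j1) (sum_atom_mass_diff (mA tt) (fA tt) j1 j2).
have self u : fine (leb2_measure (shifted_trawl_set a u)) = tail_area a 0.
  by rewrite -[X in leb2_measure X]setIid area_trawl_overlap subrr normr0.
change (tt j0) with r; change (tt j1) with s; change (tt j2) with t.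
rewrite (self r) (self s) (self t) (area_trawl_overlap r s) (area_trawl_overlap s t) (distrC r s) (distrC s t).
rewrite (ger0_norm (_ : 0 <= s - r)) ?subr_ge0// (ger0_norm (_ : 0 <= t - s)) ?subr_ge0//.
by rewrite !mulrBr !mulr_natl !mulr2n.
Qed.

End TrawlProcess.

(** * Convergence in law in the Skorokhod space *)

Section LowerIntegral.
Context {R : realType} d {T : measurableType d}.
Local Open Scope ereal_scope.

(* Neither function is assumed measurable: the integral of a nonnegative
   function is a supremum over the simple functions below it. *)
Lemma le_integral_pointwise (mu : {measure set T -> \bar R}) (f h : T -> \bar R) :
  (forall x, f x <= h x) -> \int[mu]_x f x <= \int[mu]_x h x.
Proof.
have nn (f1 f2 : T -> \bar R) : (forall x, 0 <= f1 x) -> (forall x, f1 x <= f2 x) ->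
    \int[mu]_x f1 x <= \int[mu]_x f2 x.
  move=> f10 f12; rewrite !ge0_integralTE//; last by move=> x; exact: le_trans (f12 x).
  by apply: ereal_sup_le => _ /= [s sf <-]; exists s => // x; exact: le_trans (sf x) (f12 x).
move=> fh; rewrite integralE [leRHS]integralE; apply: leeB; apply: nn => // x.
  by rewrite !funeposE ge_max !le_max lexx orbT fh.
by rewrite !funenegE ge_max !le_max lexx orbT leeN2 fh.
Qed.

End LowerIntegral.

(** * Bounded integrands without measurability *)

Section BoundedIntegral.
Context {R : realType} d {T : measurableType d} (P : probability T R).

Lemma bounded_integral_fin_num (h : T -> R) (M : R) : (forall w, `|h w| <= M) ->
  (\int[P]_w (h w)%:E)%E \is a fin_num.
Proof.
move=> hM; have [M0|M0] := leP 0 M; last first.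
  rewrite (_ : (fun w => (h w)%:E) = (fun=> 0%E)) ?integral0//; apply/funext => w.
  by have := le_lt_trans (le_trans (normr_ge0 _) (hM w)) M0; rewrite ltxx.
have c (z : R) : (\int[P]_w z%:E = z%:E)%E.
  rewrite -[LHS]fineK; first by congr EFin; exact: (Rintegral_prob_cst P).
  by apply: (integrable_fin_num measurableT); exact: (bounded_rv_integrable P (bounded_rv_cst z)).
rewrite fin_numE; apply/andP; split.
  rewrite -ltNye (@lt_le_trans _ _ (- M)%:E)// ?ltNyr// -(c (- M)).
  by apply: le_integral_pointwise => w; rewrite lee_fin; have := hM w; rewrite ler_norml => /andP[].
rewrite -ltey (@le_lt_trans _ _ M%:E)// ?ltry// -(c M).
by apply: le_integral_pointwise => w; rewrite lee_fin; have := hM w; rewrite ler_norml => /andP[].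
Qed.

Lemma le_Rintegral_pointwise (f h : T -> R) (M : R) : (forall w, `|f w| <= M) -> (forall w, `|h w| <= M) ->
  (forall w, f w <= h w) -> \int[P]_w f w <= \int[P]_w h w.
Proof.
move=> fM hM fh; apply: fine_le; try exact: bounded_integral_fin_num.
by apply: le_integral_pointwise => w; rewrite lee_fin.
Qed.

(** The integral is by definition a difference of integrals of the positive and negative parts,
    which negation exchanges; boundedness keeps both finite. *)
Lemma Rintegral_oppr (h : T -> R) (M : R) : (forall w, `|h w| <= M) ->
  \int[P]_w (- h w) = - \int[P]_w h w.
Proof.
move=> hM; rewrite /Rintegral -fineN; congr fine.
have bnd (u : T -> R) : (forall w, `|u w| <= M) -> (\int[P]_w (Num.max (u w) 0)%:E \is a fin_num)%E.
  move=> uM; apply: (@bounded_integral_fin_num _ M) => w; rewrite ger0_norm ?le_max ?lexx ?orbT//.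
  by rewrite ge_max (le_trans (ler_norm _) (uM w)) (le_trans _ (uM w)).
have hp (u : T -> R) : (fun w => ((fun w => (u w)%:E)^\+ w)%E) = (fun w => (Num.max (u w) 0)%:E).
  by apply/funext => w; rewrite funeposE/= EFin_max.
have hn (u : T -> R) : (fun w => ((fun w => (u w)%:E)^\- w)%E) = (fun w => (Num.max (- u w) 0)%:E).
  by apply/funext => w; rewrite funenegE/= EFin_max.
have hM' w : `|- h w| <= M by rewrite normrN.
rewrite integralE [in RHS]integralE !hp !hn fin_num_oppeB ?bnd//.
by rewrite [RHS]addeC; congr (_ - _)%E; apply: eq_integral => w _; rewrite opprK.
Qed.

End BoundedIntegral.

(** * Lipschitz minorants of a Skorokhod-continuous functional *)

Section InfConvolution.
Context {R : realType} (T : R) (F : (R -> R) -> R) (M : R).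
Hypothesis FM : forall x, cadlag T x -> `|F x| <= M.
Hypothesis T0 : 0 < T.

Lemma skorokhod_dist_le_sup (x y : R -> R) (e : R) : 0 <= e -> (forall t, 0 <= t <= T -> `|x t - y t| <= e) ->
  skorokhod_dist T x y <= e.
Proof.
move=> e0 H; apply: ge_inf; first by exists 0 => z [].
split => //; exists id; first by split => //; apply: continuous_subspaceT => z; exact: cvg_id.
by move=> t ht; rewrite subrr normr0; split => //; exact: H.
Qed.

(* [inf_conv] is a minorant of [F] that is Lipschitz for the uniform norm; the
   value [M] keeps the infimum finite for paths which no cadlag path approximates
   uniformly. *)
Definition inf_conv_set (m : R) (x : R -> R) : set R :=
  [set z | z = M \/ exists y e, [/\ cadlag T y, 0 <= e, (forall t, 0 <= t <= T -> `|x t - y t| <= e) &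
    z = F y + m * e]].

Definition inf_conv m x : R := inf (inf_conv_set m x).

Hypothesis M0 : 0 <= M.

Let lower (m : R) (x : R -> R) (z : R) : 0 <= m -> inf_conv_set m x z -> - M <= z.
Proof.
move=> m0 [->|[y [e [cy e0 _ ->]]]]; first by rewrite (le_trans _ M0)// oppr_le0.
have := FM cy; rewrite ler_norml => /andP[h _]; have := mulr_ge0 m0 e0; lra.
Qed.

Let has_inf_set (m : R) x : 0 <= m -> has_inf (inf_conv_set m x).
Proof. by move=> m0; split; [exists M; left|exists (- M) => z; exact: lower]. Qed.

Lemma norm_inf_conv (m : R) x : 0 <= m -> `|inf_conv m x| <= M.
Proof.
move=> m0; rewrite ler_norml; apply/andP; split.
  by apply: lb_le_inf; [exists M; left|move=> z; exact: lower].
by apply: ge_inf; [exists (- M) => z; exact: lower|left].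
Qed.

Lemma inf_conv_le (m : R) x : 0 <= m -> cadlag T x -> inf_conv m x <= F x.
Proof.
move=> m0 cx; apply: ge_inf; first by exists (- M) => z; exact: lower.
right; exists x, 0; split => //; last by rewrite mulr0 addr0.
by move=> t _; rewrite subrr normr0.
Qed.

(** Neither path is required to be cadlag, so the bound applies directly to [step_path]. *)
Lemma inf_conv_lipschitz (m : R) x x' (del : R) : 0 <= m -> 0 <= del ->
  (forall t, 0 <= t <= T -> `|x t - x' t| <= del) -> inf_conv m x <= inf_conv m x' + m * del.
Proof.
move=> m0 d0 H; rewrite -lerBlDr; apply: lb_le_inf; first by exists M; left.
have lbx : has_lbound (inf_conv_set m x) by exists (- M) => z; exact: lower.
move=> z [->|[y [e [cy e0 He ->]]]]; rewrite lerBlDr.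
  by rewrite (@le_trans _ _ M)//; [apply: ge_inf => //; left|rewrite lerDl mulr_ge0].
rewrite -addrA -mulrDr; apply: ge_inf => //; right; exists y, (e + del); split => //.
  exact: addr_ge0.
move=> t ht; rewrite (le_trans (ler_distD (x' t) _ _))// addrC lerD//; [exact: He|exact: H].
Qed.

Lemma inf_conv_cvg x : skorokhod_continuous T F -> cadlag T x ->
  inf_conv m%:R x @[m --> \oo] --> F x.
Proof.
move=> cF cx; apply/cvgrPdist_le => /= e e0.
have [del del0 H] := cF x cx e e0.
near=> m; have m0 : 0 <= m%:R :> R by [].
(* Competitors [y] farther than [del / 2] cost at least [2 * M] and cannot go below [F x]; the
   nearer ones are within [del] in the Skorokhod distance, where continuity applies. *)
have hm : 2 * M <= m%:R * (del / 2).
  rewrite -ler_pdivrMr ?divr_gt0//.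
  have h : (Num.truncn (2 * M / (del / 2)) < m)%N by near: m; exact: nbhs_infty_gt.
  by rewrite (le_trans (ltW (truncnS_gt _)))// ler_nat.
have h1 := inf_conv_le m0 cx.
rewrite ger0_norm ?subr_ge0// lerBlDl -lerBlDr.
apply: lb_le_inf; first by exists M; left.
have := FM cx; rewrite ler_norml => /andP[F1 F2].
move=> z [->|[y [e' [cy e'0 He ->]]]]; first lra.
have := FM cy; rewrite ler_norml => /andP[F3 F4].
have [ed|de] := leP e' (del / 2).
  have : `|F x - F y| < e.
    apply: H => //; rewrite (le_lt_trans (skorokhod_dist_le_sup e'0 He))//; lra.
  rewrite ltr_norml => /andP[_ h]; have := mulr_ge0 m0 e'0; lra.
have : m%:R * (del / 2) <= m%:R * e' by rewrite ler_wpM2l// ltW.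
lra.
Unshelve. all: by end_near. Qed.

End InfConvolution.

(** * Step approximations on a uniform grid *)

Section StepFunctional.
Context {R : realType} (T : R) (F : (R -> R) -> R) (M : R) (k : nat).
Hypothesis FM : forall x, cadlag T x -> `|F x| <= M.
Hypothesis M0 : 0 <= M.
Hypothesis T0 : 0 < T.
Hypothesis k0 : (0 < k)%N.

(** There are [k + 1] values because [t = T] has index [k]. *)
Definition step_path (u : 'I_k.+1 -> R) (t : R) : R := u (inord (Num.truncn (k%:R * t / T))).

Definition step_functional (m : R) (u : 'I_k.+1 -> R) : R := inf_conv T F M m (step_path u).

Lemma step_functional_lipschitz (m : R) : 0 <= m -> lipschitz_l1 m (step_functional m).
Proof.
move=> m0; have H u v : step_functional m u <= step_functional m v + m * \sum_(j < k.+1) `|u j - v j|.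
  apply: inf_conv_lipschitz => //; first by apply: sumr_ge0.
  move=> t _; rewrite /step_path (bigD1 (inord (Num.truncn (k%:R * t / T))))//= lerDl.
  by apply: sumr_ge0.
move=> u v; rewrite ler_norml; apply/andP; split; last by rewrite lerBlDl; exact: H.
rewrite lerNl opprB lerBlDl (le_trans (H v u))// lerD2l ler_wpM2l//.
by apply: ler_sum => j _; rewrite distrC.
Qed.

Lemma truncn_grid (t : R) : 0 <= t <= T -> (Num.truncn (k%:R * t / T) <= k)%N.
Proof.
move=> /andP[t0 tT].
have h : k%:R * t / T <= k%:R by rewrite ler_pdivrMr// ler_wpM2l.
have u0 : 0 <= k%:R * t / T by rewrite divr_ge0 ?mulr_ge0// ltW.
by rewrite -(ler_nat R) (le_trans _ h)//; have /andP[] := truncn_itv u0.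
Qed.

Lemma step_path_grid (x : R -> R) (t : R) : 0 <= t <= T ->
  step_path (fun j : 'I_k.+1 => x (grid T k j)) t = x (grid T k (Num.truncn (k%:R * t / T))).
Proof. by move=> ht; rewrite /step_path inordK// ltnS truncn_grid. Qed.

Lemma step_functional_close (m : R) (x : R -> R) (del : R) : 0 <= m -> 0 <= del ->
  (forall t, 0 <= t <= T -> `|x t - x (grid T k (Num.truncn (k%:R * t / T)))| <= del) ->
  `|step_functional m (fun j => x (grid T k j)) - inf_conv T F M m x| <= m * del.
Proof.
move=> m0 d0 H; rewrite ler_norml; apply/andP; split.
  rewrite lerNl opprB lerBlDl; apply: inf_conv_lipschitz => // t ht.
  by rewrite step_path_grid//; exact: H.
rewrite lerBlDl; apply: inf_conv_lipschitz => // t ht.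
by rewrite step_path_grid// distrC; exact: H.
Qed.

End StepFunctional.

Section OscillationFunctional.
Context {R : realType} (k : nat) (lam : R).
Hypothesis l0 : 0 < lam.

(* A Lipschitz upper bound of the indicator function of |x| > lam. *)
Definition cutoff (x : R) : R := Num.max 0 (Num.min 1 (2 / lam * `|x| - 1)).

Lemma cutoff_ge0 x : 0 <= cutoff x. Proof. by rewrite le_max lexx. Qed.

Lemma cutoff_le1 x : cutoff x <= 1. Proof. by rewrite ge_max ler01 ge_min lexx. Qed.

Lemma cutoff_eq1 x : lam < `|x| -> 1 <= cutoff x.
Proof.
move=> lx; rewrite le_max; apply/orP; right; rewrite le_min lexx/=.
have : 2 / lam * lam <= 2 / lam * `|x| by rewrite ler_wpM2l ?divr_ge0// ltW.
rewrite divfK ?gt_eqF//; lra.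
Qed.

Lemma cutoff_lipschitz x y : `|cutoff x - cutoff y| <= 2 / lam * `|x - y|.
Proof.
have h u v : cutoff u - cutoff v <= 2 / lam * `|u - v|.
  rewrite lerBlDl /cutoff ge_max; apply/andP; split.
    by rewrite addr_ge0 ?le_max ?lexx// mulr_ge0// divr_ge0// ltW.
  have c0 : 0 <= 2 / lam * `|u - v| by rewrite mulr_ge0// divr_ge0// ltW.
  have : 2 / lam * `|u| <= 2 / lam * `|v| + 2 / lam * `|u - v|.
    rewrite -mulrDr ler_wpM2l ?divr_ge0// ?(ltW l0)//.
    by rewrite -{1}(subrKC v u); exact: ler_normD.
  move=> h1; rewrite ge_min; have [h2|h2] := leP 1 (2 / lam * `|v| - 1).
    by rewrite (_ : Num.max _ _ = 1) ?lerDl ?c0// max_r.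
  apply/orP; right; rewrite (@le_trans _ _ (2 / lam * `|v| - 1 + 2 / lam * `|u - v|))//; first lra.
  by rewrite lerD2r le_max lexx orbT.
rewrite ler_norml h andbT lerNl opprB (distrC x); exact: h.
Qed.

(** The cutoff vanishes for [|x| <= lam / 2], which allows domination by a fourth power. The factor
    [2 ^ 4] becomes the 16 of [bad_bound]. *)
Lemma cutoff_le4 x : cutoff x <= (2 / lam) ^+ 4 * (x ^+ 2 * x ^+ 2).
Proof.
rewrite (_ : _ * (_ * _) = (2 / lam * `|x|) ^+ 4); last first.
  by rewrite exprMn -[x ^+ 2]real_normK ?num_real//; ring.
set u := 2 / lam * `|x|; have u0 : 0 <= u by rewrite mulr_ge0// divr_ge0// ltW.
rewrite ge_max exprn_ge0//= ge_min; have [u1|u1] := leP u 1.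
  by apply/orP; right; rewrite (@le_trans _ _ 0) ?exprn_ge0// subr_le0.
by apply/orP; left; rewrite exprn_ege1// ltW.
Qed.

Definition oscillation (u : 'I_k.+1 -> R) : R :=
  \sum_(i < k) cutoff (u (inord i.+1) - u (inord i)).

Lemma oscillation_lipschitz : lipschitz_l1 (k%:R * (4 / lam)) oscillation.
Proof.
move=> u v; rewrite /oscillation -sumrB (le_trans (ler_norm_sum _ _ _))//.
pose S : R := \sum_(j < k.+1) `|u j - v j|.
have uS j : `|u j - v j| <= S by rewrite /S (bigD1 j)//= lerDl sumr_ge0.
rewrite (@le_trans _ _ (\sum_(i < k) 4 / lam * S))//; last first.
  by rewrite sumr_const card_ord -[leLHS]mulr_natl mulrA lexx.
apply: ler_sum => i _; rewrite (le_trans (cutoff_lipschitz _ _))//.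
rewrite (_ : 4 / lam * S = 2 / lam * (S + S)); last by field; rewrite gt_eqF.
rewrite ler_wpM2l ?divr_ge0// ?(ltW l0)//.
have sub4 (p q r s : R) : p - q - (r - s) = (p - r) - (q - s) by ring.
by rewrite sub4 (le_trans (ler_normB _ _))//; exact: lerD.
Qed.

Lemma oscillation_ge0 u : 0 <= oscillation u.
Proof. by apply: sumr_ge0 => i _; exact: cutoff_ge0. Qed.

Lemma oscillation_le u : oscillation u <= k%:R.
Proof.
rewrite (@le_trans _ _ (\sum_(i < k) 1))//; last by rewrite sumr_const card_ord.
by apply: ler_sum => i _; exact: cutoff_le1.
Qed.

End OscillationFunctional.

(** * Comparison of a process with its grid values *)

Section ProcessApproximation.
Context {R : realType} d {Om : measurableType d} (P : probability Om R) (Z : R -> Om -> R).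
Context (T K eps : R).
Hypothesis T0 : 0 < T.
Hypothesis eps0 : 0 < eps.
Hypothesis K0 : 0 <= K.
Hypothesis cZ : forall w, cadlag T (Z ^~ w).
Hypothesis mZ : forall t, 0 <= t <= T -> measurable_fun setT (Z t).
Hypothesis Z3 : forall r s t, 0 <= r -> r <= s -> s <= t -> t <= T ->
  (\int[P]_w ((Z s w - Z r w) ^+ 2 * (Z t w - Z s w) ^+ 2)%:E <= (K * (t - r) `^ (1 + eps))%:E)%E.

Definition grid_values k w (j : 'I_k.+1) : R := Z (grid T k j) w.

Lemma measurable_grid_values k (j : 'I_k.+1) : (0 < k)%N ->
  measurable_fun setT (fun w => grid_values w j).
Proof. by move=> k0; apply: mZ; apply: grid_mem => //; rewrite -ltnS. Qed.

Definition mesh_bound k lam : R := chain_const K eps / lam ^+ 4 * (k%:R * (T / k%:R) `^ (1 + eps)).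

Lemma bounded_oscillation k lam : (0 < k)%N -> 0 < lam ->
  bounded_rv (fun w => oscillation lam (@grid_values k w)).
Proof.
move=> k0 l0; split.
  apply: (measurable_lipschitz (X := fun j w => @grid_values k w j) (L := k%:R * (4 / lam))).
  - by move=> j; exact: measurable_grid_values.
  - by rewrite mulr_ge0 ?divr_ge0// ltW.
  - exact: oscillation_lipschitz.
by exists k%:R => w; rewrite ger0_norm ?oscillation_ge0 ?oscillation_le.
Qed.

(** The bad event is where the indicator of the event of [modulus] plus the oscillation reaches 1;
    Markov's inequality bounds it by expectations. Using a Lipschitz oscillation rather than an
    indicator lets its mean pass to the limit in [n]. *)
Lemma grid_approximation k lam : (0 < k)%N -> 0 < lam -> exists E, [/\ measurable E,
  fine (P E) <= mesh_bound k lam + \int[P]_w oscillation lam (@grid_values k w) &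
  forall w, ~ E w -> forall t, 0 <= t <= T ->
    `|Z t w - Z (grid T k (Num.truncn (k%:R * t / T))) w| <= 2 * lam].
Proof.
move=> k0 l0.
have rcZ w t : 0 <= t < T -> Z s w @[s --> t^'+] --> Z t w by have [H _] := cZ w; exact: H.
have [E0 [mE0 PE0 HE0]] := modulus T0 eps0 K0 mZ rcZ Z3 k0 l0.
pose Q w := \1_E0 w + oscillation lam (@grid_values k w).
have bo := bounded_oscillation k0 l0.
have bi : bounded_rv (\1_E0 : Om -> R) by exact: bounded_rv_indic.
have bQ : bounded_rv Q by exact: bounded_rvD.
pose E := [set w | 1 <= Q w].
have mE : measurable E.
  rewrite (_ : E = setT `&` Q @^-1` `[1, +oo[); last first.
    by rewrite setTI; apply/seteqP; split => w /=; rewrite in_itv/= andbT.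
  by apply: bQ.1 => //; exact: measurable_itv.
exists E; split => //.
  rewrite -lee_fin fineK ?fin_num_measure//.
  rewrite (le_trans (@prob_le_integral _ _ _ P (EFin \o Q) E mE _ _ _))//.
  - by apply/measurable_EFinP; exact: bQ.1.
  - by move=> w; rewrite lee_fin addr_ge0 ?oscillation_ge0// indicE.
  rewrite -[leLHS]fineK; last by apply: (integrable_fin_num measurableT); exact: bounded_rv_integrable.
  have IQ : fine (\int[P]_w (EFin \o Q) w)%E = \int[P]_w \1_E0 w + \int[P]_w oscillation lam (@grid_values k w).
    exact: (RintegralD measurableT (bounded_rv_integrable P bi) (bounded_rv_integrable P bo)).
  rewrite lee_fin IQ lerD2r Rintegral_indic// -lee_fin fineK ?fin_num_measure//.
move=> w /negP; rewrite -ltNge /Q => Qw.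
have o0 : 0 <= oscillation lam (@grid_values k w) by exact: oscillation_ge0.
have nE0 : ~ E0 w.
  by move=> wE0; move: Qw; rewrite indicE mem_set//= => /(le_lt_trans _) => /(_ 1); rewrite lerDl o0 ltxx => /(_ isT).
apply: HE0 => // i ik.
rewrite leNgt; apply/negP => /(cutoff_eq1 l0) h.
move: Qw; apply/negP; rewrite -leNgt (le_trans h)// /oscillation (bigD1 (Ordinal ik))//=.
rewrite addrCA /grid_values !inordK ?ltnS//; last exact: ltnW.
by rewrite lerDl addr_ge0// ?indicE//; apply: sumr_ge0 => j _; exact: cutoff_ge0.
Qed.

Context (F : (R -> R) -> R) (M : R).
Hypothesis FM : forall x, cadlag T x -> `|F x| <= M.
Hypothesis M0 : 0 <= M.

Lemma bounded_step_functional k m : (0 < k)%N -> 0 <= m ->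
  bounded_rv (fun w => step_functional T F M m (@grid_values k w)).
Proof.
move=> k0 m0; split.
  apply: (measurable_lipschitz (X := fun j w => @grid_values k w j)) m0 (step_functional_lipschitz FM M0 m0).
  by move=> j; exact: measurable_grid_values.
by exists M => w; exact: (norm_inf_conv FM M0 _ m0).
Qed.

(** The measurable function [f] is below [F] at every path: off [E] the step functional exceeds the
    minorant of [F] by at most [2 * m * lam], and on [E] the two differ by at most [2 * M]. *)
Lemma step_functional_lower k lam m : (0 < k)%N -> 0 < lam -> 0 <= m ->
  \int[P]_w step_functional T F M m (@grid_values k w) -
    (2 * m * lam + 2 * M * (mesh_bound k lam + \int[P]_w oscillation lam (@grid_values k w))) <=
  \int[P]_w F (Z ^~ w).
Proof.
move=> k0 l0 m0; have [E [mE PE HE]] := grid_approximation k0 l0.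
have bs := bounded_step_functional k0 m0.
have bi : bounded_rv (\1_E : Om -> R) by exact: bounded_rv_indic.
pose f w := step_functional T F M m (@grid_values k w) + (- (2 * m * lam) + (- (2 * M)) * \1_E w).
have b1 := bounded_rv_cst (T := Om) (- (2 * m * lam)).
have b2 := bounded_rvM (bounded_rv_cst (T := Om) (- (2 * M))) bi.
have b3 := bounded_rvD b1 b2.
have If : \int[P]_w f w = \int[P]_w step_functional T F M m (@grid_values k w) -
    (2 * m * lam + 2 * M * fine (P E)).
  rewrite (RintegralD measurableT (bounded_rv_integrable P bs) (bounded_rv_integrable P b3)).
  rewrite (RintegralD measurableT (bounded_rv_integrable P b1) (bounded_rv_integrable P b2)).
  by rewrite (RintegralZl _ measurableT (bounded_rv_integrable P bi)) Rintegral_indic// Rintegral_prob_cst; ring.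
rewrite (@le_trans _ _ (\int[P]_w f w))//.
  by rewrite If lerD2l lerN2 lerD2l ler_wpM2l// mulr_ge0.
have mn w : 0 <= 2 * m * lam + 2 * M * \1_E w.
  by rewrite addr_ge0// !mulr_ge0// ?(ltW l0) ?indicE.
have fF w : f w <= F (Z ^~ w).
  rewrite /f indicE; case: (boolP (w \in E)) => [_|/negP wE].
    have := norm_inf_conv (T := T) (F := F) FM M0 (step_path T (@grid_values k w)) m0.
    rewrite -/(step_functional T F M m (@grid_values k w)) ler_norml => /andP[_ h].
    have := FM (cZ w); rewrite ler_norml => /andP[h' _].
    have : 0 <= 2 * m * lam by rewrite !mulr_ge0// ltW.
    rewrite mulr1; lra.
  have wE' : ~ E w by move=> h; apply: wE; exact: mem_set.
  have l20 : 0 <= 2 * lam by rewrite mulr_ge0// ltW.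
  have := step_functional_close FM M0 T0 m0 l20 (HE w wE').
  rewrite -/(@grid_values k w) ler_norml => /andP[_ h].
  have := inf_conv_le FM M0 m0 (cZ w); rewrite mulr0 addr0; lra.
pose B := M + (2 * m * lam + 2 * M).
have E1 w : 0 <= (\1_E w : R) <= 1 by rewrite indicE; case: (_ \in _); rewrite ?lexx ler01.
have ml0 : 0 <= 2 * m * lam by rewrite !mulr_ge0// ltW.
apply: (@le_Rintegral_pointwise _ _ _ _ _ _ B) => // w.
  rewrite (le_trans (ler_normD _ _))// lerD//; first exact: (norm_inf_conv FM M0 _ m0).
  rewrite (le_trans (ler_normD _ _))// lerD//; first by rewrite normrN ger0_norm.
  have /andP[e0 e1] := E1 w.
  by rewrite normrM normrN !ger0_norm ?mulr_ge0// ler_piMr// mulr_ge0.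
by rewrite (le_trans (FM (cZ w)))// lerDl addr_ge0// mulr_ge0.
Qed.

End ProcessApproximation.

Section GridLimit.
Context {R : realType} (T K eps : R).
Hypothesis T0 : 0 < T.
Hypothesis eps0 : 0 < eps.
Hypothesis K0 : 0 <= K.

(** The first constant bounds the event of [modulus], the second the mean oscillation when the
    fourth moments of increments are controlled. *)
Definition bad_bound k lam : R :=
  (chain_const K eps + 16 * K) / lam ^+ 4 * (k%:R * (T / k%:R) `^ (1 + eps)).

(** The expression equals [T * (T / k) ^ eps]; [del] solves [T * del ^ eps = e]. *)
Lemma mesh_size_small e : 0 < e -> exists2 k, (0 < k)%N & k%:R * (T / k%:R) `^ (1 + eps) <= e.
Proof.
move=> e0; pose del := (e / T) `^ eps^-1.
have del0 : 0 < del by rewrite powR_gt0// divr_gt0.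
exists (Num.truncn (T / del)).+1 => //; set k := _.+1.
have k0 : 0 < k%:R :> R by rewrite ltr0n.
have h : T / k%:R <= del.
  rewrite ler_pdivrMr// mulrC -ler_pdivrMr//; exact/ltW/truncnS_gt.
have Tk : 0 < T / k%:R by rewrite divr_gt0.
rewrite powRD; last by apply/implyP => _; rewrite gt_eqF.
rewrite powRr1 ?(ltW Tk)// mulrA mulrCA divff ?gt_eqF// mulr1.
rewrite mulrC -ler_pdivlMr// (@le_trans _ _ (del `^ eps))//.
  by apply: ge0_ler_powR; rewrite ?nnegrE ?(ltW del0) ?(ltW Tk) ?(ltW eps0).
by rewrite /del -powRrM mulVf ?gt_eqF// powRr1 ?lexx//; apply: divr_ge0; exact: ltW.
Qed.

Lemma bad_bound_small lam e : 0 < lam -> 0 < e -> exists2 k, (0 < k)%N & bad_bound k lam <= e.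
Proof.
move=> l0 e0; pose A := `|(chain_const K eps + 16 * K) / lam ^+ 4| + 1.
have A0 : 0 < A by rewrite ltr_wpDl.
have [k k0 hk] := mesh_size_small (divr_gt0 e0 A0); exists k => //.
rewrite (@le_trans _ _ (A * (k%:R * (T / k%:R) `^ (1 + eps))))//.
  rewrite ler_wpM2r ?mulr_ge0 ?powR_ge0// (le_trans (ler_norm _))// lerDl//.
by rewrite mulrC -ler_pdivlMr.
Qed.

End GridLimit.

(** * Almost sure approximation of the limit process *)

Section LimitProcess.
Context {R : realType} d {Om : measurableType d} (P : probability Om R) (Y : R -> Om -> R).
Context (T K eps : R).
Hypothesis T0 : 0 < T.
Hypothesis eps0 : 0 < eps.
Hypothesis K0 : 0 <= K.
Hypothesis cY : cadlag_process T Y.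
Hypothesis Y3 : forall r s t, 0 <= r -> r <= s -> s <= t -> t <= T ->
  (\int[P]_w ((Y s w - Y r w) ^+ 2 * (Y t w - Y s w) ^+ 2)%:E <= (K * (t - r) `^ (1 + eps))%:E)%E.
Hypothesis Y4 : forall s t, 0 <= s -> s <= t -> t <= T ->
  (\int[P]_w ((Y t w - Y s w) ^+ 2 * (Y t w - Y s w) ^+ 2)%:E <= (K * (t - s) `^ (1 + eps))%:E)%E.

Let mY t : 0 <= t <= T -> measurable_fun setT (Y t). Proof. exact: cY.2. Qed.

(** The fourth moment of each single grid increment is used here, a bound available for the limit
    process. *)
Lemma oscillation_mean_le k lam : (0 < k)%N -> 0 < lam ->
  mesh_bound T K eps k lam + \int[P]_w oscillation lam (grid_values Y T (k := k) w) <= bad_bound T K eps k lam.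
Proof.
move=> k0 l0; rewrite /bad_bound mulrDl mulrDl lerD2l.
have h0 : 0 < T / k%:R by rewrite divr_gt0// ltr0n.
have mc (i : 'I_k) : bounded_rv (fun w => cutoff lam (Y (grid T k i.+1) w - Y (grid T k i) w)).
  split; last by exists 1 => w; rewrite ger0_norm ?cutoff_ge0 ?cutoff_le1.
  apply: (measurable_lipschitz (X := fun (j : 'I_1) w => Y (grid T k i.+1) w - Y (grid T k i) w)
    (F := fun u => cutoff lam (u ord0)) (L := 2 / lam)).
  - by move=> j; apply: measurable_funB; apply: mY; apply: grid_mem => //; exact: ltnW.
  - by rewrite divr_ge0// ltW.
  - by move=> u v; rewrite big_ord_recl big_ord0 addr0; exact: cutoff_lipschitz.
have -> : \int[P]_w oscillation lam (grid_values Y T (k := k) w) =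
    \sum_(i < k) \int[P]_w cutoff lam (Y (grid T k i.+1) w - Y (grid T k i) w).
  rewrite -Rintegral_sum; last by move=> i; exact: bounded_rv_integrable.
  apply: eq_Rintegral => w _; apply: eq_bigr => i _.
  by rewrite /grid_values !inordK ?ltnS// ltnW.
rewrite (@le_trans _ _ (\sum_(i < k) (2 / lam) ^+ 4 * (K * (T / k%:R) `^ (1 + eps))))//; last first.
  rewrite sumr_const card_ord -[leLHS]mulr_natl exprMn exprVn.
  rewrite le_eqVlt; apply/orP; left; apply/eqP.
  by rewrite (_ : 2 ^+ 4 = 16%:R :> R); [ring|rewrite -natrX].
apply: ler_sum => i _; have ik : (i < k)%N by [].
have /andP[s0 _] := grid_mem T0 (ltnW ik) k0; have /andP[_ t1] := grid_mem T0 ik k0.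
have st : grid T k i <= grid T k i.+1 by rewrite gridS// lerDl ltW.
have H := Y4 s0 st t1; rewrite gridS// (addrC (grid T k i)) addrK -addrC -gridS// in H.
have mU : measurable_fun setT (fun w => (Y (grid T k i.+1) w - Y (grid T k i) w) ^+ 2 *
   (Y (grid T k i.+1) w - Y (grid T k i) w) ^+ 2).
  by apply: measurable_funM; apply: measurable_funX; apply: measurable_funB; apply: mY;
    apply: grid_mem => //; exact: ltnW.
rewrite -lee_fin /Rintegral fineK; last first.
  by apply: (integrable_fin_num measurableT); exact: (bounded_rv_integrable P (mc i)).
have l20 : 0 <= (2 / lam) ^+ 4 by rewrite exprn_ge0// divr_ge0// ltW.
rewrite (@le_trans _ _ (((2 / lam) ^+ 4)%:E * \int[P]_w ((Y (grid T k i.+1) w - Y (grid T k i) w) ^+ 2 *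
   (Y (grid T k i.+1) w - Y (grid T k i) w) ^+ 2)%:E)%E)//.
  rewrite -ge0_integralZl//; last 2 first.
  - exact/measurable_EFinP.
  - by move=> w _; rewrite lee_fin mulr_ge0 ?sqr_ge0.
  by apply: le_integral_pointwise => w; rewrite -EFinM lee_fin; exact: cutoff_le4.
by rewrite [leRHS]EFinM lee_wpmul2l// lee_fin.
Qed.

Context (F : (R -> R) -> R) (M : R).
Hypothesis FM : forall x, cadlag T x -> `|F x| <= M.
Hypothesis M0 : 0 <= M.
Hypothesis cF : skorokhod_continuous T F.

(** Of order [m ^ -2], so that the error still vanishes after multiplication by the Lipschitz
    constant [m] of the minorant. *)
Definition fine_scale m : R := harmonic m * harmonic m.

Lemma fine_scale_gt0 m : 0 < fine_scale m.
Proof. by rewrite mulr_gt0 ?harmonic_gt0. Qed.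

(* Along meshes for which the exceptional probabilities are summable, the step
   functionals converge to F(Y) almost surely; this also replaces the
   measurability of F(Y), which is not available. *)
Lemma step_functional_diagonal : exists k : nat -> nat,
  [/\ forall m, (0 < k m)%N, forall m, bad_bound T K eps (k m) (fine_scale m) <= 2^-1 ^+ m &
    \int[P]_w step_functional T F M m%:R (grid_values Y T (k := k m) w) @[m --> \oo] -->
    \int[P]_w F (Y ^~ w)].
Proof.
have /choice[k Hk] m : exists k, (0 < k)%N /\ bad_bound T K eps k (fine_scale m) <= 2^-1 ^+ m.
  have p0 : 0 < 2^-1 ^+ m :> R by rewrite exprn_gt0// invr_gt0.
  by have [k k0 hk] := bad_bound_small K T0 eps0 (fine_scale_gt0 m) p0; exists k.
have k0 m : (0 < k m)%N by have [] := Hk m.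
have kb m : bad_bound T K eps (k m) (fine_scale m) <= 2^-1 ^+ m by have [] := Hk m.
exists k; split => //.
have /choice[E HE] m : exists E, [/\ measurable E, fine (P E) <= 2^-1 ^+ m &
    forall w, ~ E w -> forall t, 0 <= t <= T ->
      `|Y t w - Y (grid T (k m) (Num.truncn ((k m)%:R * t / T))) w| <= 2 * fine_scale m].
  have [E [mE PE h]] := grid_approximation T0 eps0 K0 cY.1 cY.2 Y3 (k0 m) (fine_scale_gt0 m).
  by exists E; split => //; rewrite (le_trans PE)// (le_trans _ (kb m))// oscillation_mean_le// fine_scale_gt0.
have mE m : measurable (E m) by have [] := HE m.
have PE : (\sum_(m <oo) P (E m) < +oo)%E.
  rewrite (@le_lt_trans _ _ 2%:E)// ?ltry//.
  apply: lime_le; first exact: is_cvg_nneseries.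
  apply: nearW => n; rewrite (@le_trans _ _ (\sum_(0 <= m < n) (1 * 2^-1 ^+ m)%:E)%E)//.
    apply: lee_sum => m _; rewrite mul1r -[leLHS]fineK ?fin_num_measure// lee_fin; by have [] := HE m.
  have h2 : (2^-1 : R) != 1 by rewrite lt_eqF// invf_lt1// ltr1n.
  rewrite sumEFin lee_fin; have := congr1 (@^~ n) (@geometric_seriesE _ (1 : R) 2^-1 h2).
  rewrite /series/= => ->; rewrite mul1r ler_pdivrMr; last by rewrite subr_gt0 invf_lt1// ltr1n.
  have -> : 2 * (1 - 2^-1) = 1 :> R by field.
  by rewrite gerBl exprn_ge0// invr_ge0.
(* Borel-Cantelli: off the null set [N] a path belongs to only finitely many [E m]. *)
pose N := lim_sup_set E.
have PN : P N = 0%E by exact: lim_sup_set_cvg0.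
have mN : measurable N.
  by apply: bigcap_measurable => // j _; apply: bigcup_measurable.
pose phi m w := step_functional T F M m%:R (grid_values Y T (k := k m) w).
have lim w : ~ N w -> phi m w @[m --> \oo] --> F (Y ^~ w).
  move=> wN; have [j Hj] : exists j, forall m, (j <= m)%N -> ~ E m w.
    apply: contrapT => nj; apply: wN => j _; apply: contrapT => h; apply: nj; exists j => m jm wE.
    by apply: h; exists m.
  have H1 := inf_conv_cvg FM M0 cF (cY.1 w).
  have H2 : phi m w - inf_conv T F M m%:R (Y ^~ w) @[m --> \oo] --> (0 : R).
    have Hh : 2 * harmonic m @[m --> \oo] --> (0 : R).
      by rewrite -(mulr0 2); apply: cvgMr; exact: cvg_harmonic.
    apply/cvgrPdist_le => /= e e0; have /cvgrPdist_le/(_ e e0) Hh' := Hh.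
    near=> m; have Hm : `|0 - 2 * harmonic m| <= e by near: m; exact: Hh'.
    rewrite sub0r normrN (le_trans _ Hm)// sub0r normrN (le_trans _ (ler_norm _))//.
    have [_ _ hE] := HE m.
    have jm : (j <= m)%N by near: m; exact: nbhs_infty_ge.
    have l20 : 0 <= 2 * fine_scale m by rewrite mulr_ge0// ltW// fine_scale_gt0.
    have := step_functional_close FM M0 T0 (ler0n R m) l20 (hE w (Hj m jm)).
    move=> h; apply: (le_trans h); rewrite mulrCA ler_wpM2l// /fine_scale mulrA ler_piMl//.
      exact/ltW/harmonic_gt0.
    by rewrite /harmonic/= ler_pdivrMr ?ltr0n// mul1r ler_nat.
  have phiE : (fun m => phi m w) = (fun m => phi m w - inf_conv T F M m%:R (Y ^~ w) + inf_conv T F M m%:R (Y ^~ w)).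
    by apply/funext => m; rewrite subrK.
  by rewrite phiE -[X in _ --> X]add0r; exact: cvgD.
pose I := (\1_(~` N) : Om -> R).
pose V w := F (Y ^~ w) * I w.
have bphi m : bounded_rv (phi m) by exact: (bounded_step_functional T0 cY.2 FM M0 (k0 m) (ler0n R m)).
have bI : bounded_rv I by apply: bounded_rv_indic; exact: measurableC.
have bpI m : bounded_rv (fun w => phi m w * I w) by exact: bounded_rvM.
have limV w : phi m w * I w @[m --> \oo] --> V w.
  rewrite /V /I indicE; case: (boolP (w \in ~` N)) => [/set_mem wN|_].
    by apply: cvgMl; exact: lim.
  by rewrite mulr0; under eq_cvg do rewrite mulr0; exact: cvg_cst.
have mV : measurable_fun setT V.
  by apply: (@measurable_fun_cvg _ _ _ setT (fun m w => phi m w * I w)) => // m; case: (bpI m).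
have I01 w : 0 <= I w <= 1 by rewrite /I indicE; case: (_ \in _); rewrite ?lexx ler01.
have FYM w : `|F (Y ^~ w)| <= M by apply: FM; exact: cY.1.
have bV : bounded_rv V.
  split => //; exists M => w; have /andP[i0 i1] := I01 w.
  by rewrite normrM (ger0_norm i0) (le_trans _ (FYM w))// ler_piMr.
have L1 : \int[P]_w (phi m w * I w) @[m --> \oo] --> \int[P]_w V w.
  have mf m : measurable_fun setT (fun w => (phi m w * I w)%:E) by apply/measurable_EFinP; case: (bpI m).
  have mV' : measurable_fun setT (EFin \o V) by exact/measurable_EFinP.
  have fc : {ae P, forall w, setT w -> (phi m w * I w)%:E @[m --> \oo] --> (EFin \o V) w}.
    by apply: aeW => w _; apply: cvg_EFin; [exact: nearW|exact: limV].
  have dom : {ae P, forall w m, setT w -> (`|(phi m w * I w)%:E| <= (cst M w)%:E)%E}.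
    apply: aeW => w m _; rewrite /= lee_fin; have /andP[i0 i1] := I01 w.
    rewrite normrM (ger0_norm i0) (@le_trans _ _ `|phi m w|)//; first by rewrite ler_piMr.
    exact: (norm_inf_conv FM M0 _ (ler0n R m)).
  have iM := bounded_rv_integrable P (@bounded_rv_cst _ _ Om M).
  have [_ _ H] := dominated_convergence measurableT mf mV' fc iM dom.
  apply: fine_cvg; rewrite fineK; first exact: H.
  by apply: (integrable_fin_num measurableT); exact: (bounded_rv_integrable P bV).
have aeI : {ae P, forall w, I w = 1}.
  exists N; split => // w /= h; apply: contrapT => wN; apply: h.
  by rewrite /I indicE mem_set.
have E1 m : \int[P]_w (phi m w * I w) = \int[P]_w phi m w.
  apply: ae_eq_Rintegral; [by case: (bpI m)|by case: (bphi m)|].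
  by apply: filterS aeI => w ->; rewrite mulr1.
(* [F (Y ^~ w)] lies between [V - M (1 - I)] and [V + M (1 - I)], two measurable functions almost
   surely equal to [V]; this fixes its integral. *)
have E2 : \int[P]_w V w = \int[P]_w F (Y ^~ w).
  have bNI : bounded_rv (fun w => M * (1 - I w)).
    apply: (@bounded_rvM _ _ _ (cst M)); first exact: bounded_rv_cst.
    by apply: (@bounded_rvB _ _ _ (cst 1)) => //; exact: bounded_rv_cst.
  have eqV c : \int[P]_w (V w + c * (M * (1 - I w))) = \int[P]_w V w.
    apply: ae_eq_Rintegral => //.
      by apply: measurable_funD => //; apply: measurable_funM => //; case: bNI.
    by apply: filterS aeI => w ->; rewrite subrr !mulr0 addr0.
  have bnd c w : `|c| <= 1 -> `|V w + c * (M * (1 - I w))| <= M + M.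
    move=> c1; have /andP[i0 i1] := I01 w.
    rewrite (le_trans (ler_normD _ _))// lerD//.
      by rewrite normrM (ger0_norm i0) (le_trans _ (FYM w))// ler_piMr.
    have h0 : 0 <= M * (1 - I w) by rewrite mulr_ge0// subr_ge0.
    rewrite normrM (ger0_norm h0) (@le_trans _ _ (M * (1 - I w)))//; first by rewrite ler_piMl.
    by rewrite ler_piMr// gerBl.
  have FYM2 w : `|F (Y ^~ w)| <= M + M by rewrite (le_trans (FYM w))// lerDl.
  have Icase w : I w = 1 \/ I w = 0 by rewrite /I indicE; case: (_ \in _); [left|right].
  apply/eqP; rewrite eq_le; apply/andP; split.
    rewrite -(eqV (-1)); apply: (@le_Rintegral_pointwise _ _ _ _ _ _ (M + M)) => // w.
      by apply: bnd; rewrite normrN normr1.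
    have := FYM w; rewrite ler_norml => /andP[f1 f2].
    by rewrite /V; case: (Icase w) => ->; lra.
  rewrite -(eqV 1); apply: (@le_Rintegral_pointwise _ _ _ _ _ _ (M + M)) => // w.
    by apply: bnd; rewrite normr1.
  have := FYM w; rewrite ler_norml => /andP[f1 f2].
  by rewrite /V; case: (Icase w) => ->; lra.
by move: L1; rewrite E2; under eq_cvg do rewrite E1.
Unshelve. all: by end_near. Qed.

End LimitProcess.

Section SkorokhodConvergence.
Context {R : realType} (T K eps W : R).
Context (d : nat -> measure_display) (Om : forall n, measurableType (d n))
  (P : forall n, probability (Om n) R) (Z : forall n, R -> Om n -> R)
  (d' : measure_display) (Om' : measurableType d') (P' : probability Om' R) (Y : R -> Om' -> R).
Hypothesis T0 : 0 < T.
Hypothesis eps0 : 0 < eps.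
Hypothesis K0 : 0 <= K.
Arguments Z : clear implicits.
Hypothesis cZ : \forall n \near \oo, cadlag_process T (Z n).
Hypothesis Z3 : \forall n \near \oo, forall r s t, 0 <= r -> r <= s -> s <= t -> t <= T ->
  (\int[P n]_w ((Z n s w - Z n r w) ^+ 2 * (Z n t w - Z n s w) ^+ 2)%:E <= (K * (t - r) `^ (1 + eps))%:E)%E.
Hypothesis Z2 : \forall n \near \oo, forall t, 0 <= t <= T -> (\int[P n]_w (Z n t w ^+ 2)%:E <= W%:E)%E.
Hypothesis cY : cadlag_process T Y.
Hypothesis Y3 : forall r s t, 0 <= r -> r <= s -> s <= t -> t <= T ->
  (\int[P']_w ((Y s w - Y r w) ^+ 2 * (Y t w - Y s w) ^+ 2)%:E <= (K * (t - r) `^ (1 + eps))%:E)%E.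
Hypothesis Y4 : forall s t, 0 <= s -> s <= t -> t <= T ->
  (\int[P']_w ((Y t w - Y s w) ^+ 2 * (Y t w - Y s w) ^+ 2)%:E <= (K * (t - s) `^ (1 + eps))%:E)%E.
Hypothesis Y2 : forall t, 0 <= t <= T -> (\int[P']_w (Y t w ^+ 2)%:E <= W%:E)%E.
Hypothesis Hcos : forall k (t th : 'I_k -> R), (forall j, 0 <= t j <= T) ->
  \int[P n]_w cos (\sum_(j < k) th j * Z n (t j) w) @[n --> \oo] -->
  \int[P']_w cos (\sum_(j < k) th j * Y (t j) w).
Hypothesis Hsin : forall k (t th : 'I_k -> R), (forall j, 0 <= t j <= T) ->
  \int[P n]_w sin (\sum_(j < k) th j * Z n (t j) w) @[n --> \oo] -->
  \int[P']_w sin (\sum_(j < k) th j * Y (t j) w).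

Let grid_cvg k (G : ('I_k.+1 -> R) -> R) L : (0 < k)%N -> 0 <= L -> lipschitz_l1 L G ->
  (exists B, forall u, `|G u| <= B) ->
  \int[P n]_w G (grid_values (Z n) T (k := k) w) @[n --> \oo] -->
  \int[P']_w G (grid_values Y T (k := k) w).
Proof.
move=> k0 L0 LG bG; have gm (j : 'I_k.+1) : 0 <= grid T k j <= T by apply: grid_mem => //; rewrite -ltnS.
apply: (char_cvg_lipschitz (X := fun n (j : 'I_k.+1) w => Z n (grid T k j) w)
  (Y := fun (j : 'I_k.+1) w => Y (grid T k j) w) (W := W)) L0 LG bG.
- by apply: filterS cZ => n [_ h] j; exact: h.
- by move=> j; exact: cY.2.
- by apply: filterS Z2 => n h j; exact: h.
- by move=> j; exact: Y2.
- by move=> th; exact: Hcos.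
- by move=> th; exact: Hsin.
Qed.

(** The level [m], the mesh [k m] and the scale are fixed from the limit process before [n] is taken
    large. The mean oscillation of [Z n] is then close to that of [Y], which is known to be
    small. *)
Lemma functional_liminf (F : (R -> R) -> R) (M e : R) : skorokhod_continuous T F ->
  (forall x, cadlag T x -> `|F x| <= M) -> 0 <= M -> 0 < e ->
  \forall n \near \oo, \int[P']_w F (Y ^~ w) - e <= \int[P n]_w F (Z n ^~ w).
Proof.
move=> cF FM M0 e0.
have [k [k0 kb Hk]] := step_functional_diagonal T0 eps0 K0 cY Y3 Y4 FM M0 cF.
have e8 : 0 < e / 8 by rewrite divr_gt0.
have H2 : (2 * harmonic m + 2 * M * (2^-1 ^+ m)) @[m --> \oo] --> (0 : R).
  rewrite -(addr0 0) -{1}(mulr0 2) -{2}(mulr0 (2 * M)).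
  apply: cvgD; apply: cvgMr; first exact: cvg_harmonic.
  by apply: cvg_expr; rewrite ger0_norm// invf_lt1// ltr1n.
have [m hm1 hm2] : exists2 m, `|\int[P']_w F (Y ^~ w) -
      \int[P']_w step_functional T F M m%:R (grid_values Y T (k := k m) w)| <= e / 8 &
    `|2 * harmonic m + 2 * M * (2^-1 ^+ m)| <= e / 8.
  have /cvgrPdist_le/(_ _ e8) a1 := Hk; have /cvgrPdist_le/(_ _ e8) a2 := H2.
  have [n _ Hn] := filterI a1 a2; exists n; first by have [] := Hn n (leqnn n).
  by have [_] := Hn n (leqnn n); rewrite sub0r normrN.
have l0 := @fine_scale_gt0 R m.
have G1 := grid_cvg (k0 m) (ler0n R m) (step_functional_lipschitz FM M0 (ler0n R m))
  (ex_intro _ M (fun u => norm_inf_conv FM M0 _ (ler0n R m))).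
have G2 := grid_cvg (k0 m) (mulr_ge0 (ler0n R _) (divr_ge0 (ler0n R 4) (ltW l0))) (oscillation_lipschitz l0)
  (ex_intro _ (k m)%:R (fun u => _)).
have {}G2 : \int[P n]_w oscillation (fine_scale m) (grid_values (Z n) T (k := k m) w) @[n --> \oo] -->
    \int[P']_w oscillation (fine_scale m) (grid_values Y T (k := k m) w).
  by apply: G2 => u; rewrite ger0_norm ?oscillation_ge0 ?oscillation_le.
(* The added 1 keeps the divisor positive when [M = 0]. *)
have M1 : 0 < 2 * M + 1 by rewrite ltr_wpDl// mulr_ge0.
have e8M : 0 < e / 8 / (2 * M + 1) by rewrite divr_gt0.
have /cvgrPdist_le/(_ _ e8) {}G1 := G1; have /cvgrPdist_le/(_ _ e8M) {}G2 := G2.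
near=> n.
have g1 : `|\int[P']_w step_functional T F M m%:R (grid_values Y T (k := k m) w) -
  \int[P n]_w step_functional T F M m%:R (grid_values (Z n) T (k := k m) w)| <= e / 8.
  by near: n; exact: G1.
have g2 : `|\int[P']_w oscillation (fine_scale m) (grid_values Y T (k := k m) w) -
  \int[P n]_w oscillation (fine_scale m) (grid_values (Z n) T (k := k m) w)| <= e / 8 / (2 * M + 1).
  by near: n; exact: G2.
have cn : cadlag_process T (Z n) by near: n; exact: cZ.
have Z3n : forall r s t, 0 <= r -> r <= s -> s <= t -> t <= T ->
  (\int[P n]_w ((Z n s w - Z n r w) ^+ 2 * (Z n t w - Z n s w) ^+ 2)%:E <= (K * (t - r) `^ (1 + eps))%:E)%E.
  by near: n; exact: Z3.
have low := step_functional_lower T0 eps0 K0 cn.1 cn.2 Z3n FM M0 (k0 m) l0 (ler0n R m).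
have osc : mesh_bound T K eps (k m) (fine_scale m) +
  \int[P']_w oscillation (fine_scale m) (grid_values Y T (k := k m) w) <= bad_bound T K eps (k m) (fine_scale m).
  by apply: oscillation_mean_le => //; exact: cY.
have kbm := kb m.
have ml : m%:R * fine_scale m <= harmonic m :> R.
  rewrite /fine_scale mulrA ler_piMl ?(ltW (harmonic_gt0 _))//.
  by rewrite /harmonic/= ler_pdivrMr ?ltr0n// mul1r ler_nat.
move: low g1 g2 hm1 hm2 osc kbm ml.
set F' := \int[P n]_w F _; set FY := \int[P']_w F _.
set sY := \int[P']_w step_functional _ _ _ _ _; set sn := \int[P n]_w step_functional _ _ _ _ _.
set oY := \int[P']_w oscillation _ _; set on := \int[P n]_w oscillation _ _.
set mb := mesh_bound _ _ _ _ _; set bb := bad_bound _ _ _ _ _; set p := 2^-1 ^+ m; set hm := harmonic m.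
move=> low; rewrite !ler_norml => /andP[g1 g1'] /andP[g2 g2'] /andP[hm1 hm1'] /andP[hm2 hm2'] osc kbm ml.
have h1 : 2 * M * (mb + on) <= 2 * M * (p + e / 8 / (2 * M + 1)) by rewrite ler_wpM2l ?mulr_ge0//; lra.
have h2 : 2 * M * (e / 8 / (2 * M + 1)) <= e / 8.
  by rewrite mulrCA ler_piMr ?(ltW e8)// ler_pdivrMr// mul1r lerDl.
have h3 : 2 * m%:R * fine_scale m <= 2 * hm by rewrite -mulrA ler_wpM2l.
rewrite mulrDr in h1; lra.
Unshelve. all: by end_near. Qed.

Theorem skorokhod_cvg_in_law_of_chars : skorokhod_cvg_in_law T P Z P' Y.
Proof.
move=> F cF [M FM].
have M0 : 0 <= M by exact: le_trans (normr_ge0 _) (FM _ (cY.1 point)).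
have FY w : `|F (Y ^~ w)| <= M by apply: FM; exact: cY.1.
have cNF : skorokhod_continuous T (fun x => - F x).
  move=> x cx e e0; have [del d0 H] := cF x cx e e0; exists del => // y cy xy.
  by rewrite -opprD normrN; exact: H.
have NFM x : cadlag T x -> `|- F x| <= M by rewrite normrN; exact: FM.
have E : 'E_P'[fun w => F (Y ^~ w)]%E = (\int[P']_w F (Y ^~ w))%:E.
  by rewrite expectation_ge0E /Rintegral fineK// (bounded_integral_fin_num _ FY).
rewrite E.
have H : \int[P n]_w F (Z n ^~ w) @[n --> \oo] --> \int[P']_w F (Y ^~ w).
  apply/cvgrPdist_le => /= e e0.
  have h1 := functional_liminf cF FM M0 e0; have h2 := functional_liminf cNF NFM M0 e0.
  near=> n.
  have cn : cadlag_process T (Z n) by near: n; exact: cZ.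
  have FZ w : `|F (Z n ^~ w)| <= M by apply: FM; exact: cn.1.
  have h1n : \int[P']_w F (Y ^~ w) - e <= \int[P n]_w F (Z n ^~ w) by near: n; exact: h1.
  have : \int[P']_w (- F (Y ^~ w)) - e <= \int[P n]_w (- F (Z n ^~ w)) by near: n; exact: h2.
  rewrite (Rintegral_oppr _ FY) (Rintegral_oppr _ FZ) ler_norml => h2n; apply/andP; split; lra.
have H' : (\int[P n]_w F (Z n ^~ w))%:E @[n --> \oo] --> (\int[P']_w F (Y ^~ w))%:E.
  by apply: cvg_EFin; [exact: nearW|exact: H].
apply: cvg_trans H'; apply: near_eq_cvg; near=> n.
have cn : cadlag_process T (Z n) by near: n; exact: cZ.
have FZ w : `|F (Z n ^~ w)| <= M by apply: FM; exact: cn.1.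
by rewrite expectation_ge0E /Rintegral fineK// (bounded_integral_fin_num _ FZ).
Unshelve. all: by end_near. Qed.

End SkorokhodConvergence.

(** * Rescaled limits *)

Section ScaledMoments.
Context {R : realType}.

Lemma scaled_integrable d {T : measurableType d} (mu : {measure set T -> \bar R}) (f : T -> R) (c : R) :
  measurable_fun setT f -> (forall x, 0 <= f x) -> 0 < c -> (\int[mu]_x (f x / c)%:E < +oo)%E ->
  mu.-integrable setT (EFin \o f) /\ (\int[mu]_x (f x / c)%:E = ((\int[mu]_x f x) / c)%:E)%E.
Proof.
move=> mf f0 c0 H.
have ig : mu.-integrable setT (EFin \o (fun x => f x / c)).
  apply/integrableP; split.
    by apply/measurable_EFinP; apply: measurable_funM.
  by under eq_integral do rewrite /= ger0_norm ?divr_ge0 ?(ltW c0)//.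
have i_f : mu.-integrable setT (EFin \o f).
  have := integrableZl measurableT c ig.
  apply: eq_integrable => // x _; rewrite /= -EFinM; congr EFin.
  by rewrite mulrC divfK// gt_eqF.
split => //; rewrite mulrC -(RintegralZl _ measurableT i_f) /Rintegral fineK.
  by apply: eq_integral => x _; rewrite mulrC.
rewrite (_ : (fun x => (c^-1 * f x)%:E) = EFin \o (fun x => f x / c)); last by apply/funext => x; rewrite /= mulrC.
exact: (integrable_fin_num measurableT ig).
Qed.

(** Convergence to a finite limit makes the integrals finite for large [n], hence [f] integrable,
    after which the limit can be stated in [R]. *)
Lemma scaled_moment_cvg d {T : measurableType d} (mu : nat -> {measure set T -> \bar R}) (f : T -> R)
    (c : nat -> R) (l : R) :
  measurable_fun setT f -> (forall x, 0 <= f x) -> (forall n, (0 < n)%N -> 0 < c n) ->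
  (\int[mu n]_x (f x / c n)%:E)%E @[n --> \oo] --> l%:E ->
  (\forall n \near \oo, (mu n).-integrable setT (EFin \o f)) /\
  (\int[mu n]_x f x) / c n @[n --> \oo] --> l.
Proof.
move=> mf f0 c0 /fine_cvgP[fin H].
have key : \forall n \near \oo, (mu n).-integrable setT (EFin \o f) /\
    (\int[mu n]_x (f x / c n)%:E = ((\int[mu n]_x f x) / c n)%:E)%E.
  near=> n; apply: scaled_integrable => //.
    by apply: c0; near: n; exact: nbhs_infty_gt.
  by rewrite ltey_eq; apply/orP; left; near: n.
split; first by apply: filterS key => n [].
apply: cvg_trans H; apply: near_eq_cvg; apply: filterS key => n [_] /= ->.
by [].
Unshelve. all: by end_near. Qed.

Context (gamma b : nat -> R) (nu : nat -> {measure set (measurableTypeR R) -> \bar R}).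
Hypothesis hmom2 : (\int[nu n]_x (x ^+ 2 / n%:R)%:E)%E @[n --> \oo] --> 1%E.
Hypothesis hmom3 : (\int[nu n]_x (`|x| ^+ 3 / (n%:R * Num.sqrt n%:R))%:E)%E @[n --> \oo] --> 0%E.
Hypothesis hgauss : b n ^+ 2 / n%:R @[n --> \oo] --> (0 : R).

Lemma second_moment_asymptotics :
  (\forall n \near \oo, (nu n).-integrable setT (EFin \o (fun x : R => x ^+ 2))) /\
  (\int[nu n]_x (x ^+ 2)) / n%:R @[n --> \oo] --> (1 : R).
Proof.
apply: (scaled_moment_cvg _ _ _ hmom2) => [|x|n n0]; last by rewrite ltr0n.
  by apply: measurable_funX.
exact: sqr_ge0.
Qed.

Lemma third_moment_asymptotics :
  (\forall n \near \oo, (nu n).-integrable setT (EFin \o (fun x : R => `|x| ^+ 3))) /\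
  (\int[nu n]_x (`|x| ^+ 3)) / (n%:R * Num.sqrt n%:R) @[n --> \oo] --> (0 : R).
Proof.
apply: (scaled_moment_cvg _ _ _ hmom3) => [|x|n n0]; last by rewrite mulr_gt0 ?sqrtr_gt0 ?ltr0n.
  by apply: measurable_funX; exact: normr_measurable.
exact: exprn_ge0.
Qed.

(** The square of [th / sqrt n] supplies the normalization of the second moment and of [b n ^ 2],
    and its cube that of the third moment. *)
Lemma re_exponent_asymptotics (th : R) :
  re_exponent (b n) (nu n) (th / Num.sqrt n%:R) @[n --> \oo] --> - (th ^+ 2 / 2).
Proof.
have [i2 l2] := second_moment_asymptotics.
have [i3 l3] := third_moment_asymptotics.
pose B n : R := 2 * `|th| ^+ 3 * ((\int[nu n]_x (`|x| ^+ 3)) / (n%:R * Num.sqrt n%:R)).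
pose A n : R := - (th ^+ 2 / 2) * (b n ^+ 2 / n%:R + (\int[nu n]_x (x ^+ 2)) / n%:R).
have cA : A n @[n --> \oo] --> - (th ^+ 2 / 2).
  rewrite -[X in _ --> X]mulr1 -[X in _ * X]add0r.
  by apply: cvgM; [exact: cvg_cst|exact: cvgD].
have cB : B n @[n --> \oo] --> (0 : R).
  by rewrite -[X in _ --> X](mulr0 (2 * `|th| ^+ 3)); apply: cvgM => //; exact: cvg_cst.
have H : \forall n \near \oo, A n - B n <= re_exponent (b n) (nu n) (th / Num.sqrt n%:R) <= A n + B n.
  near=> n.
  have n0 : (0 < n)%N by near: n; exact: nbhs_infty_gt.
  have I2 : (nu n).-integrable setT (EFin \o (fun x : R => x ^+ 2)) by near: n.
  have I3 : (nu n).-integrable setT (EFin \o (fun x : R => `|x| ^+ 3)) by near: n.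
  have N0 : 0 < n%:R :> R by rewrite ltr0n.
  have S0 : 0 < Num.sqrt n%:R :> R by rewrite sqrtr_gt0.
  have S2 : Num.sqrt n%:R ^+ 2 = n%:R :> R by rewrite sqr_sqrtr ?ltW.
  have := re_exponent_taylor (b n) I2 I3 (th / Num.sqrt n%:R).
  have -> : 2 * `|th / Num.sqrt n%:R| ^+ 3 * (\int[nu n]_x (`|x| ^+ 3)) = B n.
    rewrite /B normrM normfV (gtr0_norm S0) exprMn (_ : n%:R * Num.sqrt n%:R = Num.sqrt n%:R ^+ 3).
      by field; rewrite gt_eqF.
    by rewrite -[X in X * _]S2 -exprSr.
  have -> : (th / Num.sqrt n%:R) ^+ 2 * (b n ^+ 2 + \int[nu n]_x (x ^+ 2)) / 2 = - A n.
    by rewrite /A exprMn exprVn S2; field; rewrite gt_eqF.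
  by rewrite ler_distl.
have CL : A n - B n @[n --> \oo] --> - (th ^+ 2 / 2).
  by rewrite -[X in _ --> X]subr0; exact: cvgB.
have CU : A n + B n @[n --> \oo] --> - (th ^+ 2 / 2).
  by rewrite -[X in _ --> X]addr0; exact: cvgD.
exact: squeeze_cvgr H _ CL CU.
Unshelve. all: by end_near. Qed.

Lemma im_exponent_asymptotics (th : R) :
  im_exponent (gamma n) (nu n) (th / Num.sqrt n%:R) - levy_mean (nu n) (gamma n) * (th / Num.sqrt n%:R)
    @[n --> \oo] --> (0 : R).
Proof.
have [i2 l2] := second_moment_asymptotics.
have [i3 l3] := third_moment_asymptotics.
pose B n : R := `|th| ^+ 3 * ((\int[nu n]_x (`|x| ^+ 3)) / (n%:R * Num.sqrt n%:R)).
have cB : B n @[n --> \oo] --> (0 : R).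
  by rewrite -[X in _ --> X](mulr0 (`|th| ^+ 3)); apply: cvgM => //; exact: cvg_cst.
have cNB : - B n @[n --> \oo] --> (0 : R) by rewrite -oppr0; exact: cvgN.
have H : \forall n \near \oo, - B n <= im_exponent (gamma n) (nu n) (th / Num.sqrt n%:R) -
    levy_mean (nu n) (gamma n) * (th / Num.sqrt n%:R) <= B n.
  near=> n.
  have n0 : (0 < n)%N by near: n; exact: nbhs_infty_gt.
  have I2 : (nu n).-integrable setT (EFin \o (fun x : R => x ^+ 2)) by near: n.
  have I3 : (nu n).-integrable setT (EFin \o (fun x : R => `|x| ^+ 3)) by near: n.
  have N0 : 0 < n%:R :> R by rewrite ltr0n.
  have S0 : 0 < Num.sqrt n%:R :> R by rewrite sqrtr_gt0.
  have S2 : Num.sqrt n%:R ^+ 2 = n%:R :> R by rewrite sqr_sqrtr ?ltW.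
  have := im_exponent_le3 (gamma n) I2 I3 (th / Num.sqrt n%:R).
  have -> : `|th / Num.sqrt n%:R| ^+ 3 * (\int[nu n]_x (`|x| ^+ 3)) = B n.
    rewrite /B normrM normfV (gtr0_norm S0) exprMn (_ : n%:R * Num.sqrt n%:R = Num.sqrt n%:R ^+ 3).
      by field; rewrite gt_eqF.
    by rewrite -[X in X * _]S2 -exprSr.
  by rewrite ler_norml.
exact: squeeze_cvgr H _ cNB cB.
Unshelve. all: by end_near. Qed.

Lemma fourth_moment_bound : (exists M : R, forall n, (0 < n)%N ->
     (\int[nu n]_x (x ^+ 4 / n%:R ^+ 2)%:E <= M%:E)%E) ->
  exists2 M : R, 0 <= M & forall n, (0 < n)%N ->
    (nu n).-integrable setT (EFin \o (fun x : R => x ^+ 4)) /\ (\int[nu n]_x (x ^+ 4)) / n%:R ^+ 2 <= M.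
Proof.
move=> [M HM]; exists (Num.max 0 M); first by rewrite le_max lexx.
move=> n n0.
have p0 (x : R) : 0 <= x ^+ 4 by rewrite (exprM x 2 2) sqr_ge0.
have [||||i4 e4] := @scaled_integrable _ _ (nu n) (fun x : R => x ^+ 4) (n%:R ^+ 2).
- by apply: measurable_funX.
- exact: p0.
- by rewrite exprn_gt0// ltr0n.
- by apply: le_lt_trans (HM n n0) _; rewrite ltry.
split => //; rewrite le_max; apply/orP; right.
by have := HM n n0; rewrite e4 lee_fin.
Qed.

End ScaledMoments.

(** The rescaled process is an affine image of [X n] with one common centre on [[0, T]] only; the
    one-sided limits involved see no other times. *)
Lemma cadlag_eq_on (R : realType) (T : R) (x y : R -> R) :
  (forall t, 0 <= t <= T -> x t = y t) -> cadlag T x -> cadlag T y.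
Proof.
move=> xy [cr cl]; split => t /andP[t0 tT].
  rewrite -xy ?t0 ?ltW//; apply: cvg_trans (cr t _); last by rewrite t0.
  apply: near_eq_cvg; near=> s; apply: xy; apply/andP; split.
    by apply: (le_trans t0); apply: ltW; near: s; exact: nbhs_right_gt.
  by apply: ltW; near: s; exact: nbhs_right_lt.
have /cl : 0 < t <= T by rewrite t0.
move=> /cvg_ex[l xl]; apply/cvg_ex; exists l; apply: cvg_trans xl.
apply: near_eq_cvg; near=> s; apply: xy; apply/andP; split.
  by apply: ltW; near: s; exact: nbhs_left_gt.
by apply: le_trans tT; apply: ltW; near: s; exact: nbhs_left_lt.
Unshelve. all: by end_near. Qed.

Lemma cadlag_affine (R : realType) (T c s : R) (x : R -> R) :
  cadlag T x -> cadlag T (fun t => (x t - c) / s).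
Proof.
move=> [cr cl]; split => t tT.
  apply: cvgM; last exact: cvg_cst.
  by apply: cvgB; [exact: cr|exact: cvg_cst].
have /cvg_ex[l xl] := cl _ tT; apply/cvg_ex; exists ((l - c) / s).
by apply: cvgM; [apply: cvgB => //|]; exact: cvg_cst.
Qed.

(** * The rescaled trawl processes *)

Section TrawlLimit.
Context {R : realType} (a : R -> R) (ha : trawl_function a) (T : R).

Lemma trawl_area_diff s t : s <= t ->
  leb2 (shifted_trawl_set a t `\` shifted_trawl_set a s) = (tail_area a 0 - tail_area a (t - s))%:E.
Proof.
move=> st.
have [mt ft] := finite_borel_shifted_trawl_set ha t.
have [ms fs] := finite_borel_shifted_trawl_set ha s.
rewrite -[LHS]/(leb2_measure (shifted_trawl_set a t `\` shifted_trawl_set a s)).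
rewrite measureD//.
have fI : (leb2_measure (shifted_trawl_set a t `&` shifted_trawl_set a s) < +oo)%E.
  apply: le_lt_trans ft; apply: le_measure; rewrite ?inE//; exact: measurableI.
have e1 := area_trawl_overlap ha t t.
have e2 := area_trawl_overlap ha t s.
rewrite setIid subrr normr0 in e1; rewrite ger0_norm ?subr_ge0// in e2.
have fr1 : leb2_measure (shifted_trawl_set a t) \is a fin_num by rewrite ge0_fin_numE.
have fr2 : leb2_measure (shifted_trawl_set a t `&` shifted_trawl_set a s) \is a fin_num by rewrite ge0_fin_numE.
by rewrite EFinB -e1 -e2; congr (_ - _)%E; rewrite fineK.
Qed.

Context (d : nat -> measure_display) (Om : forall n, measurableType (d n))
  (P : forall n, probability (Om n) R)
  (L : forall n, set (measurableTypeR R * measurableTypeR R) -> Om n -> R)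
  (gamma b : nat -> R)
  (nu : nat -> {measure set (measurableTypeR R) -> \bar R})
  (X : forall n, R -> Om n -> R).
Arguments L : clear implicits.
Arguments X : clear implicits.
Hypothesis hL : forall n, (0 < n)%N -> levy_basis (P n) (L n) (gamma n) (b n) (nu n).
Hypothesis mX : forall n, (0 < n)%N -> forall t, 0 <= t <= T -> measurable_fun setT (X n t).
Hypothesis hX : forall n, (0 < n)%N -> forall t, 0 <= t <= T ->
     {ae P n, forall w, X n t w = L n (shifted_trawl_set a t) w}.
Hypothesis hmom2 : (\int[nu n]_x (x ^+ 2 / n%:R)%:E)%E @[n --> \oo] --> 1%E.
Hypothesis hmom3 : (\int[nu n]_x (`|x| ^+ 3 / (n%:R * Num.sqrt n%:R))%:E)%E @[n --> \oo] --> 0%E.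
Hypothesis hgauss : b n ^+ 2 / n%:R @[n --> \oo] --> (0 : R).

Let Z n t w : R := (X n t w - fine ('E_(P n)[X n t])%E) / Num.sqrt n%:R.

Arguments Z : clear implicits.

(** The mean is the same at all times of [[0, T]]; it is computed for large [n], once the second and
    third moments of the Levy measure are finite. *)
Lemma rescaled_trawlE : \forall n \near \oo, forall t, 0 <= t <= T -> forall w,
  Z n t w = (X n t w - trawl_center a (gamma n) (nu n)) / Num.sqrt n%:R.
Proof.
have [i2 _] := second_moment_asymptotics hmom2.
have [i3 _] := third_moment_asymptotics hmom3.
near=> n; move=> t tT w.
have n0 : (0 < n)%N by near: n; exact: nbhs_infty_gt.
rewrite /Z (trawl_mean ha (hL n0) (mX n0) (hX n0) _ _ tT) //; first by near: n; exact: i2.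
by near: n; exact: i3.
Unshelve. all: by end_near. Qed.

Lemma rescaled_trawl_char_limit k (t th : 'I_k -> R) : (forall j, 0 <= t j <= T) ->
  let V := \sum_i \sum_j th i * th j * tail_area a `|t i - t j| in
  \int[P n]_w cos (\sum_(j < k) th j * Z n (t j) w) @[n --> \oo] --> expR (- V / 2) * cos 0 /\
  \int[P n]_w sin (\sum_(j < k) th j * Z n (t j) w) @[n --> \oo] --> expR (- V / 2) * sin 0.
Proof.
move=> tT V.
pose q := atom_mass leb2_measure (fun j => shifted_trawl_set a (t j)).
pose S n : R := Num.sqrt n%:R.
pose ex n := \sum_U q U * re_exponent (b n) (nu n) (\sum_(j in U) th j / S n).
pose be n := \sum_U q U * (im_exponent (gamma n) (nu n) (\sum_(j in U) th j / S n) -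
  levy_mean (nu n) (gamma n) * (\sum_(j in U) th j / S n)).
have cex : ex n @[n --> \oo] --> - V / 2.
  have -> : - V / 2 = \sum_U q U * - ((\sum_(j in U) th j) ^+ 2 / 2).
    transitivity (\sum_U (- 2^-1) * (q U * (\sum_(j in U) th j) ^+ 2)); last first.
      by apply: eq_bigr => U _; ring.
    rewrite -big_distrr /= (sum_atom_mass_square _ _ th).
    - rewrite mulNr mulNr mulrC; congr (- (_ * _)); apply: eq_bigr => i _; apply: eq_bigr => j _.
      by rewrite area_trawl_overlap.
    - by move=> j; have [] := finite_borel_shifted_trawl_set ha (t j).
    - by move=> j; have [] := finite_borel_shifted_trawl_set ha (t j).
  apply: (cvg_big add_continuous) => U _; apply: cvgM; first exact: cvg_cst.
  under eq_cvg do rewrite -mulr_suml; exact: re_exponent_asymptotics.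
have cre : expR (ex n) @[n --> \oo] --> expR (- V / 2).
  by apply: (cvg_comp ex (@expR R) cex); exact: continuous_expR.
have cim : be n @[n --> \oo] --> (0 : R).
  rewrite (_ : 0 = \sum_(U : {set 'I_k}) (q U * 0)); last by rewrite big1// => U _; rewrite mulr0.
  apply: (cvg_big add_continuous) => U _; apply: cvgM; first exact: cvg_cst.
  under eq_cvg do rewrite -mulr_suml; exact: im_exponent_asymptotics.
have key : \forall n \near \oo, char_polar (P n) (fun w => \sum_(j < k) th j * Z n (t j) w) (expR (ex n)) (be n).
  have ZE := rescaled_trawlE.
  near=> n.
  have n0 : (0 < n)%N by near: n; exact: nbhs_infty_gt.
  have := trawl_polar ha (hL n0) (mX n0) (hX n0) tT (fun j => th j / S n).
  have -> : (fun w => \sum_(j < k) th j / S n * (X n (t j) w - trawl_center a (gamma n) (nu n))) =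
            (fun w => \sum_(j < k) th j * Z n (t j) w).
    apply/funext => w; apply: eq_bigr => j _.
    have -> : Z n (t j) w = (X n (t j) w - trawl_center a (gamma n) (nu n)) / S n.
      by have := tT j; move: (t j) w; near: n; apply: filterS ZE => n' H u w' /H; exact.
    by rewrite mulrAC mulrA.
  exact.
split.
  apply: (@cvg_trans _ ((expR (ex n) * cos (be n)) @[n --> \oo])).
    by apply: near_eq_cvg; apply: filterS key => n [-> _].
  by apply: cvgM => //; apply: (cvg_comp be (@cos R) cim); exact: continuous_cos.
apply: (@cvg_trans _ ((expR (ex n) * sin (be n)) @[n --> \oo])).
  by apply: near_eq_cvg; apply: filterS key => n [_ ->].
by apply: cvgM => //; apply: (cvg_comp be (@sin R) cim); exact: continuous_sin.
Unshelve. all: by end_near. Qed.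

(** The limit is 1, so any bound above 1 holds eventually. *)
Let half_variance : \forall n \near \oo,
  (b n ^+ 2 / 2 + \int[nu n]_x (x ^+ 2)) / n%:R <= 2.
Proof.
have [_ l2] := second_moment_asymptotics hmom2.
have : (b n ^+ 2 / n%:R) / 2 + (\int[nu n]_x (x ^+ 2)) / n%:R @[n --> \oo] --> (0 / 2 + 1 : R).
  by apply: cvgD => //; apply: cvgM => //; exact: cvg_cst.
rewrite mul0r add0r => H.
have lt12 : (1 : R) < 2 by rewrite ltr1n.
apply: filterS (cvgr_le _ H 2 lt12) => n Hn.
by rewrite mulrDl mulrAC.
Qed.

Lemma rescaled_trawl_second_moment : \forall n \near \oo, forall t, 0 <= t <= T ->
  (\int[P n]_w (Z n t w ^+ 2)%:E <= (4 * tail_area a 0)%:E)%E.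
Proof.
have [i2 _] := second_moment_asymptotics hmom2.
have [i3 _] := third_moment_asymptotics hmom3.
have ZE := rescaled_trawlE.
have HV := half_variance.
near=> n; move=> t tT.
have n0 : (0 < n)%N by near: n; exact: nbhs_infty_gt.
have N0 : 0 < n%:R :> R by rewrite ltr0n.
have I2 : (nu n).-integrable setT (EFin \o (fun x : R => x ^+ 2)) by near: n.
have I3 : (nu n).-integrable setT (EFin \o (fun x : R => `|x| ^+ 3)) by near: n.
have E w : Z n t w = (X n t w - trawl_center a (gamma n) (nu n)) / Num.sqrt n%:R.
  by move: t tT w; near: n; apply: filterS ZE => n' H u /H; exact.
have V2 : (b n ^+ 2 / 2 + \int[nu n]_x (x ^+ 2)) / n%:R <= 2 by near: n.
under eq_integral => w _ do rewrite E exprMn exprVn (sqr_sqrtr (ltW N0)) mulrC EFinM.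
rewrite ge0_integralZl//; last 2 first.
- apply/measurable_EFinP; apply: measurable_funX; apply: measurable_funB => //.
  exact: mX.
- by move=> w _; rewrite lee_fin sqr_ge0.
have B2 := trawl_second_moment ha (hL n0) (mX n0) (hX n0) I2 I3 tT.
have N1 : (0 <= (n%:R^-1)%:E :> \bar R)%E by rewrite lee_fin invr_ge0 ltW.
apply: le_trans (lee_wpmul2l N1 B2) _.
rewrite -EFinM lee_fin.
have A0 := tail_area_ge0 ha (lexx 0).
rewrite [leLHS](_ : _ = 2 * (((b n ^+ 2 / 2 + \int[nu n]_x (x ^+ 2)) / n%:R) * tail_area a 0)); last by ring.
by rewrite [leRHS](_ : _ = 2 * (2 * tail_area a 0)); [rewrite ler_pM2l ?ltr0n// ler_wpM2r|ring].
Unshelve. all: by end_near. Qed.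

Context (C CT eps M : R).
Hypothesis C0 : 0 <= C.
Hypothesis eps0 : 0 < eps.
Hypothesis harea : forall h, 0 <= h -> tail_area a 0 - tail_area a h <= C * h `^ (1 / 2 + eps / 2).
Hypothesis hlebT : forall r s t, 0 <= r -> r <= s -> s <= t -> t <= T ->
     (leb2 ((shifted_trawl_set a s `\` shifted_trawl_set a t)
              `\` shifted_trawl_set a r)
        <= (CT * (t - r) `^ (1 + eps))%:E)%E.
Hypothesis hmom4 : forall n, (0 < n)%N ->
    (nu n).-integrable setT (EFin \o (fun x : R => x ^+ 4)) /\ (\int[nu n]_x (x ^+ 4)) / n%:R ^+ 2 <= M.

Lemma rescaled_trawl_three_point : \forall n \near \oo, forall r s t, 0 <= r -> r <= s -> s <= t -> t <= T ->
  (\int[P n]_w ((Z n s w - Z n r w) ^+ 2 * (Z n t w - Z n s w) ^+ 2)%:E <=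
     (4 * (M * CT + 4 * (8 * C) ^+ 2) * (t - r) `^ (1 + eps))%:E)%E.
Proof.
have [i2 _] := second_moment_asymptotics hmom2.
have [i3 _] := third_moment_asymptotics hmom3.
have ZE := rescaled_trawlE.
have HV := half_variance.
near=> n; move=> r s t r0 rs st tT.
have n0 : (0 < n)%N by near: n; exact: nbhs_infty_gt.
have N0 : 0 < n%:R :> R by rewrite ltr0n.
have I2 : (nu n).-integrable setT (EFin \o (fun x : R => x ^+ 2)) by near: n.
have I3 : (nu n).-integrable setT (EFin \o (fun x : R => `|x| ^+ 3)) by near: n.
have [I4 B4] := hmom4 n0.
have E u w : 0 <= u <= T -> Z n u w = (X n u w - trawl_center a (gamma n) (nu n)) / Num.sqrt n%:R.
  by move=> uT; move: u uT w; near: n; apply: filterS ZE => n' H u /H; exact.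
have V2 : (b n ^+ 2 / 2 + \int[nu n]_x (x ^+ 2)) / n%:R <= 2 by near: n.
have rT : 0 <= r <= T by rewrite r0 (le_trans rs) // (le_trans st).
have sT : 0 <= s <= T by rewrite (le_trans r0 rs) (le_trans st).
have tT' : 0 <= t <= T by rewrite (le_trans r0 (le_trans rs st)).
have EE w : (Z n s w - Z n r w) ^+ 2 * (Z n t w - Z n s w) ^+ 2 =
    n%:R ^- 2 * ((X n s w - X n r w) ^+ 2 * (X n t w - X n s w) ^+ 2).
  rewrite !E// -!mulrBl !exprMn !exprVn (sqr_sqrtr (ltW N0)).
  by rewrite !opprB !addrA !subrK; field; rewrite gt_eqF.
under eq_integral => w _ do rewrite EE EFinM.
have N1 : (0 <= (n%:R ^- 2)%:E :> \bar R)%E by rewrite lee_fin invr_ge0 exprn_ge0// ltW.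
rewrite ge0_integralZl//; last 2 first.
- apply/measurable_EFinP; apply: measurable_funM; apply: measurable_funX; apply: measurable_funB; exact: mX.
- by move=> w _; rewrite lee_fin mulr_ge0// sqr_ge0.
have B3 := trawl_three_point ha (hL n0) (mX n0) (hX n0) I2 I3 I4 r0 rs st tT.
apply: le_trans (lee_wpmul2l N1 B3) _.
rewrite -EFinM lee_fin.
set A := fine _; set M4 := (\int[nu n]_x (x ^+ 4)) in B4 *.
set D1 := tail_area a 0 - tail_area a (s - r); set D2 := tail_area a 0 - tail_area a (t - s).
set v2 : R := b n ^+ 2 / 2 + _ in V2 *.
have tr0 : 0 <= t - r by rewrite subr_ge0 (le_trans rs).
(* [p ^ 2] is [(t - r) ^ (1 + eps)]. As [D1] and [D2] are at most [C * p] and [v2 / n <= 2], the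
   quadratic term is at most [(8 * C * p) ^ 2]. *)
pose p : R := (t - r) `^ (1 / 2 + eps / 2).
have p0 : 0 <= p by exact: powR_ge0.
have e0 : 0 <= 1 / 2 + eps / 2 by rewrite addr_ge0 ?divr_ge0 // ltW.
have p2 : (t - r) `^ (1 + eps) = p ^+ 2.
  by rewrite /p -powR_mulrn ?powR_ge0// -powRrM; congr (_ `^ _); field.
have D1le : D1 <= C * p.
  apply: le_trans (harea _) _; first by rewrite subr_ge0.
  by rewrite ler_wpM2l// ge0_ler_powR// ?nnegrE ?subr_ge0// lerD2r.
have D2le : D2 <= C * p.
  apply: le_trans (harea _) _; first by rewrite subr_ge0.
  by rewrite ler_wpM2l// ge0_ler_powR// ?nnegrE ?subr_ge0// lerD2l lerN2.
have D10 : 0 <= D1.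
  by rewrite -lee_fin -(trawl_area_diff rs) measure_ge0.
have D20 : 0 <= D2.
  by rewrite -lee_fin -(trawl_area_diff st) measure_ge0.
have Ale : A <= CT * p ^+ 2.
  have h := hlebT r0 rs st tT; rewrite p2 in h.
  rewrite -lee_fin fineK// ge0_fin_numE; first exact: (le_lt_trans h (ltry _)).
  exact: (measure_ge0 leb2_measure).
have A0 : 0 <= A by rewrite fine_ge0//; exact: (measure_ge0 leb2_measure).
have v20 : 0 <= v2 / n%:R.
  apply: divr_ge0; last exact: ltW.
  apply: addr_ge0; first by rewrite divr_ge0// sqr_ge0.
  by apply: Rintegral_ge0 => x _; exact: sqr_ge0.
have M40 : 0 <= M4 / n%:R ^+ 2.
  apply: divr_ge0; last by rewrite exprn_ge0// ltW.
  by apply: Rintegral_ge0 => x _; rewrite (exprM x 2 2) sqr_ge0.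
have -> : n%:R ^- 2 * (4 * (M4 * A + 4 * (v2 * (2 * D1 + 2 * D2)) ^+ 2)) =
    4 * (M4 / n%:R ^+ 2 * A + 4 * (v2 / n%:R * (2 * D1 + 2 * D2)) ^+ 2).
  by field; rewrite gt_eqF.
have -> : 4 * (M * CT + 4 * (8 * C) ^+ 2) * (t - r) `^ (1 + eps) =
    4 * (M * (CT * p ^+ 2) + 4 * (2 * (4 * (C * p))) ^+ 2).
  by rewrite p2; ring.
rewrite ler_pM2l ?ltr0n//; apply: lerD; first exact: ler_pM.
rewrite ler_pM2l ?ltr0n// ler_sqr ?nnegrE.
- by apply: ler_pM => //; lra.
- by rewrite mulr_ge0// addr_ge0// mulr_ge0.
- by rewrite !mulr_ge0.
Unshelve. all: by end_near. Qed.

End TrawlLimit.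

Theorem theorem6 (R : realType) (T : R) (hT : 0 < T)
  (g a : R -> R)
  (hg : lebesgue_measure.-integrable `[0, +oo[ (EFin \o g))
  (hga : trawl_from_kernel g a)
  (ha : trawl_function a)
  (* the Levy bases and their characteristic triplets *)
  (d : nat -> measure_display) (Om : forall n, measurableType (d n))
  (P : forall n, probability (Om n) R)
  (L : forall n, set (measurableTypeR R * measurableTypeR R) -> Om n -> R)
  (gamma b : nat -> R)
  (nu : nat -> {measure set (measurableTypeR R) -> \bar R})
  (hb : forall n, (0 < n)%N -> 0 <= b n)
  (hnu : forall n, (0 < n)%N -> levy_measure (nu n))
  (hL : forall n, (0 < n)%N -> levy_basis (P n) (L n) (gamma n) (b n) (nu n))
  (* the trawl processes, as random elements of D[0,T] *)
  (X : forall n, R -> Om n -> R)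
  (hXcadlag : forall n, (0 < n)%N -> cadlag_process T (X n))
  (hX : forall n, (0 < n)%N -> forall t, 0 <= t <= T ->
     {ae P n, forall w, X n t w = L n (shifted_trawl_set a t) w})
  (* the conditions on the trawl *)
  (hmono : monotone_half_line a)
  (eps C CT : R) (heps : 0 < eps) (hC : 0 < C)
  (hCT : 0 < CT <= T `^ (- (1 + eps)))
  (hleb : forall s t, s <= t ->
     (leb2 (shifted_trawl_set a t `\` shifted_trawl_set a s)
        <= (C * (t - s) `^ (1 / 2 + eps / 2))%:E)%E)
  (hlebT : forall r s t, 0 <= r -> r <= s -> s <= t -> t <= T ->
     (leb2 ((shifted_trawl_set a s `\` shifted_trawl_set a t)
              `\` shifted_trawl_set a r)
        <= (CT * (t - r) `^ (1 + eps))%:E)%E)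
  (* the asymptotic conditions on the triplets *)
  (hmom2 : (\int[nu n]_x (x ^+ 2 / n%:R)%:E)%E @[n --> \oo] --> 1%E)
  (hmom3 : (\int[nu n]_x (`|x| ^+ 3 / (n%:R * Num.sqrt n%:R))%:E)%E
             @[n --> \oo] --> 0%E)
  (hgauss : b n ^+ 2 / n%:R @[n --> \oo] --> (0 : R))
  (hmom4 : exists M : R, forall n, (0 < n)%N ->
     (\int[nu n]_x (x ^+ 4 / n%:R ^+ 2)%:E <= M%:E)%E)
  (* the limit process, as a random element of D[0,T] *)
  (d' : measure_display) (Om' : measurableType d') (P' : probability Om' R)
  (B : R -> Om' -> R) (hB : two_sided_brownian_motion P' B)
  (Y : R -> Om' -> R) (hYcadlag : cadlag_process T Y)
  (hY : forall t, 0 <= t <= T ->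
     is_wiener_integral P' B (moving_average_kernel g t) (Y t)) :
  skorokhod_cvg_in_law T P
    (fun n t w => (X n t w - fine ('E_(P n)[X n t])%E) / Num.sqrt n%:R) P' Y.
Proof.
have harea h : 0 <= h -> tail_area a 0 - tail_area a h <= C * h `^ (1 / 2 + eps / 2).
  by move=> h0; have := hleb 0 h h0; rewrite (trawl_area_diff ha h0) lee_fin !subr0.
have [M M0 HM] := fourth_moment_bound hmom4.
have mX n (n0 : (0 < n)%N) : forall t, 0 <= t <= T -> measurable_fun setT (X n t) := (hXcadlag n n0).2.
have /andP[CT0 _] := hCT.
(* One constant for both processes: the first summand serves the Gaussian limit, the second the
   rescaled trawl processes. *)
pose K : R := 32 * C ^+ 2 + 4 * (M * CT + 4 * (8 * C) ^+ 2).
have K1 : 0 <= 4 * (M * CT + 4 * (8 * C) ^+ 2).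
  by rewrite mulr_ge0// addr_ge0// ?mulr_ge0 ?sqr_ge0// ltW.
have K2 : 0 <= 32 * C ^+ 2 by rewrite mulr_ge0// sqr_ge0.
have powle (c t : R) : c <= K -> ((c * t `^ (1 + eps))%:E <= (K * t `^ (1 + eps))%:E)%E.
  by move=> cK; rewrite lee_fin ler_wpM2r// powR_ge0.
have A0 := tail_area_ge0 ha (lexx 0).
(* The bound [4 * tail_area a 0] on second moments is that of the rescaled processes; the limit has
   variance at most [tail_area a 0]. *)
apply: (@skorokhod_cvg_in_law_of_chars R T K eps (4 * tail_area a 0)) => //.
- by rewrite /K addr_ge0.
- have ZE := rescaled_trawlE ha hL mX hX hmom2 hmom3.
  near=> n.
  have n0 : (0 < n)%N by near: n; exact: nbhs_infty_gt.
  have E : forall t, 0 <= t <= T -> forall w, (X n t w - fine ('E_(P n)[X n t])%E) / Num.sqrt n%:R =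
    (X n t w - trawl_center a (gamma n) (nu n)) / Num.sqrt n%:R by near: n; exact: ZE.
  split => [w|t tT].
    apply: (@cadlag_eq_on R T (fun t => (X n t w - trawl_center a (gamma n) (nu n)) / Num.sqrt n%:R)).
      by move=> t tT; rewrite E.
    by apply: cadlag_affine; have [+ _] := hXcadlag n n0; exact.
  by apply: measurable_funM => //; apply: measurable_funB => //; exact: mX.
- have Z3 := rescaled_trawl_three_point ha hL mX hX hmom2 hmom3 hgauss (ltW hC) heps harea hlebT HM.
  apply: filterS Z3 => n H r s t r0 rs st tT; apply: le_trans (H r s t r0 rs st tT) _.
  by apply: powle; rewrite /K lerDr.
- exact: (rescaled_trawl_second_moment ha hL mX hX hmom2 hmom3 hgauss).
- move=> r s t r0 rs st tT.
  apply: le_trans (gaussian_three_point hB hg hga ha hY harea r0 rs st tT (ltW hC) heps) _.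
  by apply: powle; rewrite /K lerDl.
- move=> s t s0 st tT.
  apply: le_trans (gaussian_fourth_moment hB hg hga ha hY harea s0 st tT (ltW hC)) _.
  by apply: powle; rewrite /K lerDl.
- move=> t tT; apply: le_trans (gaussian_second_moment hB hg hga ha hY tT) _.
  by rewrite lee_fin ler_peMl// ler1n.
- move=> k t th tT; have [-> _] := gaussian_polar hB hg hga ha hY th tT.
  by have [] := rescaled_trawl_char_limit ha hL mX hX hmom2 hmom3 hgauss th tT.
- move=> k t th tT; have [_ ->] := gaussian_polar hB hg hga ha hY th tT.
  by have [] := rescaled_trawl_char_limit ha hL mX hX hmom2 hmom3 hgauss th tT.
Unshelve. all: by end_near. Qed.
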